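(* In the setting described in the context, let $l$ be a positive integer and suppose given smooth maps $D=\mathcal R^{(0)}(D),\mathcal R^{(1)}(D),\dots,\mathcal R^{(l-1)}(D)\colon\mathcal T\to\mathrm D_k$ which satisfy the first $l$ steps of the recursion, i.e. for every $0\le j\le l-1$ $$d^F_{\mathcal T}\mathcal R^{(j)}(D)=\frac1{2k}\sum_{n=1}^{j}(ik)^n\bigl[b-(-1)^n\overline b,\ \mathcal R^{(j-n)}(D)\bigr]$$ (for $j=0$ this reads $d^F_{\mathcal T}D=0$). Then the right-hand side of the next step of the recursion is closed: $$d^F_{\mathcal T}\Biggl(\sum_{n=1}^{l}(ik)^n\bigl[b-(-1)^n\overline b,\ \mathcal R^{(l-n)}(D)\bigr]\Biggr)=0 .$$
   Context: Setting. $(\mathcal M,\omega)$ is a symplectic manifold with $H^1(\mathcal M,\mathbb R)=0$ and with a pre-quantum line bundle $\mathscr L$, i.e. a Hermitian line bundle with compatible connection $\nabla$ of curvature $-i\omega$; $\mathscr L^k=\mathscr L^{\otimes k}$, $k$ a fixed positive integer. $\mathcal T$ is a complex manifold and $J\colon\mathcal T\to C^\infty(\mathcal M,\operatorname{End}(T\mathcal M))$ is a smooth family of integrable almost complex structures such that, for each $\sigma\in\mathcal T$, $J_\sigma$, $\omega$ and $g_\sigma=\omega(\cdot,J_\sigma\cdot)$ form a Kähler structure; $(\mathcal M,J_\sigma)$ has no non-constant holomorphic functions and no non-zero holomorphic vector fields. $d_{\mathcal T}$ is the exterior differential on $\mathcal T$, $d$ that on $\mathcal M$. There is given a Ricci potential: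 a real-valued smooth function $F$ on $\mathcal M\times\mathcal T$ and a real constant $\lambda$ such that, for each $\sigma$, $2i\partial\overline\partial F=\rho-\lambda\omega$ on $\mathcal M$, with $\rho$ the Ricci form of $g_\sigma$. For $V$ tangent to $\mathcal T$, let $\tilde g$ be the inverse of $g$ and $\tilde G(V)=-V[\tilde g]$, which decomposes as $\tilde G(V)=G(V)+\overline G(V)$ into parts of type $(2,0)$ and $(0,2)$ on $\mathcal M$. It is assumed that $J$ is holomorphic ($G$ is a $(1,0)$-form and $\overline G$ a $(0,1)$-form on $\mathcal T$) and rigid ($G(V)$ is a holomorphic tensor field on $\mathcal M$ for every $V$). For a symmetric bivector field $B$ on $\mathcal M$ put $\Delta_B=\nabla^2_B+\nabla_{\delta B}$ acting on sections of $\mathscr L^k$, where $\nabla^2_B=B^{\mu\nu}\nabla_\mu\nabla_\nu$ (using the Levi-Civita connection and the connection on $\mathscr L^k$) and $(\delta B)^\nu=\nabla_\mu B^{\mu\nu}$. Writing $V=V'+V''$ for the decomposition into $(1,0)$ and $(0,1)$ parts on $\mathcal T$, define the operator-valued $1$-forms on $\mathcal T$ $$b(V)=\Delta_{G(V)}+2\nabla_{G(V)\cdot dF}-2\lambda V'[F],\qquad \overline b(V)=\Delta_{\overline G(V)}+2\nabla_{\overline G(V)\cdot dF}-2\lambda V''[F].$$ It is known that, for every $t=k+is$, $s\in\mathbb R$, the Hitchin-Witten connection $\tilde{\boldsymbol\nabla}=\nabla^{\mathrm{Tr}}+\frac1{2t}b-\frac1{2\overline t}\overline b+d_{\mathcal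 T}F$ on $C^\infty(\mathcal M,\mathscr L^k)\times\mathcal T\to\mathcal T$ ($\nabla^{\mathrm{Tr}}$ the trivial connection) has curvature with values in central operators, and that $[b\wedge b]$ and $[\overline b\wedge\overline b]$ take values in central operators. $\mathrm D_k$ is the algebra of finite-order differential operators acting on $C^\infty(\mathcal M,\mathscr L^k)$. A map $D\colon\mathcal T\to\mathrm D_k$ is smooth if $D\psi$ is smooth on $\mathcal M\times\mathcal T$ for every smooth section $\psi$. For $\mathrm D_k$-valued forms on $\mathcal T$, $[\cdot\wedge\cdot]$ is the wedge product combined with the commutator, and $d^F_{\mathcal T}\varphi=d_{\mathcal T}\varphi+[d_{\mathcal T}F\wedge\varphi]$ is the twisted exterior differential, where functions are identified with their multiplication operators. *)

(* Defs.v *)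
From HB Require Import structures.
From mathcomp Require Import all_boot all_order all_algebra complex.
From mathcomp Require Import boolp classical_sets functions cardinality reals.
From mathcomp Require Import topology normedtype derive.

Set Implicit Arguments.
Unset Strict Implicit.
Unset Printing Implicit Defensive.

Import Order.TTheory GRing.Theory Num.Theory numFieldNormedType.Exports.
Local Open Scope classical_set_scope.
Local Open Scope complex_scope.
Local Open Scope ring_scope.

(* Manifolds are given by atlases and tensor fields by their components in every
   chart of the atlas. Components are junk off the chart domain. A vector is X^mu, a covector is a row alpha_mu, a 2-tensor matrix A mu nu is
   A_{mu nu} (forms, metrics) or A^{mu nu} (bivectors), and an endomorphism
   matrix J mu nu is J^mu_nu, acting on column vectors. *)

Section SmoothMaps.
Variables (R : realType) (E F : normedModType R).

Fixpoint iterD (vs : seq E) (f : E -> F) : E -> F :=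
  if vs is v :: vs' then iterD vs' (fun x => 'D_v f x) else f.

(* C^oo on an open set U of a finite-dimensional space. *)
Definition smooth_on (U : set E) (f : E -> F) : Prop :=
  forall (vs : seq E) (x : E), U x ->
    {for x, continuous (iterD vs f)} /\
    (forall v : E, derivable (iterD vs f) x v).

End SmoothMaps.

(* Derivative along a real direction of a complex-valued function. *)
Definition derivC (R : realType) (E : normedModType R) (v : E)
    (f : E -> R[i]) (x : E) : R[i] :=
  ('D_v (fun y => complex.Re (f y)) x) +i* ('D_v (fun y => complex.Im (f y)) x).

Record manifold (R : realType) (E : normedModType R) := Manifold {
  points :> topologicalType;
  atlas : Type;
  dom : atlas -> set points;
  coord : atlas -> points -> E;
  icoord : atlas -> E -> points;
  _ : hausdorff_space points;
  _ : @second_countable points;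
  _ : forall x, exists c, dom c x;
  _ : forall c, open (dom c);
  _ : forall c, open (coord c @` dom c);
  _ : forall c x, dom c x -> icoord c (coord c x) = x;
  _ : forall c x, dom c x -> {for x, continuous (coord c)};
  _ : forall c y, (coord c @` dom c) y -> {for y, continuous (icoord c)};
  _ : forall c c', smooth_on (coord c @` (dom c `&` dom c'))
                             (coord c' \o icoord c) }.

(* C^n as pairs (x, y) standing for x + i y; j0 is multiplication by i. *)
Definition j0 (R : realType) (n : nat) (z : 'rV[R]_n * 'rV[R]_n) :
  'rV[R]_n * 'rV[R]_n := (- z.2, z.1).

Record complex_manifold (R : realType) (n : nat) := ComplexManifold {
  cm_manifold :> manifold ('rV[R]_n * 'rV[R]_n)%type;
  _ : forall (d d' : atlas cm_manifold) z v,
        (coord d @` (dom d `&` dom d')) z ->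
        'D_(j0 v) (coord d' \o icoord d) z
        = j0 ('D_v (coord d' \o icoord d) z) }.

Section Calculus.
Variables (R : realType) (EM ET : normedModType R).
Variables (M : manifold EM) (T : manifold ET).

Definition smooth (W : set M) (f : M -> R) : Prop :=
  forall c : atlas M, smooth_on (coord c @` (dom c `&` W)) (f \o icoord c).

Definition csmooth (W : set M) (f : M -> R[i]) : Prop :=
  smooth W (fun x => complex.Re (f x)) /\ smooth W (fun x => complex.Im (f x)).

(* Smoothness on the open subset W x T of M x T. *)
Definition smooth2 (W : set M) (f : M -> T -> R) : Prop :=
  forall (c : atlas M) (d : atlas T),
    smooth_on ((coord c @` (dom c `&` W)) `*` (coord d @` dom d))
      (fun p : (EM * ET)%type => f (icoord c p.1) (icoord d p.2)).

Definition csmooth2 (W : set M) (f : M -> T -> R[i]) : Prop :=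
  smooth2 W (fun x s => complex.Re (f x s)) /\
  smooth2 W (fun x s => complex.Im (f x s)).

(* V[f] at x, for V the vector field with constant components v in chart c. *)
Definition vder (c : atlas M) (v : EM) (f : M -> R) (x : M) : R :=
  'D_v (f \o icoord c) (coord c x).

Definition vderC (c : atlas M) (v : EM) (f : M -> R[i]) (x : M) : R[i] :=
  derivC v (f \o icoord c) (coord c x).

End Calculus.

Section Tensors.
Variables (R : realType) (m : nat) (M : manifold 'rV[R]_m).
Local Notation toC := (map_mx (fun a : R => a%:C)).

Definition pd (c : atlas M) (mu : 'I_m) (f : M -> R) (x : M) : R :=
  vder c (delta_mx 0 mu) f x.

Definition pdC (c : atlas M) (mu : 'I_m) (f : M -> R[i]) (x : M) : R[i] :=
  vderC c (delta_mx 0 mu) f x.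

(* d x_{c'}^mu / d x_c^nu *)
Definition jac (c c' : atlas M) (x : M) : 'M[R]_m :=
  \matrix_(mu, nu) pd c nu (fun y => coord c' y 0 mu) x.

Record one_form (al : atlas M -> M -> 'rV[R]_m) : Prop := OneForm {
  one_form_smooth : forall c mu, smooth (dom c) (fun x => al c x 0 mu);
  one_form_change : forall c c' x, dom c x -> dom c' x ->
    al c x = al c' x *m jac c c' x }.

Definition H1_zero : Prop :=
  forall al, one_form al ->
    (forall c x mu nu, dom c x ->
      pd c mu (fun y => al c y 0 nu) x = pd c nu (fun y => al c y 0 mu) x) ->
    exists2 f : M -> R, smooth setT f &
      forall c x mu, dom c x -> al c x 0 mu = pd c mu f x.

Record symplectic (om : atlas M -> M -> 'M[R]_m) : Prop := Symplectic {
  symp_smooth : forall c mu nu, smooth (dom c) (fun x => om c x mu nu);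
  symp_change : forall c c' x, dom c x -> dom c' x ->
    om c x = (jac c c' x)^T *m om c' x *m jac c c' x;
  symp_skew : forall c x, dom c x -> (om c x)^T = - om c x;
  symp_nondeg : forall c x, dom c x -> om c x \in unitmx;
  symp_closed : forall c x (ka mu nu : 'I_m), dom c x ->
    pd c ka (fun y => om c y mu nu) x + pd c mu (fun y => om c y nu ka) x
    + pd c nu (fun y => om c y ka mu) x = 0 }.

(* A Hermitian line bundle L with compatible connection, through unitary local
   frames e_i over an open cover: e_j = g_ij e_i, so that a section s = s_i e_i
   satisfies s_i = g_ij s_j, and nabla s = (d s_i + theta_i s_i) e_i. *)
Record herm_line_bundle := HermLineBundle {
  frame : Type;
  fdom : frame -> set M;
  trans : frame -> frame -> M -> R[i];
  theta : frame -> atlas M -> M -> 'rV[R[i]]_m;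
  _ : forall x, exists i, fdom i x;
  _ : forall i, open (fdom i);
  _ : forall i j, csmooth (fdom i `&` fdom j) (trans i j);
  _ : forall i j x, fdom i x -> fdom j x -> `|trans i j x| = 1;
  _ : forall i x, fdom i x -> trans i i x = 1;
  _ : forall i j l x, fdom i x -> fdom j x -> fdom l x ->
        trans i j x * trans j l x = trans i l x;
  _ : forall i c mu, csmooth (fdom i `&` dom c) (fun x => theta i c x 0 mu);
  _ : forall i c c' x, fdom i x -> dom c x -> dom c' x ->
        theta i c x = theta i c' x *m toC (jac c c' x);
  (* compatibility with the Hermitian structure *)
  _ : forall i c x mu, fdom i x -> dom c x ->
        complex.Re (theta i c x 0 mu) = 0;
  _ : forall i j c x mu, fdom i x -> fdom j x -> dom c x ->
        trans i j x * (theta j c x 0 mu - theta i c x 0 mu)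
        = pdC c mu (trans i j) x }.

(* curvature - i om *)
Definition prequantum (om : atlas M -> M -> 'M[R]_m) (L : herm_line_bundle) :
    Prop :=
  forall (i : frame L) c x mu nu, fdom i x -> dom c x ->
    pdC c mu (fun y => theta i c y 0 nu) x
    - pdC c nu (fun y => theta i c y 0 mu) x = - 'i%C * (om c x mu nu)%:C.

Section Kahler.
Variables (ET : normedModType R) (T : manifold ET).
Variables (om : atlas M -> M -> 'M[R]_m) (J : atlas M -> M -> T -> 'M[R]_m).

Definition metric (c : atlas M) (x : M) (s : T) : 'M[R]_m :=
  om c x *m J c x s.

Definition inv_metric c x s : 'M[R]_m := invmx (metric c x s).

Definition nijenhuis (c : atlas M) (x : M) (s : T) (la mu nu : 'I_m) : R :=
  \sum_ka (J c x s ka mu * pd c ka (fun y => J c y s la nu) x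
           - J c x s ka nu * pd c ka (fun y => J c y s la mu) x
           - J c x s la ka * (pd c mu (fun y => J c y s ka nu) x
                              - pd c nu (fun y => J c y s ka mu) x)).

Record kahler_family : Prop := KahlerFamily {
  kah_smooth : forall c mu nu, smooth2 (dom c) (fun x s => J c x s mu nu);
  kah_change : forall c c' x s, dom c x -> dom c' x ->
    J c' x s *m jac c c' x = jac c c' x *m J c x s;
  kah_acs : forall c x s, dom c x -> J c x s *m J c x s = - 1%:M;
  kah_integrable : forall c x s la mu nu, dom c x ->
    nijenhuis c x s la mu nu = 0;
  kah_sym : forall c x s, dom c x -> (metric c x s)^T = metric c x s;
  kah_pos : forall c x s (v : 'cV[R]_m), dom c x -> v != 0 ->
    0 < (v^T *m metric c x s *m v) 0 0 }.

(* Projections of the complexified tangent space onto types (1,0), (0,1). *)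
Definition proj10 c x s : 'M[R[i]]_m :=
  (2%:R)^-1 *: (1%:M - 'i%C *: toC (J c x s)).
Definition proj01 c x s : 'M[R[i]]_m :=
  (2%:R)^-1 *: (1%:M + 'i%C *: toC (J c x s)).

Definition holomorphic (s : T) (U : set M) (f : M -> R[i]) : Prop :=
  csmooth U f /\
  forall c x mu, U x -> dom c x ->
    \sum_nu pdC c nu f x * (J c x s nu mu)%:C = 'i%C * pdC c mu f x.

Definition only_constant_holomorphic_functions : Prop :=
  forall (s : T) (f : M -> R[i]), holomorphic s setT f ->
    exists a, forall x, f x = a.

Record holomorphic_vector_field (s : T) (X : atlas M -> M -> 'cV[R[i]]_m) :
    Prop := HolVectorField {
  hvf_smooth : forall c mu, csmooth (dom c) (fun x => X c x mu 0);
  hvf_change : forall c c' x, dom c x -> dom c' x ->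
    X c' x = toC (jac c c' x) *m X c x;
  hvf_type : forall c x, dom c x -> proj10 c x s *m X c x = X c x;
  (* X maps local holomorphic functions to holomorphic functions *)
  hvf_hol : forall c (U : set M) f, open U -> U `<=` dom c ->
    holomorphic s U f ->
    holomorphic s U (fun x => \sum_mu X c x mu 0 * pdC c mu f x) }.

Definition no_holomorphic_vector_fields : Prop :=
  forall (s : T) X, holomorphic_vector_field s X ->
    forall c x, dom c x -> X c x = 0.

(* Gamma^la_{mu nu} *)
Definition christoffel (c : atlas M) (x : M) (s : T) (la mu nu : 'I_m) : R :=
  (2%:R)^-1 * \sum_ka inv_metric c x s la ka *
     (pd c mu (fun y => metric c y s nu ka) x
      + pd c nu (fun y => metric c y s mu ka) x
      - pd c ka (fun y => metric c y s mu nu) x).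

Definition ricci (c : atlas M) (x : M) (s : T) : 'M[R]_m :=
  \matrix_(mu, nu) \sum_la
    (pd c la (fun y => christoffel c y s la mu nu) x
     - pd c nu (fun y => christoffel c y s la mu la) x
     + \sum_ka (christoffel c x s la la ka * christoffel c x s ka mu nu
                - christoffel c x s la nu ka * christoffel c x s ka mu la)).

(* rho = Ric(J . , . ), matching om = g(J . , . ) *)
Definition ricci_form c x s : 'M[R]_m := (J c x s)^T *m ricci c x s.

Variable F : M -> T -> R.

Definition dbarF (c : atlas M) (x : M) (s : T) : 'rV[R[i]]_m :=
  (\row_mu (pd c mu (F ^~ s) x)%:C) *m proj01 c x s.

(* The (1,1) part of d (dbar F). *)
Definition ddbarF (c : atlas M) (x : M) (s : T) : 'M[R[i]]_m :=
  let A := \matrix_(mu, nu) (pdC c mu (fun y => dbarF c y s 0 nu) x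
                             - pdC c nu (fun y => dbarF c y s 0 mu) x) in
  (proj10 c x s)^T *m A *m proj01 c x s + (proj01 c x s)^T *m A *m proj10 c x s.

Definition ricci_potential (lam : R) : Prop :=
  smooth2 setT F /\
  forall c x s, dom c x ->
    (2%:R * 'i%C) *: ddbarF c x s = toC (ricci_form c x s - lam *: om c x).

(* - V[inverse metric], for V with constant components v in the chart d of T *)
Definition Gtilde (c : atlas M) (d : atlas T) (v : ET) (x : M) (s : T) :
    'M[R]_m :=
  \matrix_(mu, nu) - vder d v (fun t => inv_metric c x t mu nu) s.

Definition G c d v x s : 'M[R[i]]_m :=
  proj10 c x s *m toC (Gtilde c d v x s) *m (proj10 c x s)^T.

Definition Gbar c d v x s : 'M[R[i]]_m :=
  proj01 c x s *m toC (Gtilde c d v x s) *m (proj01 c x s)^T.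

(* G(V)(df, dh) is holomorphic for all local holomorphic f, h, i.e. the
   components of G(V) in holomorphic coordinates are holomorphic. *)
Definition rigid : Prop :=
  forall c d v s (U : set M) f h, dom d s -> open U -> U `<=` dom c ->
    holomorphic s U f -> holomorphic s U h ->
    holomorphic s U (fun x => \sum_mu \sum_nu
      G c d v x s mu nu * pdC c mu f x * pdC c nu h x).

End Kahler.
End Tensors.

Arguments herm_line_bundle {R m} M.

Section HolomorphicFamily.
Variables (R : realType) (m n : nat).
Variables (M : manifold 'rV[R]_m) (T : complex_manifold R n).

Definition holomorphic_family (om : atlas M -> M -> 'M[R]_m)
    (J : atlas M -> M -> T -> 'M[R]_m) : Prop :=
  forall c (d : atlas T) v x s, dom c x -> dom d s ->
    G om J c d (j0 v) x s = 'i%C *: G om J c d v x s /\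
    Gbar om J c d (j0 v) x s = - 'i%C *: Gbar om J c d v x s.

(* V'[f] and V''[f] *)
Definition vder10 (d : atlas T) (v : 'rV[R]_n * 'rV[R]_n) (f : T -> R) (s : T) :
    R[i] :=
  (2%:R)^-1 * ((vder d v f s)%:C - 'i%C * (vder d (j0 v) f s)%:C).

Definition vder01 (d : atlas T) (v : 'rV[R]_n * 'rV[R]_n) (f : T -> R) (s : T) :
    R[i] :=
  (2%:R)^-1 * ((vder d v f s)%:C + 'i%C * (vder d (j0 v) f s)%:C).

End HolomorphicFamily.

Section Operators.
Variables (R : realType) (m : nat) (M : manifold 'rV[R]_m).
Variables (L : herm_line_bundle M) (k : nat).
(* The local coefficient functions s_i of a section s. An operator is a function
   on all such families, of which only the values on smooth sections matter: two
   operators are identified when they agree on smooth sections (opeq). *)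
Local Notation sec := (frame L -> M -> R[i]).
Local Notation op := (sec -> sec).

(* A section of L^{(x) k}; the junk values s_i x, x outside fdom i, are 0. *)
Definition cocycle_section (s : sec) : Prop :=
  (forall i x, ~ fdom i x -> s i x = 0) /\
  (forall i j x, fdom i x -> fdom j x -> s i x = trans i j x ^+ k * s j x).

Definition smooth_section (s : sec) : Prop :=
  cocycle_section s /\ forall i, csmooth (fdom i) (s i).

Definition opeq (D D' : op) : Prop :=
  forall s, smooth_section s -> D s = D' s.

Definition comm (D D' : op) : op := fun s => D (D' s) - D' (D s).

Definition mulop (f : M -> R[i]) : op := fun s i x => f x * s i x.

Definition opscale (a : R[i]) (D : op) : op := fun s i x => a * D s i x.

(* Differential operators of order < r: all r-fold iterated commutators with
   functions vanish. *)
Fixpoint order_lt (r : nat) (D : op) : Prop :=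
  if r is r'.+1 then
    forall f : M -> R[i], csmooth setT f -> order_lt r' (comm D (mulop f))
  else opeq D 0.

Record Dk (D : op) : Prop := IsDk {
  Dk_stable : forall s, smooth_section s -> smooth_section (D s);
  Dk_linear : forall (a : R[i]) s s', smooth_section s -> smooth_section s' ->
    D (fun i x => a * s i x + s' i x) = (fun i x => a * D s i x + D s' i x);
  Dk_order : exists r, order_lt r D }.

Definition central (K : op) : Prop :=
  Dk K /\ forall D, Dk D -> opeq (comm K D) 0.

Section Covariant.
Variables (ET : normedModType R) (T : manifold ET).
Variables (om : atlas M -> M -> 'M[R]_m) (J : atlas M -> M -> T -> 'M[R]_m).

(* The operators below act on the local coefficient u = s_i, in the chart c. *)
Definition nab (i : frame L) (c : atlas M) (mu : 'I_m) (u : M -> R[i]) (x : M) :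
    R[i] :=
  pdC c mu u x + k%:R * theta i c x 0 mu * u x.

Definition nab2 i c (s : T) (mu nu : 'I_m) (u : M -> R[i]) (x : M) : R[i] :=
  nab i c mu (nab i c nu u) x
  - \sum_la (christoffel om J c x s la mu nu)%:C * nab i c la u x.

Definition div_bivector c (s : T) (B : M -> 'M[R[i]]_m) (x : M) (nu : 'I_m) :
    R[i] :=
  \sum_mu (pdC c mu (fun y => B y mu nu) x
    + \sum_la ((christoffel om J c x s mu mu la)%:C * B x la nu
               + (christoffel om J c x s nu mu la)%:C * B x mu la)).

Definition Delta i c (s : T) (B : M -> 'M[R[i]]_m) (u : M -> R[i]) (x : M) :
    R[i] :=
  \sum_mu \sum_nu B x mu nu * nab2 i c s mu nu u x
  + \sum_nu div_bivector c s B x nu * nab i c nu u x.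

(* nabla_{B . dF} *)
Definition nab_grad i c (s : T) (F : M -> T -> R) (B : M -> 'M[R[i]]_m)
    (u : M -> R[i]) (x : M) : R[i] :=
  \sum_mu (\sum_nu B x mu nu * (pd c nu (F ^~ s) x)%:C) * nab i c mu u x.

End Covariant.

Section FormsOnT.
Variables (n : nat) (T : complex_manifold R n).
Local Notation vec := ('rV[R]_n * 'rV[R]_n)%type.
(* Operator-valued 1-forms on T: phi d v s is phi(V) at s, for V the tangent
   vector with components v in the chart d at s. *)
Local Notation form1 := (atlas T -> vec -> T -> op).

Definition smooth_family (psi : T -> sec) : Prop :=
  (forall s, cocycle_section (psi s)) /\
  (forall i, csmooth2 (fdom i) (fun x s => psi s i x)).

(* Smooth maps T -> D_k; psi ranges over the smooth sections over M x T. *)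
Definition smooth_op (D : T -> op) : Prop :=
  (forall s, Dk (D s)) /\
  (forall psi, smooth_family psi -> smooth_family (fun s => D s (psi s))).

(* V[D] *)
Definition opder (d : atlas T) (v : vec) (D : T -> op) (s : T) : op :=
  fun psi i x => vderC d v (fun t => D t psi i x) s.

(* [al /\ be](V, W) *)
Definition wedge_comm (al be : form1) (d : atlas T) (v w : vec) (s : T) : op :=
  comm (al d v s) (be d w s) - comm (al d w s) (be d v s).

(* d phi (V, W) for V, W with constant components in d, so that [V, W] = 0. *)
Definition dT1 (phi : form1) (d : atlas T) (v w : vec) (s : T) : op :=
  opder d v (phi d w) s - opder d w (phi d v) s.

Variable F : M -> T -> R.

Definition dTF : form1 := fun d v s => mulop (fun x => (vder d v (F x) s)%:C).

Definition dF0 (D : T -> op) : form1 :=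
  fun d v s => opder d v D s + comm (dTF d v s) (D s).

Definition dF1 (phi : form1) (d : atlas T) (v w : vec) (s : T) : op :=
  dT1 phi d v w s + wedge_comm dTF phi d v w s.

(* b is the operator-valued form b(V): the condition gives its expression in
   every chart and every local frame. *)
Definition is_b (om : atlas M -> M -> 'M[R]_m)
    (J : atlas M -> M -> T -> 'M[R]_m) (lam : R) (b : form1) : Prop :=
  forall (d : atlas T) v s psi i x, dom d s -> smooth_section psi ->
    (~ fdom i x -> b d v s psi i x = 0) /\
    (forall c, fdom i x -> dom c x ->
      let B := fun y => G om J c d v y s in
      b d v s psi i x
      = Delta om J i c s B (psi i) x
        + 2%:R * nab_grad i c s F B (psi i) x
        - 2%:R * lam%:C * vder10 d v (F x) s * psi i x).

Definition is_bbar (om : atlas M -> M -> 'M[R]_m)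
    (J : atlas M -> M -> T -> 'M[R]_m) (lam : R) (bbar : form1) : Prop :=
  forall (d : atlas T) v s psi i x, dom d s -> smooth_section psi ->
    (~ fdom i x -> bbar d v s psi i x = 0) /\
    (forall c, fdom i x -> dom c x ->
      let B := fun y => Gbar om J c d v y s in
      bbar d v s psi i x
      = Delta om J i c s B (psi i) x
        + 2%:R * nab_grad i c s F B (psi i) x
        - 2%:R * lam%:C * vder01 d v (F x) s * psi i x).

Variables b bbar : form1.

(* The connection form of the Hitchin-Witten connection, t = k + i sg. *)
Definition HW_form (sg : R) : form1 := fun d v s =>
  let t := k%:R +i* sg in
  opscale (2%:R * t)^-1 (b d v s) - opscale (2%:R * (t^*)%C)^-1 (bbar d v s)
  + dTF d v s.

(* d A + 1/2 [A /\ A] *)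
Definition HW_curvature (sg : R) (d : atlas T) (v w : vec) (s : T) : op :=
  dT1 (HW_form sg) d v w s
  + opscale (2%:R)^-1 (wedge_comm (HW_form sg) (HW_form sg) d v w s).

(* sum_{n=1}^j (i k)^n [b - (-1)^n bbar, RR (j - n)] *)
Definition recursion_sum (RR : nat -> T -> op) (j : nat) : form1 :=
  fun d v s => \sum_(1 <= p < j.+1)
    opscale (('i%C * k%:R) ^+ p)
      (comm (b d v s - opscale ((-1) ^+ p) (bbar d v s)) (RR (j - p)%N s)).

End FormsOnT.
End Operators.

(* Main.v *)
From Pilot Require Import Defs.
From HB Require Import structures.
From mathcomp Require Import all_boot all_order all_algebra complex zify ring lra.
From mathcomp Require Import boolp classical_sets functions reals constructive_ereal.
From mathcomp Require Import topology normedtype derive realfun sequences exp.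
From mathcomp Require Import measure lebesgue_measure lebesgue_integral ftc.
(* poly has a derivC too: the one of Defs has to come last. *)
Import Pilot.Defs.
Set Implicit Arguments.
Unset Strict Implicit.
Unset Printing Implicit Defensive.
Import Order.TTheory GRing.Theory Num.Theory numFieldNormedType.Exports.
Local Open Scope classical_set_scope.
Local Open Scope complex_scope.
Local Open Scope ring_scope.

(* Modulo central operators, the curvature of the Hitchin-Witten connection at
   t = k + i sg is a polynomial in sg, up to a factor; its coefficients give
   d^F b = - d^F bbar and [b /\ bbar] = 4 k d^F b. With these relations, the
   Leibniz rule for d^F and the recursion, the closedness becomes an identity
   in the Lie algebra of operators on smooth sections: the coefficient of
   (i k)^N is a sum over p + r = N of [[x_p(W), x_r(V)], R^(l - N)(D)], where
   x_p = b - (-1)^p bbar, and the sum over 0 < p < N of (-1)^p is 0 or -1.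

   The analytic input is the Leibniz rule V[D psi] = V[D] psi + D (V psi) for
   a smooth map D to operators. It needs no local expression of D: by
   Hadamard's lemma psi_t = psi_s + sum_a z_a(t) g_a(t) near s, with smooth
   families g_a and coordinates z_a centred at s, so D psi can be
   differentiated at s because D is linear and preserves smooth families. *)

(** * Directional derivatives *)

(** [smooth_op] is tested only on smooth families over all of M x T, whereas Hadamard's families
    exist only near one point; bump functions on T bridge this gap. Smoothness of b and bbar in T
    has to be read off their coefficients. Both kinds of operators are put under one local notion,
    [locop]: linear on smooth sections, and sending smooth families over an open set of a chart
    space to smooth families. Smoothness itself is given through iterated directional derivatives,
    so linearity of the derivative in its direction, the chain rule and differentiation under the
    integral are established in that form. Centrality is a statement about brackets with elements of
    D_k. Hence the relations between d^F b, d^F bbar and [b /\ bbar] hold only after a bracket with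
    some R^(j)(D), and the algebra is arranged so that these forms occur only there. *)

Lemma cvg_dnbhs0P (R : realType) (phi : R -> R) (a : R) :
  phi @ 0^' --> a <->
  forall e : R, 0 < e -> exists2 d : R, 0 < d &
    forall h, h != 0 -> `|h| < d -> `|phi h - a| < e.
Proof.
split=> [H e e0|H].
  have /= := (@cvgrPdist_lt _ _ _ _ _ phi a).1 H e e0.
  move=> [d /= d0 Hd]; exists d => // h h0 hd.
  rewrite distrC; apply: Hd => //=; by rewrite sub0r normrN.
apply/cvgrPdist_lt => e /H[d d0 Hd].
exists d => //= h; rewrite /= sub0r normrN => hd h0.
by rewrite distrC; apply: Hd.
Qed.

Lemma continuousP_dist (R : realType) (V W : normedModType R) (f : V -> W)
    (x : V) :
  {for x, continuous f} <->
  forall e : R, 0 < e -> exists2 d : R, 0 < d &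
    forall y, `|y - x| < d -> `|f y - f x| < e.
Proof.
split=> [H e e0|H].
  have /= := (@cvgrPdist_lt _ _ _ _ _ f (f x)).1 H e e0.
  move=> /(_ (nbhs_filter x)) /(nbhs_normP x)[d /= d0 Hd]; exists d => // h hd.
  rewrite distrC; by apply: Hd; rewrite /ball_ /= distrC.
apply/cvgrPdist_lt => e /H[d d0 Hd].
apply/nbhs_normP; exists d => //= h; rewrite /ball_ /= distrC => hd.
by rewrite distrC; apply: Hd.
Qed.

Lemma open_dist (R : realType) (V : normedModType R) (U : set V) (x : V) :
  open U -> U x -> exists2 d : R, 0 < d & forall y, `|y - x| < d -> U y.
Proof.
move=> oU Ux; have /(nbhs_normP x)[d /= d0 H] := open_nbhs_nbhs (conj oU Ux).
exists d => // y yx.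
by apply: H; rewrite /ball_ /= distrC.
Qed.

Section DirectionalDerivative.
Variables (R : realType) (E : normedModType R).
Implicit Types (f : E -> R) (U : set E).

Lemma derive_cvg f (x v : E) (a : R) :
  (fun h => h^-1 *: (f (h *: v + x) - f x)) @ 0^' --> a ->
  derivable f x v /\ 'D_v f x = a.
Proof.
move=> H; split; first by apply/cvg_ex; exists a.
exact: (cvg_lim (@Rhausdorff R) H).
Qed.

Lemma derivable_dist f (x v : E) : derivable f x v ->
  forall e : R, 0 < e -> exists2 d : R, 0 < d & forall h, h != 0 -> `|h| < d ->
    `|h^-1 * (f (h *: v + x) - f x) - 'D_v f x| < e.
Proof.
move=> df; have := df; rewrite /derivable -/('D_v f x) => H.
have : (fun h => h^-1 *: (f (h *: v + x) - f x)) @ 0^' --> 'D_v f x by exact: H.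
by move/cvg_dnbhs0P.
Qed.

Lemma derive_dist f (x v : E) (a : R) :
  (forall e : R, 0 < e -> exists2 d : R, 0 < d & forall h, h != 0 -> `|h| < d ->
    `|h^-1 * (f (h *: v + x) - f x) - a| < e) ->
  derivable f x v /\ 'D_v f x = a.
Proof. by move=> H; apply: derive_cvg; apply/cvg_dnbhs0P. Qed.

Lemma derive_line f (y v : E) (s : R) :
  (derivable (fun t : R => f (y + t *: v)) s 1 <-> derivable f (y + s *: v) v) /\
  'D_1 (fun t : R => f (y + t *: v)) s = 'D_v f (y + s *: v).
Proof.
have e : (fun h : R => h^-1 *: ((((fun t : R => f (y + t *: v)) \o shift s) (h *: 1))
             - f (y + s *: v)))
   = (fun h => h^-1 *: ((f \o shift (y + s *: v)) (h *: v) - f (y + s *: v))).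
  apply/funext => h /=; congr (_ *: (f _ - _)).
  by rewrite [h *: 1]mulr1 scalerDl addrCA.
by split; [rewrite /derivable e | rewrite /derive e].
Qed.

Lemma deriveZv f (x v : E) (a : R) : derivable f x v ->
  derivable f x (a *: v) /\ 'D_(a *: v) f x = a * 'D_v f x.
Proof.
have [->|a0] := eqVneq a 0.
  move=> _; rewrite scale0r mul0r; split; [exact: derivable0|exact: derive0].
move=> df; apply: derive_dist => e e0.
have na0 : 0 < `|a| by rewrite normr_gt0.
have [d d0 Hd] := derivable_dist df (divr_gt0 e0 na0).
exists (d / `|a|); first exact: divr_gt0.
move=> h h0; rewrite ltr_pdivlMr // -normrM => ha.
have := Hd (h * a) (mulf_neq0 h0 a0) ha.
rewrite ltr_pdivlMr // -normrM invfM scalerA [X in `|X|]mulrC mulrBr !mulrA.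
by rewrite (mulrAC a) mulfV // mul1r.
Qed.

(** The one-variable mean value theorem along a segment, the tool by which continuity of a
    directional derivative controls increments. *)
Lemma line_MVT f (y w : E) :
  (forall s : R, 0 <= s <= 1 -> derivable f (y + s *: w) w) ->
  exists2 th : R, 0 <= th <= 1 & f (y + w) - f y = 'D_w f (y + th *: w).
Proof.
move=> df.
have d1 (s : R) : 0 <= s <= 1 -> derivable (fun t : R => f (y + t *: w)) s 1.
  by move=> /df; apply (derive_line f y w s).1.
have [||c c01] := @MVT_segment R (fun t : R => f (y + t *: w))
    (fun t : R => 'D_1 (fun t : R => f (y + t *: w)) t) 0 1 ler01.
- move=> x; rewrite in_itv /= => /andP[x0 x1]; apply: derivableP; apply: d1.
  by rewrite !ltW.
- apply: derivable_within_continuous => x; rewrite in_itv /= => x01.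
  exact: d1.
- rewrite scale1r scale0r addr0 subr0 mulr1 => ->; exists c.
  + by move: c01; rewrite in_itv.
  + by rewrite (derive_line f y w c).2.
Qed.

(** A directional derivative need not be additive in its direction; continuity of ['D_v f] at [x]
    makes it so. The increment along [u + v] is split at [h *: u + x], and the mean value theorem on
    the second leg yields ['D_v f] at a point tending to [x]. *)
Lemma deriveDv f (U : set E) (x u v : E) : open U -> U x ->
  derivable f x u -> (forall y, U y -> derivable f y v) ->
  {for x, continuous ('D_v f)} ->
  derivable f x (u + v) /\ 'D_(u + v) f x = 'D_u f x + 'D_v f x.
Proof.
move=> oU Ux du dv cv; apply: derive_dist => e e0.
have e20 : 0 < e / 2 by apply: divr_gt0.
have [d1 d10 H1] := derivable_dist du e20.
have /continuousP_dist/(_ _ e20)[d2 d20 H2] := cv.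
have [d3 d30 H3] := open_dist oU Ux.
(* The distance from [x] to any point of the second leg is at most |h| N; the summand 1 keeps [N]
   positive. *)
set N := `|u| + `|v| + 1.
have N0 : 0 < N by rewrite ltr_wpDl // addr_ge0.
exists (Num.min d1 (Num.min (d2 / N) (d3 / N))).
  by rewrite !lt_min d10 !divr_gt0.
move=> h h0; rewrite !lt_min !ltr_pdivlMr // => /and3P[hd1 hd2 hd3].
have close (s : R) : 0 <= s <= 1 ->
    `|(h *: u + x) + s *: (h *: v) - x| <= `|h| * N.
  move=> /andP[s0 s1]; rewrite addrAC addrK.
  apply: (le_trans (ler_normD _ _)); rewrite !normrZ (ger0_norm s0).
  rewrite /N !mulrDr -addrA lerD2l mulr1.
  apply: (@le_trans _ _ (`|h| * `|v|)); last by rewrite lerDl.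
  by rewrite ler_piMl // mulr_ge0.
have [s s01|th th01] := @line_MVT f (h *: u + x) (h *: v).
  apply: (fun H => (deriveZv h (dv _ H)).1); apply: H3.
  by apply: (le_lt_trans (close _ s01)).
have Uy : U ((h *: u + x) + th *: (h *: v)).
  by apply: H3; apply: (le_lt_trans (close _ th01)).
rewrite (deriveZv h (dv _ Uy)).2 => mvt.
have -> : f (h *: (u + v) + x) - f x =
    h * 'D_v f (h *: u + x + th *: (h *: v)) + (f (h *: u + x) - f x).
  by rewrite -mvt addrA subrK scalerDr addrAC.
rewrite mulrDr mulrA mulVf // mul1r.
rewrite (addrC ('D_u f x)) opprD addrACA (splitr e).
apply: (le_lt_trans (ler_normD _ _)); apply: ltrD.
  by apply: H2; apply: (le_lt_trans (close _ th01)).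
by apply: H1.
Qed.
End DirectionalDerivative.

(** * Coordinate systems and the chain rule *)

Lemma cvg_sum_seq (R : realType) (T I : Type) (F : set_system T) (r : seq I)
    (f : I -> T -> R) (a : I -> R) : Filter F ->
  (forall i, f i @ F --> a i) ->
  (fun x => \sum_(i <- r) f i x) @ F --> \sum_(i <- r) a i.
Proof.
move=> FF fa; elim: r => [|i r IH].
  by rewrite big_nil; under eq_fun do rewrite big_nil; exact: cvg_cst.
by rewrite big_cons; under eq_fun do rewrite big_cons; exact: cvgD.
Qed.

(** Chart spaces are row vectors, pairs of them and products of the two. A finite system of
    continuous linear coordinates treats these uniformly and gives the index set for the chain rule
    and for Hadamard's expansion. *)
Record basis (R : realType) (E : normedModType R) := Basis {
  basis_index : finType;
  bvec : basis_index -> E;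
  bcoord : basis_index -> E -> R;
  bcoord_linear : forall i a x y,
    bcoord i (a *: x + y) = a * bcoord i x + bcoord i y;
  bcoord_continuous : forall i, continuous (bcoord i);
  bcoord_sum : forall x, x = \sum_i bcoord i x *: bvec i }.

Section ChainRule.
Variables (R : realType) (E : normedModType R) (B : basis E).
Local Notation e_ := (@bvec R E B).
Local Notation l_ := (@bcoord R E B).

Lemma bcoord0 i : l_ i 0 = 0.
Proof.
have := bcoord_linear i 1 0 0; rewrite scaler0 addr0 mul1r => /eqP.
by rewrite -subr_eq0 opprD addrA subrr sub0r oppr_eq0 => /eqP.
Qed.

Lemma bcoordZ i a x : l_ i (a *: x) = a * l_ i x.
Proof. by have := bcoord_linear i a x 0; rewrite !addr0 bcoord0 addr0. Qed.

Lemma bcoordD i x y : l_ i (x + y) = l_ i x + l_ i y.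
Proof. by have := bcoord_linear i 1 x y; rewrite scale1r mul1r. Qed.

Lemma bcoordB i x y : l_ i (x - y) = l_ i x - l_ i y.
Proof. by rewrite bcoordD -scaleN1r bcoordZ mulN1r. Qed.

Lemma derive_sumv (I : Type) (r : seq I) (a : I -> R) (u : I -> E)
    (f : E -> R) (U : set E) (x : E) : open U -> U x ->
  (forall v y, U y -> derivable f y v) ->
  (forall v, {for x, continuous ('D_v f)}) ->
  'D_(\sum_(i <- r) a i *: u i) f x = \sum_(i <- r) a i * 'D_(u i) f x.
Proof.
move=> oU Ux df cf; elim: r => [|i r IH]; first by rewrite !big_nil derive0.
rewrite !big_cons (deriveDv oU Ux _ _ (cf _)).2 ?IH.
- by rewrite (deriveZv _ (df _ _ Ux)).2.
- exact: df.
- by move=> y Uy; exact: df.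
Qed.

Lemma derive_basis (f : E -> R) (U : set E) (x w : E) : open U -> U x ->
  (forall v y, U y -> derivable f y v) ->
  (forall v, {for x, continuous ('D_v f)}) ->
  'D_w f x = \sum_i l_ i w * 'D_(e_ i) f x.
Proof.
by move=> oU Ux df cf; rewrite {1}(bcoord_sum B w) (derive_sumv _ _ _ oU Ux).
Qed.

(** The mean value theorem is applied to [f] on the segment from [g x] to [g (h *: v + x)], and the
    derivative along that segment is expanded in the basis. The intermediate point tends to [g x],
    where the partial derivatives of [f] are continuous. *)
Lemma derive_comp (E' : normedModType R) (f : E -> R) (g : E' -> E)
    (V : set E) (x v : E') : open V -> V (g x) ->
  (forall v y, V y -> derivable f y v) ->
  (forall v y, V y -> {for y, continuous ('D_v f)}) ->
  {for x, continuous g} ->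
  (forall i, derivable (l_ i \o g) x v) ->
  derivable (f \o g) x v /\
  'D_v (f \o g) x = \sum_i 'D_(e_ i) f (g x) * 'D_v (l_ i \o g) x.
Proof.
move=> oV Vgx df cf cg dg.
have [r r0 Hr] := open_dist oV Vgx.
have /continuousP_dist cg' := cg.
have [d1 d10 H1] := cg' _ r0.
(* The intermediate point is chosen as a function of [h], with default 0 for large [h], so that the
   limit can be taken in a closed expression. *)
have /choice[th Hth] (h : R) : exists s : R, `|h| * `|v| < d1 ->
   0 <= s <= 1 /\ f (g (h *: v + x)) - f (g x) =
   'D_(g (h *: v + x) - g x) f (g x + s *: (g (h *: v + x) - g x)).
  have [hd|hd] := ltP (`|h| * `|v|) d1; last by exists 0.
  have [s s01|s s01 Es] := @line_MVT _ _ f (g x) (g (h *: v + x) - g x).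
    apply: df; apply: Hr; rewrite addrAC subrr add0r normrZ.
    case/andP: s01 => s0 s1; rewrite (ger0_norm s0).
    apply: (le_lt_trans (ler_piMl _ s1)) => //.
    by apply: H1; rewrite addrK normrZ.
  by exists s => _; split => //; rewrite -Es (addrC (g x)) subrK.
set w := fun h => g (h *: v + x) - g x.
set p := fun h => g x + th h *: w h.
have w_small (e : R) : 0 < e -> exists2 d : R, 0 < d & forall h, `|h| < d ->
    `|w h| < e /\ `|h| * `|v| < d1.
  move=> e0; have [d2 d20 H2] := cg' _ e0.
  have N0 : 0 < `|v| + 1 by rewrite ltr_wpDl.
  exists (Num.min d1 d2 / (`|v| + 1)); first by rewrite divr_gt0 // lt_min d10.
  move=> h; rewrite ltr_pdivlMr // lt_min => /andP[h1 h2].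
  have hv : `|h| * `|v| <= `|h| * (`|v| + 1) by rewrite ler_wpM2l // lerDl.
  split; last exact: le_lt_trans h1.
  by apply: H2; rewrite addrK normrZ; apply: le_lt_trans h2.
have pV h : `|w h| < r -> `|h| * `|v| < d1 -> V (p h).
  move=> wr hd; apply: Hr; rewrite /p addrAC subrr add0r normrZ.
  have [/andP[s0 s1] _] := Hth _ hd; rewrite (ger0_norm s0).
  exact: (le_lt_trans (ler_piMl _ s1)).
apply: derive_cvg.
have [d0 d00 H0] := w_small _ r0.
apply: (@cvg_trans _ ((fun h => \sum_i 'D_(e_ i) f (p h) *
   (h^-1 * (l_ i (g (h *: v + x)) - l_ i (g x)))) @ 0^')).
  apply: near_eq_cvg; exists d0 => //= h; rewrite /= sub0r normrN => hd h0.
  have [wr hd1] := H0 _ hd; have [s01 ->] := Hth _ hd1.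
  rewrite -/(w h) -/(p h) (derive_basis _ oV (pV _ wr hd1)) //; last first.
    by move=> u; apply: cf; apply: pV.
  rewrite scaler_sumr; apply: eq_bigr => i _.
  by rewrite /w bcoordB -[RHS]/(_ * (_ * _)) [RHS]mulrA [RHS]mulrC.
apply: cvg_sum_seq => i; apply: cvgM; last first.
  have := dg i; rewrite /derivable -/('D_v (l_ i \o g) x) => H; exact: H.
apply/cvg_dnbhs0P => e e0.
have /continuousP_dist/(_ _ e0)[d3 d30 H3] := cf (e_ i) _ Vgx.
have [d4 d40 H4] := w_small _ d30.
exists d4 => // h h0 /H4[wd hd1]; apply: H3.
rewrite /p addrAC subrr add0r normrZ.
have [/andP[s0 s1] _] := Hth _ hd1; rewrite (ger0_norm s0).
exact: (le_lt_trans (ler_piMl _ s1)).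
Qed.

End ChainRule.

(** * Smooth functions *)

Section FiniteOrderSmoothness.
Variables (R : realType) (E : normedModType R).
Implicit Types (f g : E -> R) (U : set E).

(** Products, inverses and compositions are handled by induction on a finite order. The lists of
    directions in [smooth_on] do not lend themselves to this, since one derivative of a product is
    already a sum of products. *)
Fixpoint ck (n : nat) (U : set E) (f : E -> R) : Prop :=
  (forall x, U x -> {for x, continuous f}) /\
  (if n is n'.+1 then
     forall v, (forall x, U x -> derivable f x v) /\ ck n' U ('D_v f)
   else True).

Lemma ck_continuous n U f x : ck n U f -> U x -> {for x, continuous f}.
Proof. by case: n => [|n] [+ _]; apply. Qed.

Lemma ck_derivable n U f x v : ck n.+1 U f -> U x -> derivable f x v.
Proof. by move=> [_ /(_ v)[+ _]]; apply. Qed.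

Lemma ck_derive n U f v : ck n.+1 U f -> ck n U ('D_v f).
Proof. by move=> [_ /(_ v)[]]. Qed.

Lemma ckW n U f : ck n.+1 U f -> ck n U f.
Proof.
elim: n f => [|n IH] f [cf df]; first by split.
by split=> // v; have [d1 d2] := df v; split => //; apply: IH.
Qed.

Lemma derivable_eq U f g x v : open U -> U x -> (forall y, U y -> f y = g y) ->
  derivable f x v -> derivable g x v /\ 'D_v g x = 'D_v f x.
Proof.
move=> oU Ux fg df; apply: derive_dist => e e0.
have [d1 d10 H1] := derivable_dist df e0.
have [d2 d20 H2] := open_dist oU Ux.
have N0 : 0 < `|v| + 1 by rewrite ltr_wpDl.
exists (Num.min d1 (d2 / (`|v| + 1))); first by rewrite lt_min d10 divr_gt0.
move=> h h0; rewrite lt_min ltr_pdivlMr // => /andP[h1 h2].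
rewrite -!fg //; first exact: H1.
apply: H2; rewrite addrK normrZ; apply: le_lt_trans h2.
by rewrite ler_wpM2l // lerDl.
Qed.

Lemma continuous_eq U f g x : open U -> U x -> (forall y, U y -> f y = g y) ->
  {for x, continuous f} -> {for x, continuous g}.
Proof.
move=> oU Ux fg /continuousP_dist cf; apply/continuousP_dist => e e0.
have [d1 d10 H1] := cf _ e0; have [d2 d20 H2] := open_dist oU Ux.
exists (Num.min d1 d2); first by rewrite lt_min d10.
by move=> y; rewrite lt_min => /andP[y1 y2]; rewrite -!fg //; [exact: H1|exact: H2].
Qed.

Lemma ck_eq n U f g : open U -> (forall y, U y -> f y = g y) ->
  ck n U f -> ck n U g.
Proof.
move=> oU; elim: n f g => [|n IH] f g fg [cf df].
  by split=> // x Ux; apply: (continuous_eq oU Ux fg); apply: cf.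
split; first by move=> x Ux; apply: (continuous_eq oU Ux fg); apply: cf.
move=> v; have [d1 d2] := df v; split.
  by move=> x Ux; exact: (derivable_eq oU Ux fg (d1 x Ux)).1.
apply: IH d2 => y Uy; exact/esym/(derivable_eq oU Uy fg (d1 y Uy)).2.
Qed.

Lemma ck_sub n U V f : V `<=` U -> ck n U f -> ck n V f.
Proof.
move=> VU; elim: n f => [|n IH] f [cf df].
  by split=> // x /VU; apply: cf.
split=> [x /VU|v]; first exact: cf.
have [d1 d2] := df v; split; last exact: IH.
by move=> x /VU; apply: d1.
Qed.

Lemma ck_local n U f :
  (forall x, U x -> exists V : set E, V x /\ ck n V f) -> ck n U f.
Proof.
elim: n f => [|n IH] f H.
  by split=> // x /H[V [Vx [cf _]]]; apply: cf.
split=> [x /H[V [Vx [cf _]]]|v]; first exact: cf.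
split=> [x /H[V [Vx cf]]|]; first exact: ck_derivable cf Vx.
by apply: IH => x /H[V [Vx cf]]; exists V; split => //; exact: ck_derive.
Qed.

Lemma ck_cst n U (a : R) : ck n U (fun=> a).
Proof.
elim: n a => [|n IH] a; first by split => // x _; exact: cvg_cst.
split=> [x _|v]; first exact: cvg_cst.
split=> [x _|]; first exact: derivable_cst.
by rewrite (_ : 'D_v _ = fun=> 0) //; apply/funext => x; rewrite derive_cst.
Qed.

Lemma ck_add n U f g : open U -> ck n U f -> ck n U g ->
  ck n U (fun x => f x + g x).
Proof.
move=> oU; elim: n f g => [|n IH] f g cf cg.
  by split=> // x Ux; apply: continuousD; [exact: cf.1|exact: cg.1].
split=> [x Ux|v]; first by apply: continuousD; [exact: cf.1|exact: cg.1].
split=> [x Ux|].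
  by apply: derivableD; [exact: ck_derivable cf Ux|exact: ck_derivable cg Ux].
apply: (ck_eq oU _ (IH _ _ (ck_derive v cf) (ck_derive v cg))) => x Ux.
by rewrite -deriveD //; [exact: ck_derivable cf Ux|exact: ck_derivable cg Ux].
Qed.

Lemma ck_mul n U f g : open U -> ck n U f -> ck n U g ->
  ck n U (fun x => f x * g x).
Proof.
move=> oU; elim: n f g => [|n IH] f g cf cg.
  by split=> // x Ux; apply: continuousM; [exact: cf.1|exact: cg.1].
split=> [x Ux|v]; first by apply: continuousM; [exact: cf.1|exact: cg.1].
split=> [x Ux|].
  by apply: derivableM; [exact: ck_derivable cf Ux|exact: ck_derivable cg Ux].
apply: (ck_eq oU _ (ck_add oU (IH _ _ (ckW cf) (ck_derive v cg))
   (IH _ _ (ckW cg) (ck_derive v cf)))) => x Ux.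
by rewrite deriveM //; [exact: ck_derivable cf Ux|exact: ck_derivable cg Ux].
Qed.

Lemma ck_sum (I : Type) (r : seq I) n U (F : I -> E -> R) : open U ->
  (forall i, ck n U (F i)) -> ck n U (fun x => \sum_(i <- r) F i x).
Proof.
move=> oU cF; elim: r => [|i r IH].
  by under eq_fun do rewrite big_nil; exact: ck_cst.
by under eq_fun do rewrite big_cons; apply: ck_add.
Qed.

Lemma ck_inv n U f : open U -> (forall x, U x -> f x != 0) -> ck n U f ->
  ck n U (fun x => (f x)^-1).
Proof.
move=> oU f0; elim: n f f0 => [|n IH] f f0 cf.
  by split=> // x Ux; apply: continuousV; [exact: f0|exact: cf.1].
split=> [x Ux|v]; first by apply: continuousV; [exact: f0|exact: cf.1].
split=> [x Ux|].
  by apply: derivableV; [exact: f0|exact: ck_derivable cf Ux].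
have cV := IH f f0 (ckW cf).
apply: (ck_eq oU _ (ck_mul oU (ck_mul oU (ck_cst n U (-1)) (ck_mul oU cV cV))
  (ck_derive v cf))) => x Ux.
rewrite (@deriveV _ _ f) //; [|exact: f0|exact: ck_derivable cf Ux].
by rewrite mulN1r -[RHS]/(_ * _) -expr2 exprVn.
Qed.

Lemma ck_smooth_on U f : smooth_on U f <-> forall n, ck n U f.
Proof.
split=> [H n|H vs].
  elim: n f H => [|n IH] f H.
    by split=> // x Ux; exact: (H [::] x Ux).1.
  split=> [x Ux|v]; first exact: (H [::] x Ux).1.
  split=> [x Ux|]; first exact: (H [::] x Ux).2.
  by apply: IH => vs x Ux; exact: (H (v :: vs) x Ux).
elim: vs f H => [|v vs IH] f H x Ux /=.
  split; first exact: ck_continuous (H 0%N) Ux.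
  move=> v; exact: ck_derivable (H 1%N) Ux.
by apply: IH => // n; exact: ck_derive (H n.+1).
Qed.

End FiniteOrderSmoothness.

Section Composition.
Variables (R : realType) (E E' : normedModType R) (B : basis E).

(** Only the order of the conclusion decreases, while [f] has every order: the derivative of
    [f \o g] involves the partial derivatives of [f] composed with the same [g], which the induction
    hypothesis covers. *)
Lemma ck_comp n (U : set E') (V : set E) (f : E -> R) (g : E' -> E) :
  open U -> open V -> (forall x, U x -> V (g x)) ->
  (forall x, U x -> {for x, continuous g}) ->
  (forall n, ck n V f) -> (forall n i, ck n U (@bcoord _ _ B i \o g)) ->
  ck n U (f \o g).
Proof.
move=> oU oV gV cg; elim: n f => [|n IH] f cf ccg.
  split=> // x Ux; apply: continuous_comp; first exact: cg.
  by apply: ck_continuous (cf 0%N) _; apply: gV.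
have chain x v Ux := @derive_comp _ _ B _ f g V x v oV (gV x Ux)
  (fun v y Vy => @ck_derivable _ _ _ _ _ _ v (cf 1%N) Vy)
  (fun v y Vy => ck_continuous (ck_derive v (cf 1%N)) Vy)
  (cg x Ux) (fun i => @ck_derivable _ _ _ _ _ _ v (ccg 1%N i) Ux).
split=> [x Ux|v].
  apply: continuous_comp; first exact: cg.
  by apply: ck_continuous (cf 0%N) _; apply: gV.
split=> [x Ux|]; first exact: (chain x v Ux).1.
apply: (@ck_eq _ _ n U (fun x => \sum_i ('D_(@bvec _ _ B i) f \o g) x *
   'D_v (@bcoord _ _ B i \o g) x)) => //.
  by move=> x Ux; rewrite (chain x v Ux).2.
apply: ck_sum => // i; apply: ck_mul => //.
  apply: IH => [k|k j]; [exact: ck_derive (cf k.+1)|exact: ccg].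
exact: ck_derive (ccg n.+1 i).
Qed.

End Composition.

Section SmoothReal.
Variables (R : realType) (E : normedModType R).
Implicit Types (f g : E -> R) (U : set E).

(* A record, so that unification never unfolds the quantifier over orders. *)
Record sm U f : Prop := Sm { sm_ck : forall n, ck n U f }.

Lemma smE U f : sm U f <-> smooth_on U f.
Proof. by split=> [[/ck_smooth_on]|/ck_smooth_on ?]. Qed.

Lemma sm_continuous U f x : sm U f -> U x -> {for x, continuous f}.
Proof. by move=> [H]; exact: ck_continuous (H 0%N). Qed.

Lemma sm_derivable U f x v : sm U f -> U x -> derivable f x v.
Proof. by move=> [H]; exact: ck_derivable (H 1%N). Qed.

Lemma sm_derive U f v : sm U f -> sm U ('D_v f).
Proof. by move=> [H]; split=> n; exact: ck_derive (H n.+1). Qed.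

Lemma sm_eq U f g : open U -> (forall y, U y -> f y = g y) -> sm U f -> sm U g.
Proof. by move=> oU fg [H]; split=> n; exact: ck_eq oU fg (H n). Qed.

Lemma sm_sub U V f : V `<=` U -> sm U f -> sm V f.
Proof. by move=> VU [H]; split=> n; exact: ck_sub VU (H n). Qed.

Lemma sm_local U f :
  (forall x, U x -> exists V : set E, V x /\ sm V f) -> sm U f.
Proof.
move=> H; split=> n; apply: ck_local => x /H[V [Vx [Hf]]].
by exists V; split => //; exact: Hf.
Qed.

Lemma sm_cst U (a : R) : sm U (fun=> a).
Proof. by split=> n; exact: ck_cst. Qed.

Lemma sm_add U f g : open U -> sm U f -> sm U g -> sm U (fun x => f x + g x).
Proof. by move=> oU [cf] [cg]; split=> n; exact: ck_add. Qed.

Lemma sm_mul U f g : open U -> sm U f -> sm U g -> sm U (fun x => f x * g x).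
Proof. by move=> oU [cf] [cg]; split=> n; exact: ck_mul. Qed.

Lemma sm_opp U f : open U -> sm U f -> sm U (fun x => - f x).
Proof.
move=> oU cf; apply: (sm_eq oU _ (sm_mul oU (sm_cst U (-1)) cf)) => x _.
by rewrite mulN1r.
Qed.

Lemma sm_subr U f g : open U -> sm U f -> sm U g -> sm U (fun x => f x - g x).
Proof. by move=> oU cf cg; apply: sm_add => //; exact: sm_opp. Qed.

Lemma sm_inv U f : open U -> (forall x, U x -> f x != 0) -> sm U f ->
  sm U (fun x => (f x)^-1).
Proof. by move=> oU f0 [cf]; split=> n; exact: ck_inv. Qed.

Lemma sm_sum (I : Type) (r : seq I) U (F : I -> E -> R) : open U ->
  (forall i, sm U (F i)) -> sm U (fun x => \sum_(i <- r) F i x).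
Proof. by move=> oU cF; split=> n; apply: ck_sum => // i; case: (cF i). Qed.

Lemma sm_prod (I : Type) (r : seq I) U (F : I -> E -> R) : open U ->
  (forall i, sm U (F i)) -> sm U (fun x => \prod_(i <- r) F i x).
Proof.
move=> oU cF; elim: r => [|i r IH].
  by under eq_fun do rewrite big_nil; exact: sm_cst.
by under eq_fun do rewrite big_cons; exact: sm_mul.
Qed.

Lemma sm_lin U (l : E -> R) : (forall a x y, l (a *: x + y) = a * l x + l y) ->
  continuous l -> sm U l.
Proof.
move=> ll cl; split=> n; case: n => [|n]; first by split => // x _; exact: cl.
have l0 : l 0 = 0.
  have := ll 1 0 0; rewrite scaler0 addr0 mul1r => /eqP.
  by rewrite -subr_eq0 opprD addrA subrr sub0r oppr_eq0 => /eqP.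
have dl x v : derivable l x v /\ 'D_v l x = l v.
  apply: derive_dist => e e0; exists 1 => // h h0 _.
  by rewrite ll addrK mulrA mulVf // mul1r subrr normr0.
split=> [x _|v]; first exact: cl.
split=> [x _|]; first exact: (dl x v).1.
rewrite (_ : 'D_v l = fun=> l v); first exact: ck_cst.
by apply/funext => x; exact: (dl x v).2.
Qed.

End SmoothReal.

Arguments sm_derivable {R E U f x} v _ _.

Section SmoothComp.
Variables (R : realType) (E E' : normedModType R).

Lemma sm_comp (B : basis E) (U : set E') (V : set E) (f : E -> R) (g : E' -> E) :
  open U -> open V -> (forall x, U x -> V (g x)) ->
  (forall x, U x -> {for x, continuous g}) ->
  sm V f -> (forall i, sm U (@bcoord _ _ B i \o g)) ->
  sm U (f \o g).
Proof.
move=> oU oV gV cg [cf] cgi; split=> n; apply: (@ck_comp _ _ _ B _ _ _ _ _ oU oV gV cg cf) => k i.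
by case: (cgi i).
Qed.

(** The two difference quotients coincide term by term. This turns partial derivatives along M or T
    into directional derivatives on the product of the chart spaces. *)
Lemma derive_affine (f : E -> R) (g : E' -> E) (A : E' -> E) (x v : E') :
  (forall h, g (h *: v + x) = h *: A v + g x) ->
  'D_v (f \o g) x = 'D_(A v) f (g x) /\
  (derivable (f \o g) x v <-> derivable f (g x) (A v)).
Proof.
move=> Ag; have e : (fun h : R => h^-1 *: (((f \o g) \o shift x) (h *: v) - (f \o g) x))
   = (fun h => h^-1 *: ((f \o shift (g x)) (h *: A v) - f (g x))).
  by apply/funext => h /=; rewrite Ag.
by split; [rewrite /derive e|rewrite /derivable e].
Qed.

Lemma sm_affine (U : set E') (V : set E) (f : E -> R) (g A : E' -> E) :
  (forall x v h, g (h *: v + x) = h *: A v + g x) -> continuous g ->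
  (forall x, U x -> V (g x)) -> sm V f -> sm U (f \o g).
Proof.
move=> Ag cg gV [cf]; split=> n; elim: n f cf => [|n IH] f cf.
  split=> // x Ux; apply: continuous_comp; first exact: cg.
  by apply: ck_continuous (cf 0%N) _; apply: gV.
split=> [x Ux|v].
  apply: continuous_comp; first exact: cg.
  by apply: ck_continuous (cf 0%N) _; apply: gV.
have dfg x := derive_affine f (Ag x v).
split=> [x Ux|].
  by apply (dfg x).2; apply: ck_derivable (cf 1%N) _; apply: gV.
rewrite (_ : 'D_v (f \o g) = 'D_(A v) f \o g).
  by apply: IH => k; apply: ck_derive.
by apply/funext => x; rewrite (dfg x).1.
Qed.

End SmoothComp.

Section Bases.
Variable R : realType.

Lemma row_basis_linear (n : nat) (i : 'I_n) (a : R) (x y : 'rV[R]_n) :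
  (a *: x + y) 0 i = a * x 0 i + y 0 i.
Proof. by rewrite !mxE. Qed.

Definition row_basis (n : nat) : basis 'rV[R]_n :=
  @Basis R 'rV[R]_n 'I_n (delta_mx 0) (fun i x => x 0 i)
    (@row_basis_linear n) (fun i => @coord_continuous R 1 n 0 i)
    (@row_sum_delta _ _).

Variables (E1 E2 : normedModType R) (B1 : basis E1) (B2 : basis E2).

Definition prod_bvec (i : basis_index B1 + basis_index B2) : E1 * E2 :=
  match i with inl j => (bvec j, 0) | inr j => (0, bvec j) end.

Definition prod_bcoord (i : basis_index B1 + basis_index B2) (x : E1 * E2) : R :=
  match i with inl j => bcoord j x.1 | inr j => bcoord j x.2 end.

Lemma prod_bcoord_linear i a x y :
  prod_bcoord i (a *: x + y) = a * prod_bcoord i x + prod_bcoord i y.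
Proof. by case: i => i; exact: bcoord_linear. Qed.

Lemma prod_bcoord_continuous i : continuous (prod_bcoord i).
Proof.
case: i => i x; apply: continuous_comp.
- exact: cvg_fst.
- exact: bcoord_continuous.
- exact: cvg_snd.
- exact: bcoord_continuous.
Qed.

Lemma prod_bcoord_sum x : x = \sum_i prod_bcoord i x *: prod_bvec i.
Proof.
rewrite big_sumType /= [LHS]surjective_pairing.
rewrite [in LHS](bcoord_sum B1 x.1) [in LHS](bcoord_sum B2 x.2).
have E1E (I : finType) (a : I -> R) (u : I -> E1) :
    \sum_i a i *: (u i, 0 : E2) = (\sum_i a i *: u i, 0).
  elim: (index_enum I) => [|i r IH]; first by rewrite !big_nil.
  by rewrite !big_cons IH; congr pair; rewrite /= scaler0 addr0.
have E2E (I : finType) (a : I -> R) (u : I -> E2) :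
    \sum_i a i *: (0 : E1, u i) = (0, \sum_i a i *: u i).
  elim: (index_enum I) => [|i r IH]; first by rewrite !big_nil.
  by rewrite !big_cons IH; congr pair; rewrite /= scaler0 addr0.
by rewrite E1E E2E; congr pair; rewrite /= ?addr0 ?add0r.
Qed.

Definition prod_basis : basis (E1 * E2)%type :=
  Basis prod_bcoord_linear prod_bcoord_continuous prod_bcoord_sum.

End Bases.

(** * Complex-valued smooth functions *)

Section SmoothComplex.
Variables (R : realType) (E : normedModType R).
Implicit Types (f g : E -> R[i]) (U : set E).

Lemma cReM (x y : R[i]) :
  complex.Re (x * y) = complex.Re x * complex.Re y - complex.Im x * complex.Im y.
Proof. by case: x y => a b [c d]. Qed.

Lemma cImM (x y : R[i]) :
  complex.Im (x * y) = complex.Re x * complex.Im y + complex.Im x * complex.Re y.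
Proof. by case: x y => a b [c d]. Qed.

Lemma cReD (x y : R[i]) : complex.Re (x + y) = complex.Re x + complex.Re y.
Proof. by case: x y => a b [c d]. Qed.

Lemma cImD (x y : R[i]) : complex.Im (x + y) = complex.Im x + complex.Im y.
Proof. by case: x y => a b [c d]. Qed.

Record csm U f : Prop := Csm {
  csm_Re : sm U (fun x => complex.Re (f x));
  csm_Im : sm U (fun x => complex.Im (f x)) }.

Lemma csm_eq U f g : open U -> (forall y, U y -> f y = g y) ->
  csm U f -> csm U g.
Proof.
by move=> oU fg [r i]; split; [move: r|move: i]; apply: sm_eq => // y /fg ->.
Qed.

Lemma csm_sub U V f : V `<=` U -> csm U f -> csm V f.
Proof. by move=> VU [r i]; split; [move: r|move: i]; exact: sm_sub. Qed.

Lemma csm_local U f :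
  (forall x, U x -> exists V : set E, V x /\ csm V f) -> csm U f.
Proof.
by move=> H; split; apply: sm_local => x /H[V [Vx [r i]]]; exists V.
Qed.

Lemma csm_cst U (a : R[i]) : csm U (fun=> a).
Proof. by split; exact: sm_cst. Qed.

Lemma csm_real U (f : E -> R) : sm U f -> csm U (fun x => (f x)%:C).
Proof. by move=> sf; split => //=; exact: sm_cst. Qed.

Lemma csm_add U f g : open U -> csm U f -> csm U g -> csm U (fun x => f x + g x).
Proof.
move=> oU [fr fi] [gr gi]; split.
  by under eq_fun do rewrite cReD; exact: sm_add.
by under eq_fun do rewrite cImD; exact: sm_add.
Qed.

Lemma csm_mul U f g : open U -> csm U f -> csm U g -> csm U (fun x => f x * g x).
Proof.
move=> oU [fr fi] [gr gi]; split.
  by under eq_fun do rewrite cReM; apply: sm_subr => //; exact: sm_mul.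
by under eq_fun do rewrite cImM; apply: sm_add => //; exact: sm_mul.
Qed.

Lemma csm_scale U (a : R[i]) f : open U -> csm U f -> csm U (fun x => a * f x).
Proof. by move=> oU; apply: csm_mul => //; exact: csm_cst. Qed.

Lemma csm_opp U f : open U -> csm U f -> csm U (fun x => - f x).
Proof.
move=> oU /(csm_scale (-1) oU); apply: csm_eq => // x _; exact: mulN1r.
Qed.

Lemma csm_sum (I : Type) (r : seq I) U (F : I -> E -> R[i]) : open U ->
  (forall i, csm U (F i)) -> csm U (fun x => \sum_(i <- r) F i x).
Proof.
move=> oU cF; elim: r => [|i r IH].
  by under eq_fun do rewrite big_nil; exact: csm_cst.
by under eq_fun do rewrite big_cons; exact: csm_add.
Qed.

Lemma csm_exp U f n : open U -> csm U f -> csm U (fun x => f x ^+ n).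
Proof.
move=> oU cf; elim: n => [|n IH].
  by under eq_fun do rewrite expr0; exact: csm_cst.
by under eq_fun do rewrite exprS; exact: csm_mul.
Qed.

Lemma csm_derive U f v : csm U f -> csm U (derivC v f).
Proof. by move=> [r i]; split => /=; exact: sm_derive. Qed.

Lemma derivC_eq U f g x v : open U -> U x -> (forall y, U y -> f y = g y) ->
  csm U f -> derivC v f x = derivC v g x.
Proof.
move=> oU Ux fg [r i]; rewrite /derivC; congr (_ +i* _); symmetry.
  exact: (@derivable_eq _ _ _ _ (fun y => complex.Re (g y)) _ _ oU Ux
    (fun y Uy => congr1 (@complex.Re R) (fg y Uy)) (sm_derivable v r Ux)).2.
exact: (@derivable_eq _ _ _ _ (fun y => complex.Im (g y)) _ _ oU Ux
    (fun y Uy => congr1 (@complex.Im R) (fg y Uy)) (sm_derivable v i Ux)).2.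
Qed.

Lemma derivC_cst (a : R[i]) (x v : E) : derivC v (fun _ : E => a) x = 0.
Proof. by rewrite /derivC !derive_cst. Qed.

Lemma derivC_real (f : E -> R) (x v : E) :
  derivC v (fun y => (f y)%:C) x = ('D_v f x)%:C.
Proof. by rewrite /derivC /= derive_cst. Qed.

Lemma derivCD U f g x v : open U -> U x -> csm U f -> csm U g ->
  derivC v (fun y => f y + g y) x = derivC v f x + derivC v g x.
Proof.
move=> oU Ux [fr fi] [gr gi].
rewrite /derivC [RHS]/GRing.add /=; congr (_ +i* _).
  under eq_fun do rewrite cReD.
  by apply: deriveD; [exact: sm_derivable v fr Ux|exact: sm_derivable v gr Ux].
under eq_fun do rewrite cImD.
by apply: deriveD; [exact: sm_derivable v fi Ux|exact: sm_derivable v gi Ux].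
Qed.

Lemma derive_mul (f g : E -> R) x v : derivable f x v -> derivable g x v ->
  'D_v (f * g) x = f x * 'D_v g x + g x * 'D_v f x.
Proof. exact: deriveM. Qed.

Lemma derivCM U f g x v : open U -> U x -> csm U f -> csm U g ->
  derivC v (fun y => f y * g y) x = f x * derivC v g x + derivC v f x * g x.
Proof.
move=> oU Ux [fr fi] [gr gi].
have dfr := sm_derivable v fr Ux; have dfi := sm_derivable v fi Ux.
have dgr := sm_derivable v gr Ux; have dgi := sm_derivable v gi Ux.
apply/eqP; rewrite eq_complex; apply/andP; split; apply/eqP.
  rewrite cReD !cReM /=; under eq_fun do rewrite cReM.
  have -> := deriveB (derivableM dfr dgr) (derivableM dfi dgi).
  by rewrite (derive_mul dfr dgr) (derive_mul dfi dgi); ring.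
rewrite cImD !cImM /=; under eq_fun do rewrite cImM.
have -> := deriveD (derivableM dfr dgi) (derivableM dfi dgr).
by rewrite (derive_mul dfr dgi) (derive_mul dfi dgr); ring.
Qed.

Lemma derivCZ U (a : R[i]) f x v : open U -> U x -> csm U f ->
  derivC v (fun y => a * f y) x = a * derivC v f x.
Proof.
move=> oU Ux cf; rewrite (derivCM v oU Ux (csm_cst U a) cf).
by rewrite derivC_cst mul0r addr0.
Qed.

Lemma derivC_sum (I : Type) (r : seq I) U (F : I -> E -> R[i]) x v :
  open U -> U x -> (forall i, csm U (F i)) ->
  derivC v (fun y => \sum_(i <- r) F i y) x = \sum_(i <- r) derivC v (F i) x.
Proof.
move=> oU Ux cF; elim: r => [|i r IH].
  by under eq_fun do rewrite big_nil; rewrite derivC_cst big_nil.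
under eq_fun do rewrite big_cons.
by rewrite (derivCD v oU Ux (cF i) (csm_sum r oU cF)) IH big_cons.
Qed.

Lemma derivCX U f n x v : open U -> U x -> csm U f ->
  derivC v (fun y => f y ^+ n) x = n%:R * f x ^+ n.-1 * derivC v f x.
Proof.
move=> oU Ux cf; elim: n => [|n IH].
  by under eq_fun do rewrite expr0; rewrite derivC_cst !mul0r.
under eq_fun do rewrite exprS.
rewrite (derivCM v oU Ux cf (csm_exp n oU cf)) IH /=.
case: n {IH} => [|n] /=; first by rewrite !mul0r mulr0 add0r expr0 !mul1r mulr1.
by rewrite (exprS (f x) n) -(natr1 n.+1); ring.
Qed.

End SmoothComplex.

Section SmoothComplexAffine.
Variables (R : realType) (E E' : normedModType R).

Lemma csm_comp (B : basis E) (U : set E') (V : set E) (f : E -> R[i])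
    (g : E' -> E) :
  open U -> open V -> (forall x, U x -> V (g x)) ->
  (forall x, U x -> {for x, continuous g}) ->
  csm V f -> (forall i, sm U (@bcoord _ _ B i \o g)) ->
  csm U (f \o g).
Proof.
move=> oU oV gV cg [r i] sg; split.
  exact: (sm_comp oU oV gV cg r sg).
exact: (sm_comp oU oV gV cg i sg).
Qed.

Lemma derivC_affine (f : E -> R[i]) (g : E' -> E) (A : E' -> E) (x v : E') :
  (forall h, g (h *: v + x) = h *: A v + g x) ->
  derivC v (f \o g) x = derivC (A v) f (g x).
Proof.
move=> Ag; rewrite /derivC; congr (_ +i* _).
  exact: (derive_affine (fun y => complex.Re (f y)) Ag).1.
exact: (derive_affine (fun y => complex.Im (f y)) Ag).1.
Qed.

Lemma csm_affine (U : set E') (V : set E) (f : E -> R[i]) (g A : E' -> E) :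
  (forall x v h, g (h *: v + x) = h *: A v + g x) -> continuous g ->
  (forall x, U x -> V (g x)) -> csm V f -> csm U (f \o g).
Proof.
by move=> Ag cg gV [r i]; split; [apply: (sm_affine Ag cg gV r)|apply: (sm_affine Ag cg gV i)].
Qed.

End SmoothComplexAffine.

Lemma pair_continuous (A B C : topologicalType) (f : A -> B) (g : A -> C) x :
  {for x, continuous f} -> {for x, continuous g} ->
  {for x, continuous (fun x => (f x, g x))}.
Proof. by move=> cf cg; apply: (@cvg_pair _ _ _ _ _ _ _ _ _ f g cf cg). Qed.

(** * Hadamard's lemma *)

Section UnitIntegral.
Variable R : realType.
Implicit Types g h : R -> R.

Definition I01 g : R := \int[@lebesgue_measure R]_(t in `[0%R, 1%R]) g t.

Definition cont01 g := forall t, 0 <= t <= 1 -> {for t, continuous g}.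

Lemma cont01_within g : cont01 g -> {within `[0, 1], continuous g}.
Proof.
move=> cg; apply: continuous_in_subspaceT => t; rewrite inE /= in_itv /=.
exact: cg.
Qed.

Lemma cont01_integrable g : cont01 g ->
  (@lebesgue_measure R).-integrable `[0, 1] (EFin \o g).
Proof.
move=> cg; apply: continuous_compact_integrable; first exact: segment_compact.
exact: cont01_within.
Qed.

Lemma I01B g h : cont01 g -> cont01 h -> I01 (fun t => g t - h t) = I01 g - I01 h.
Proof. by move=> cg ch; apply: RintegralB => //; exact: cont01_integrable. Qed.

Lemma I01Z a g : cont01 g -> I01 (fun t => a * g t) = a * I01 g.
Proof. by move=> cg; apply: RintegralZl => //; exact: cont01_integrable. Qed.

Lemma I01_eq g h : (forall t, 0 <= t <= 1 -> g t = h t) -> I01 g = I01 h.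
Proof. by move=> gh; apply: eq_Rintegral => t; rewrite inE /= in_itv; exact: gh. Qed.

Lemma I01_cst a : I01 (fun=> a) = a.
Proof.
rewrite /I01 Rintegral_cst //= lebesgue_measure_itv /= lte_fin ltr01.
by rewrite oppr0 addr0 mulr1.
Qed.

Lemma I01_le_norm g (e : R) : cont01 g ->
  (forall t, 0 <= t <= 1 -> `|g t| <= e) -> `|I01 g| <= e.
Proof.
move=> cg ge; rewrite -(I01_cst e).
have cn : cont01 (fun t => `|g t|).
  by move=> t /cg; exact: cvg_norm.
apply: (le_trans (le_normr_Rintegral _ (cont01_integrable cg))) => //.
apply: le_Rintegral => //; first exact: cont01_integrable.
  by apply: cont01_integrable => t _; exact: cvg_cst.
Qed.

Lemma I01_FTC (g : R -> R) : (forall t, 0 <= t <= 1 -> derivable g t 1) ->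
  cont01 ('D_1 g) -> I01 ('D_1 g) = g 1 - g 0.
Proof.
move=> dg cg.
have cg0 t : 0 <= t <= 1 -> {for t, continuous g}.
  by move=> /dg /derivable1_diffP /differentiable_continuous.
rewrite /I01 /Rintegral.
rewrite (@continuous_FTC2 R ('D_1 g) g 0 1 ltr01 (cont01_within cg)) //.
- split.
  + by move=> t; rewrite in_itv /= => /andP[t0 t1]; apply: dg; rewrite !ltW.
  + by apply: cvg_at_right_filter; apply: cg0; rewrite lexx ler01.
  + by apply: cvg_at_left_filter; apply: cg0; rewrite lexx ler01.
- by move=> t _; rewrite derive1E.
Qed.

End UnitIntegral.

(** * Integrals over [0, 1] depending on a parameter *)

Section ParametricIntegral.
Variables (R : realType) (E : normedModType R).
Implicit Types (phi : R * E -> R).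

(** Compactness of [0, 1], in its near-covering form, makes continuity in the parameter uniform in
    [t]. *)
Lemma uniform01 phi (p0 : E) (e : R) : 0 < e ->
  (forall t : R, 0 <= t <= 1 -> {for (t, p0), continuous phi}) ->
  exists2 d : R, 0 < d & forall p t, `|p - p0| < d -> 0 <= t <= 1 ->
    `|phi (t, p) - phi (t, p0)| < e.
Proof.
move=> e0 cphi; have e20 : 0 < e / 2 by apply: divr_gt0.
have /compact_near_coveringP ncov : compact (`[0%R, 1%R] : set R).
  exact: segment_compact.
have [t|d /= d0 Hd] := (fun H => (nbhs_normP p0 _).1 (ncov E (nbhs p0)
  (fun p t => `|phi (t, p) - phi (t, p0)| < e) _ H)).
  rewrite /= in_itv /= => /cphi /continuousP_dist/(_ _ e20)[d d0 Hd].
  exists (ball t d, ball p0 d); first by split; exact: nbhsx_ballx.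
  move=> [t' p] /=; rewrite -!ball_normE /ball_ /= => -[tt' pp'].
  rewrite -(subrK (phi (t, p0)) (phi (t', p))) -addrA (splitr e).
  apply: (le_lt_trans (ler_normD _ _)); apply: ltrD.
    apply: Hd; rewrite /Num.norm /= gt_max /=; apply/andP.
    by split; rewrite distrC.
  rewrite distrC; apply: Hd; rewrite /Num.norm /= gt_max /=; apply/andP.
  by split; rewrite ?subrr ?normr0 // distrC.
exists d => // p t pd t01; apply: (Hd p _ t); first by rewrite /ball_ /= distrC.
by rewrite /= in_itv.
Qed.

Lemma cont01_slice phi (p : E) :
  (forall t : R, 0 <= t <= 1 -> {for (t, p), continuous phi}) ->
  cont01 (fun t => phi (t, p)).
Proof.
move=> cphi t /cphi c; apply: (@continuous_comp _ _ _ (fun t => (t, p)) phi) => //.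
by apply: pair_continuous; [exact: cvg_id|exact: cvg_cst].
Qed.

Variables (U : set E) (O : set (R * E)).
Hypothesis oU : open U.
Hypothesis UO : forall t p, 0 <= t <= 1 -> U p -> O (t, p).

Lemma I01_param_continuous phi (p : E) : ck 0 O phi -> U p ->
  {for p, continuous (fun p => I01 (fun t => phi (t, p)))}.
Proof.
move=> cphi Up; apply/continuousP_dist => e e0.
have c q : U q -> forall t, 0 <= t <= 1 -> {for (t, q), continuous phi}.
  by move=> Uq t t01; apply: ck_continuous cphi _; exact: UO.
have e20 : 0 < e / 2 by apply: divr_gt0.
have [d1 d10 H1] := uniform01 e20 (c _ Up).
have [d2 d20 H2] := open_dist oU Up.
exists (Num.min d1 d2); first by rewrite lt_min d10.
move=> q; rewrite lt_min => /andP[q1 q2].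
have cq := cont01_slice (c _ (H2 _ q2)); have cp := cont01_slice (c _ Up).
rewrite -I01B //; apply: (@le_lt_trans _ _ (e / 2)); last first.
  by rewrite ltr_pdivrMr // ltr_pMr // ltr1n.
apply: I01_le_norm.
  by move=> t t01; apply: cvgB; [exact: cq|exact: cp].
by move=> t t01; apply/ltW/H1.
Qed.

(** For fixed [t] the mean value theorem turns the difference quotient into ['D_(0, v) phi] at a
    nearby parameter; [uniform01] bounds the error by e / 2 for all [t] at once. *)
Lemma I01_param_derive phi (p v : E) : ck 1 O phi -> U p ->
  let g p := I01 (fun t => phi (t, p)) in
  derivable g p v /\ 'D_v g p = I01 (fun t => 'D_(0, v) phi (t, p)).
Proof.
move=> cphi Up g; apply: derive_dist => e e0.
have c q : U q -> forall t, 0 <= t <= 1 -> {for (t, q), continuous phi}.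
  by move=> Uq t t01; apply: ck_continuous cphi _; exact: UO.
have cd q : U q -> forall t, 0 <= t <= 1 ->
    {for (t, q), continuous ('D_(0, v) phi)}.
  by move=> Uq t t01; apply: ck_continuous (ck_derive (0, v) cphi) _; exact: UO.
have e20 : 0 < e / 2 by apply: divr_gt0.
have [d1 d10 H1] := uniform01 e20 (cd _ Up).
have [d2 d20 H2] := open_dist oU Up.
have N0 : 0 < `|v| + 1 by rewrite ltr_wpDl.
exists (Num.min d1 d2 / (`|v| + 1)); first by rewrite divr_gt0 // lt_min d10.
move=> h h0; rewrite ltr_pdivlMr // lt_min => /andP[hd1 hd2].
have close (s : R) : 0 <= s <= 1 -> `|p + s *: (h *: v) - p| <= `|h| * (`|v| + 1).
  move=> /andP[s0 s1]; rewrite addrAC subrr add0r !normrZ (ger0_norm s0).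
  apply: (@le_trans _ _ (`|h| * `|v|)); first by rewrite ler_piMl // mulr_ge0.
  by rewrite ler_wpM2l // lerDl.
have Uh s : 0 <= s <= 1 -> U (p + s *: (h *: v)).
  by move=> /close H; apply: H2; apply: le_lt_trans hd2.
have Uhp : U (h *: v + p) by rewrite addrC -[h *: v]scale1r; apply: Uh; rewrite lexx ler01.
have cq := cont01_slice (c _ Uhp); have cp := cont01_slice (c _ Up).
have cdp := cont01_slice (cd _ Up).
have cqp : cont01 (fun t => phi (t, h *: v + p) - phi (t, p)).
  by move=> t t01; apply: cvgB; [exact: cq|exact: cp].
have cqph : cont01 (fun t => h^-1 * (phi (t, h *: v + p) - phi (t, p))).
  by move=> t t01; apply: cvgM; [exact: cvg_cst|exact: cqp].
rewrite /g -I01B // -I01Z // -I01B //.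
apply: (@le_lt_trans _ _ (e / 2)); last by rewrite ltr_pdivrMr // ltr_pMr // ltr1n.
apply: I01_le_norm; first by move=> t t01; apply: cvgB; [exact: cqph|exact: cdp].
move=> t t01.
have dline q : U q -> derivable phi (t, q) (0, v).
  by move=> Uq; apply: ck_derivable cphi _; exact: UO.
have [s s01|s s01] := @line_MVT _ _ phi (t, p) (0, h *: v).
  have -> : (0, h *: v) = h *: ((0, v) : R * E) by congr pair; rewrite /= scaler0.
  apply: (fun H => (deriveZv h H).1).
  have -> : (t, p) + s *: (h *: ((0, v) : R * E)) = (t, p + s *: (h *: v)).
    by congr pair; rewrite /= !scaler0 addr0.
  by apply: dline; exact: Uh.
have -> : (t, p) + ((0, h *: v) : R * E) = (t, h *: v + p).
  by congr pair; rewrite /= ?addr0 // addrC.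
have -> : (t, p) + s *: ((0, h *: v) : R * E) = (t, p + s *: (h *: v)).
  by congr pair; rewrite /= !scaler0 addr0.
have -> : (0, h *: v) = h *: ((0, v) : R * E) by congr pair; rewrite /= scaler0.
move=> ->; rewrite (deriveZv h (dline _ (Uh _ s01))).2 mulrA mulVf // mul1r.
by apply/ltW/H1 => //; apply: le_lt_trans (close _ s01) _.
Qed.

Lemma ck_I01_param n phi : ck n O phi ->
  ck n U (fun p => I01 (fun t => phi (t, p))).
Proof.
elim: n phi => [|n IH] phi cphi.
  by split=> // p Up; exact: I01_param_continuous.
have c0 : ck 0 O phi by split=> // x Ox; exact: ck_continuous cphi Ox.
have c1 : ck 1 O phi.
  split=> [x Ox|v]; first exact: ck_continuous cphi Ox.
  split=> [x Ox|]; first exact: ck_derivable cphi Ox.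
  split=> // x Ox; exact: ck_continuous (ck_derive v cphi) Ox.
split=> [p Up|v]; first exact: I01_param_continuous.
split=> [p Up|]; first exact: (I01_param_derive v c1 Up).1.
apply: (ck_eq oU _ (IH _ (ck_derive (0, v) cphi))) => p Up.
by rewrite (I01_param_derive v c1 Up).2.
Qed.

Lemma sm_I01_param phi : sm O phi -> sm U (fun p => I01 (fun t => phi (t, p))).
Proof. by move=> [cphi]; split=> n; exact: ck_I01_param. Qed.

End ParametricIntegral.

Lemma open_prod (X Y : topologicalType) (A : set X) (B : set Y) :
  open A -> open B -> open (A `*` B).
Proof.
rewrite !openE => oA oB [x y] [/= /oA Ax /oB By].
by exists (A, B).
Qed.

(** * Hadamard's expansion on a star-shaped set *)

Section Hadamard.
Variables (R : realType) (E1 E2 : normedModType R).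
Variables (B1 : basis E1) (B2 : basis E2).
Variables (U : set E1) (W : set E2) (z0 : E2).
Hypotheses (oU : open U) (oW : open W).
Hypothesis starW : forall z (t : R), 0 <= t <= 1 -> W z ->
  W (z0 + t *: (z - z0)).

Let hom_path (q : R * (E1 * E2)) : E1 * E2 :=
  (q.2.1, z0 + q.1 *: (q.2.2 - z0)).

Let continuous21 : continuous (fun q : R * (E1 * E2) => q.2.1).
Proof.
move=> q; apply: (@continuous_comp _ _ _ (fun q : R * (E1 * E2) => q.2) fst).
  exact: cvg_snd.
exact: cvg_fst.
Qed.

Let continuous22 : continuous (fun q : R * (E1 * E2) => q.2.2).
Proof.
move=> q; apply: (@continuous_comp _ _ _ (fun q : R * (E1 * E2) => q.2) snd).
  exact: cvg_snd.
exact: cvg_snd.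
Qed.

Let hom_path_continuous : continuous hom_path.
Proof.
move=> q; apply: (@pair_continuous _ _ _ (fun q : R * (E1 * E2) => q.2.1)
    (fun q : R * (E1 * E2) => z0 + q.1 *: (q.2.2 - z0)) q).
  exact: continuous21.
apply: cvgD; first exact: cvg_cst.
apply: cvgZ; first exact: cvg_fst.
by apply: cvgB; [exact: continuous22|exact: cvg_cst].
Qed.

(** The contraction [hom_path] of the second factor is defined for all real [t], and the preimage of
    U x W under it is an open set that contains [0, 1] x U x W, since [W] is star-shaped about [z0].
    The integrand is smooth there by the chain rule. *)
Lemma sm_path_integral (f : E1 * E2 -> R) : sm (U `*` W) f ->
  sm (U `*` W) (fun p => I01 (fun t => f (p.1, z0 + t *: (p.2 - z0)))).
Proof.
move=> sf; have oUW : open (U `*` W) by exact: open_prod.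
have oO : open (hom_path @^-1` (U `*` W)).
  by apply: open_comp oUW => q _; exact: hom_path_continuous.
have UO (t : R) (p : E1 * E2) : 0 <= t <= 1 -> (U `*` W) p ->
    (hom_path @^-1` (U `*` W)) (t, p).
  by case: p => y z t01 [Uy Wz]; split => //=; exact: starW.
suff H : sm (hom_path @^-1` (U `*` W)) (f \o hom_path).
  exact: (sm_I01_param oUW UO H).
apply: (sm_comp (B := prod_basis B1 B2) oO oUW _ _ sf) => //.
  by move=> q _; exact: hom_path_continuous.
case=> i /=.
  apply: sm_lin => [a x y|x]; first exact: bcoord_linear.
  by apply: (@continuous_comp _ _ _ (fun q : R * (E1 * E2) => q.2.1) (bcoord i));
    [exact: continuous21|exact: bcoord_continuous].
have -> : (@prod_bcoord _ _ _ B1 B2 (inr i) \o hom_path) = (fun q : R * (E1 * E2) =>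
    bcoord i z0 + q.1 * (bcoord i q.2.2 - bcoord i z0)).
  by apply/funext => q /=; rewrite bcoordD bcoordZ bcoordB.
apply: sm_add => //; first exact: sm_cst.
apply: sm_mul => //.
  by apply: sm_lin => // x; exact: cvg_fst.
apply: sm_subr => //; last exact: sm_cst.
apply: sm_lin => [a x y|x]; first exact: bcoord_linear.
by apply: (@continuous_comp _ _ _ (fun q : R * (E1 * E2) => q.2.2) (bcoord i));
  [exact: continuous22|exact: bcoord_continuous].
Qed.

Lemma I01_sum (I : Type) (r : seq I) (a : I -> R) (g : I -> R -> R) :
  (forall i, cont01 (g i)) ->
  I01 (fun t => \sum_(i <- r) a i * g i t) = \sum_(i <- r) a i * I01 (g i).
Proof.
move=> cg; elim: r => [|i r IH].
  by rewrite big_nil; under [X in I01 X]eq_fun do rewrite big_nil; exact: I01_cst.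
rewrite big_cons; under [X in I01 X]eq_fun do rewrite big_cons.
rewrite -I01Z // -IH; apply: RintegralD => //; apply: cont01_integrable.
  by move=> t t01; apply: cvgM; [exact: cvg_cst|exact: cg].
move=> t t01; apply: cvg_sum_seq => j.
by apply: cvgM; [exact: cvg_cst|exact: cg].
Qed.

(** The fundamental theorem of calculus along the segment from [z0] to [z], with the derivative in
    the direction [z - z0] expanded in the basis. *)
Lemma hadamard (f : E2 -> R) z : sm W f -> W z ->
  f z - f z0 = \sum_i bcoord i (z - z0) *
     I01 (fun t => 'D_(@bvec _ _ B2 i) f (z0 + t *: (z - z0))).
Proof.
move=> sf Wz; pose w := z - z0.
have Wt t : 0 <= t <= 1 -> W (z0 + t *: w) by move=> t01; exact: starW.
have cpath g : sm W g -> cont01 (fun t => g (z0 + t *: w)).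
  move=> sg t t01; apply: (@continuous_comp _ _ _ (fun t : R => z0 + t *: w) g).
    apply: cvgD; first exact: cvg_cst.
    by apply: cvgZ; [exact: cvg_id|exact: cvg_cst].
  by apply: sm_continuous sg _; exact: Wt.
have lin t : 0 <= t <= 1 -> 'D_w f (z0 + t *: w) =
    \sum_i bcoord i w * 'D_(@bvec _ _ B2 i) f (z0 + t *: w).
  move=> t01; apply: (@derive_basis _ _ B2 f W _ w oW (Wt _ t01)).
    by move=> v y Wy; exact: sm_derivable sf Wy.
  by move=> v; apply: sm_continuous (sm_derive v sf) _; exact: Wt.
rewrite -(I01_sum _ (fun i => bcoord i w)); last first.
  by move=> i; exact: (cpath _ (sm_derive (bvec i) sf)).
have -> : f z - f z0 = f (z0 + 1 *: w) - f (z0 + 0 *: w).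
  by rewrite scale1r scale0r addr0 /w (addrC z0 (z - z0)) subrK.
rewrite -(@I01_FTC _ (fun t => f (z0 + t *: w))).
- by apply: I01_eq => t t01; rewrite (derive_line f z0 w t).2 lin.
- move=> t t01; apply/(derive_line f z0 w t).1.
  by apply: sm_derivable sf _; exact: Wt.
- move=> t t01.
  have -> : 'D_(1 : R) (fun t : R => f (z0 + t *: w)) =
      fun t : R => 'D_w f (z0 + t *: w).
    by apply/funext => t'; rewrite (derive_line f z0 w t').2.
  by apply: (cpath _ (sm_derive w sf) t).
Qed.

End Hadamard.

(** * Bump functions *)

Section Bump.
Variable R : realType.

(** The power of 1/x is a parameter because the derivatives of exp(-1/x) are linear combinations of
    these functions: the family is closed under differentiation, and smoothness of all its members
    is one induction. *)
Definition flat (k : nat) (x : R) : R :=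
  if 0 < x then x^-1 ^+ k * expR (- x^-1) else 0.

Lemma flat_ge0 k x : 0 <= flat k x.
Proof.
rewrite /flat; case: ltP => // x0.
by rewrite mulr_ge0 ?expR_ge0 // exprn_ge0 // invr_ge0 ltW.
Qed.

(** From exp(y) >= y^(k+2) / (k+2)! with y = 1/x. The remaining exponent 2 is what makes the
    derivative at 0 exist and vanish. *)
Lemma flat_le k x : flat k x <= (k.+2)`!%:R * x ^+ 2.
Proof.
rewrite /flat; case: ltP => [x0|_]; last by rewrite mulr_ge0 ?sqr_ge0 // ler0n.
rewrite expRN ler_pdivrMr ?expR_gt0 //.
set y := x^-1; have y0 : 0 < y by rewrite invr_gt0.
have K0 : 0 < (k.+2)`!%:R :> R by rewrite ltr0n fact_gt0.
have le : y ^+ k.+2 / (k.+2)`!%:R <= expR y.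
  by apply: le_trans (expR_ge1Dxn k.+1 (ltW y0)); rewrite lerDr.
have -> : y ^+ k = (k.+2)`!%:R * x ^+ 2 * (y ^+ k.+2 / (k.+2)`!%:R).
  rewrite (mulrC (y ^+ k.+2)) mulrACA mulfV ?gt_eqF // mul1r -(addn2 k) exprD mulrCA.
  by rewrite -exprMn /y mulfV ?gt_eqF // expr1n mulr1.
by apply: ler_wpM2l => //; rewrite mulr_ge0 ?sqr_ge0 // ltW.
Qed.

Lemma derive_flat k x : derivable (flat k) x 1 /\
  'D_1 (flat k) x = flat k.+2 x - k%:R * flat k.+1 x.
Proof.
have [x0|x0|->] := ltgtP x 0.
- have oU : open [set y : R | y < 0] by exact: open_lt.
  have [d e] := @derivable_eq R R [set y : R | y < 0] (fun=> 0) (flat k) x 1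
    oU x0 (fun y (y0 : y < 0) => esym (ltac:(by rewrite /flat ltNge (ltW y0)) : flat k y = 0)) (derivable_cst _ _ _).
  by split=> //; rewrite e derive_cst /flat !ltNge (ltW x0) /= mulr0 subrr.
- have oU : open [set y : R | 0 < y] by exact: open_gt.
  pose g := fun y : R => y^-1 ^+ k * expR (- y^-1).
  have dg : is_derive x 1 g (flat k.+2 x - k%:R * flat k.+1 x).
    have xn0 : x != 0 by rewrite gt_eqF.
    have dI : is_derive x 1 (fun y : R => y^-1) (- x^-1 ^+ 2).
      apply: (is_derive_eq (@is_deriveV R id x 1 1 xn0 (is_derive_id _ _))).
      by rewrite [_ *: _]mulr1 exprVn.
    have dE : is_derive x 1 (fun y : R => expR (- y^-1))
        (x^-1 ^+ 2 * expR (- x^-1)).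
      have := @is_derive1_comp R expR (fun y => - y^-1) x _ _
        (is_derive_expR _) (is_deriveN dI).
      by move/is_derive_eq; apply; rewrite opprK mulrC.
    have dP : is_derive x 1 (fun y : R => y^-1 ^+ k) (- k%:R * x^-1 ^+ k.+1).
      have -> : (fun y : R => y^-1 ^+ k) = (fun y : R => y^-1) ^+ k.
        by apply/funext => y; rewrite exprfctE.
      apply: (is_derive_eq (is_deriveX k dI)); case: k {g} => [|k] /=.
        by rewrite mul0r scale0r oppr0 mul0r.
      by rewrite [_ *: _]mulrN !exprS mulrA; ring.
    apply: (is_derive_eq (is_deriveM dP dE)).
    by rewrite /flat x0 /GRing.scale /= !exprS; ring.
  have [d e] := @derivable_eq R R [set y : R | 0 < y] g (flat k) x 1
    oU x0 (fun y (y0 : 0 < y) => esym (ltac:(by rewrite /flat y0) : flat k y = g y)) (let: DeriveDef h _ := dg in h).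
  by split=> //; rewrite e derive_val.
- have -> : flat k.+2 0 - k%:R * flat k.+1 0 = 0 by rewrite /flat ltxx mulr0 subrr.
  (* By [flat_le] the difference quotient at 0 is at most (k+2)! |h| in absolute value. *)
  apply: derive_dist => e e0; have K0 : 0 < (k.+2)`!%:R :> R by rewrite ltr0n fact_gt0.
  exists (e / (k.+2)`!%:R); first exact: divr_gt0.
  move=> h h0; rewrite ltr_pdivlMr // => hd.
  rewrite addr0 [h *: 1]mulr1 {2}/flat ltxx !subr0 normrM normfV.
  rewrite mulrC ltr_pdivrMr ?normr_gt0 // (ger0_norm (flat_ge0 _ _)).
  apply: (le_lt_trans (flat_le _ _)); rewrite -(ger0_norm (sqr_ge0 h)) normrX expr2.
  by rewrite mulrA ltr_pM2r ?normr_gt0 // mulrC.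
Qed.

Lemma ck_flat n k : ck n setT (flat k).
Proof.
have c j x : {for x, continuous (flat j)}.
  by apply: differentiable_continuous; apply/derivable1_diffP; exact: (derive_flat j x).1.
elim: n k => [|n IH] k; split=> // [v].
have dv x := deriveZv v (derive_flat k x).1.
split=> [x _|]; first by have := (dv x).1; rewrite [v *: 1]mulr1.
apply: (@ck_eq _ _ n setT (fun x => v * (flat k.+2 x + (- k%:R) * flat k.+1 x))).
- exact: openT.
- move=> x _; have := (dv x).2; rewrite [v *: 1]mulr1 => ->.
  by rewrite (derive_flat k x).2 mulNr.
- by apply: ck_mul (ck_cst _ _ _) (ck_add _ (IH _) (ck_mul _ (ck_cst _ _ _) (IH _)));
  exact: openT.
Qed.

Lemma sm_flat k : sm setT (flat k).
Proof. by split=> n; exact: ck_flat. Qed.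

Definition bump1 (x : R) := flat 0 (1 + x) * flat 0 (1 - x).

Lemma sm_bump1 : sm setT bump1.
Proof.
apply: sm_mul; first exact: openT.
  apply: (@sm_affine _ R R setT setT (flat 0) (fun x => 1 + x) id) => //.
  - by move=> x v h; rewrite addrCA.
  - by move=> x; apply: cvgD; [exact: cvg_cst|exact: cvg_id].
  - exact: sm_flat.
apply: (@sm_affine _ R R setT setT (flat 0) (fun x => 1 - x) (fun x => - x)) => //.
- by move=> x v h; rewrite scalerN opprD addrCA.
- by move=> x; apply: cvgB; [exact: cvg_cst|exact: cvg_id].
- exact: sm_flat.
Qed.

Lemma bump1_0 : bump1 0 != 0.
Proof.
rewrite /bump1 addr0 subr0 /flat ltr01 mulf_neq0 // mulf_neq0 ?gt_eqF //;
  by rewrite ?expR_gt0 // exprn_gt0 // invr_gt0.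
Qed.

Lemma bump1_supp x : bump1 x != 0 -> `|x| <= 1.
Proof.
rewrite /bump1 mulf_eq0 negb_or /flat => /andP[].
case: ltP => [x0 _|]; last by rewrite eqxx.
case: ltP => [x1 _|]; last by rewrite eqxx.
by rewrite ler_norml; apply/andP; split; lra.
Qed.

Variables (E : normedModType R) (B : basis E).

(** The points z0 + sum_i a_i e_i with all |a_i| <= r. The recursion exhibits the set as an iterated
    continuous image of a segment times a compact set; it plays the part of a compact ball in a
    space known only through [basis]. *)
Fixpoint zonotope (z0 : E) (r : R) (s : seq E) : set E :=
  if s is e :: s' then
    (fun p : R * E => p.1 *: e + p.2) @` (`[- r, r] `*` zonotope z0 r s')
  else [set z0].

Lemma zonotope_compact z0 r s : compact (zonotope z0 r s).
Proof.
elim: s => [|e s IH] /=; first exact: compact_set1.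
apply: continuous_compact; last by apply: compact_setX => //; exact: segment_compact.
apply: continuous_subspaceT => p; apply: cvgD; last exact: cvg_snd.
by apply: cvgZ; [exact: cvg_fst|exact: cvg_cst].
Qed.

Lemma zonotope_norm z0 r s z : zonotope z0 r s z ->
  `|z - z0| <= r * \sum_(e <- s) `|e|.
Proof.
elim: s z => [|e s IH] z /=; first by move=> ->; rewrite subrr normr0 big_nil mulr0.
move=> [[a y] [/= + /IH Hy] <-]; rewrite in_itv /= -ler_norml => ar.
rewrite big_cons mulrDr -addrA; apply: (le_trans (ler_normD _ _)).
by apply: lerD => //; rewrite normrZ ler_wpM2r.
Qed.

Lemma zonotope_mem (I : Type) z0 r (s : seq I) (e : I -> E) (a : I -> R) :
  (forall i, `|a i| <= r) ->
  zonotope z0 r (map e s) (\sum_(i <- s) a i *: e i + z0).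
Proof.
move=> ar; elim: s => [|i s IH] /=; first by rewrite big_nil add0r.
rewrite big_cons -addrA; eexists (a i, _); last by [].
by split => //=; rewrite in_itv /= -ler_norml.
Qed.

(** A product of one-variable bumps in the rescaled coordinates of [z - z0]. The compact set [K] is
    recorded with [chi] because the smoothness of extensions by zero will rest on the closedness of
    its image in T. *)
Lemma bump_exists (W : set E) (z0 : E) : open W -> W z0 ->
  exists (chi : E -> R) (K : set E),
    [/\ sm setT chi, compact K, K `<=` W, chi z0 != 0 &
        forall z, chi z != 0 -> K z].
Proof.
move=> oW Wz0; have [d d0 Hd] := open_dist oW Wz0.
(* The summand 1 makes [r] times the sum of the norms strictly smaller than [d], also for an empty
   basis, so the zonotope stays in the open ball of radius [d]. *)
pose S := \sum_(e <- map (@bvec _ _ B) (enum (basis_index B))) `|e| + 1.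
have S0 : 0 < S by rewrite /S ltr_wpDl // sumr_ge0.
pose r := d / S; have r0 : 0 < r by exact: divr_gt0.
exists (fun z => \prod_(i <- enum (basis_index B)) bump1 (r^-1 * bcoord i (z - z0))).
exists (zonotope z0 r (map (@bvec _ _ B) (enum (basis_index B)))); split.
- apply: sm_prod => [|i]; first exact: openT.
  apply: (@sm_affine _ R E setT setT bump1 (fun z => r^-1 * bcoord i (z - z0))
    (fun z => r^-1 * bcoord i z)) => //.
  + by move=> x v h; rewrite /= -(addrA (h *: v) x (- z0)) (bcoordD i (h *: v)) bcoordZ mulrDr mulrCA.
  + move=> x; apply: cvgM; first exact: cvg_cst.
    apply: (@continuous_comp _ _ _ (fun z => z - z0) (bcoord i)).
      by apply: cvgB; [exact: cvg_id|exact: cvg_cst].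
    exact: bcoord_continuous.
  + exact: sm_bump1.
- exact: zonotope_compact.
- move=> z /zonotope_norm Hz; apply: Hd; apply: (le_lt_trans Hz).
  by rewrite /r -mulrA gtr_pMr // mulrC ltr_pdivrMr // mul1r /S ltrDl.
- rewrite prodf_seq_neq0; apply/allP => i _ /=.
  by rewrite subrr bcoord0 mulr0 bump1_0.
- move=> z; rewrite prodf_seq_neq0 => /allP Hz.
  rewrite -(subrK z0 z) {1}(bcoord_sum B (z - z0)) -big_enum /=.
  apply: zonotope_mem => i.
  have /bump1_supp := Hz i (mem_enum _ i).
  by rewrite normrM normfV (gtr0_norm r0) mulrC ler_pdivrMr // mul1r.
Qed.

End Bump.

(** * Hadamard's lemma for complex-valued functions *)

Section ComplexHadamard.
Variables (R : realType).

Definition I01C (g : R -> R[i]) : R[i] :=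
  (I01 (fun t => complex.Re (g t))) +i* (I01 (fun t => complex.Im (g t))).

Variables (E1 E2 : normedModType R) (B1 : basis E1) (B2 : basis E2).
Variables (U : set E1) (W : set E2) (z0 : E2).
Hypotheses (oU : open U) (oW : open W).
Hypothesis starW : forall z (t : R), 0 <= t <= 1 -> W z ->
  W (z0 + t *: (z - z0)).

Lemma csm_path_integral (f : E1 * E2 -> R[i]) : csm (U `*` W) f ->
  csm (U `*` W) (fun p => I01C (fun t => f (p.1, z0 + t *: (p.2 - z0)))).
Proof.
by move=> [r i]; split; [exact: sm_path_integral r|exact: sm_path_integral i].
Qed.

Lemma cont01_path (g : E2 -> R) z : sm W g -> W z ->
  cont01 (fun t => g (z0 + t *: (z - z0))).
Proof.
move=> sg Wz t t01.
apply: (@continuous_comp _ _ _ (fun t : R => z0 + t *: (z - z0)) g).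
  apply: cvgD; first exact: cvg_cst.
  by apply: cvgZ; [exact: cvg_id|exact: cvg_cst].
by apply: sm_continuous sg _; exact: starW.
Qed.

Lemma hadamardC (f : E2 -> R[i]) z : csm W f -> W z ->
  f z = f z0 + \sum_i (bcoord i (z - z0))%:C *
     I01C (fun t => derivC (@bvec _ _ B2 i) f (z0 + t *: (z - z0))).
Proof.
move=> [r i] Wz; apply/eqP; rewrite addrC -subr_eq; apply/eqP.
have ReB (x y : R[i]) : complex.Re (x - y) = complex.Re x - complex.Re y.
  by case: x y => a b [c d].
have ImB (x y : R[i]) : complex.Im (x - y) = complex.Im x - complex.Im y.
  by case: x y => a b [c d].
apply/eqP; rewrite eq_complex; apply/andP; split; apply/eqP.
  rewrite ReB (hadamard B2 oW starW r Wz).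
  rewrite (big_morph (@complex.Re R) (@cReD R) erefl); apply: eq_bigr => j _.
  by rewrite cReM /= mul0r subr0.
rewrite ImB (hadamard B2 oW starW i Wz).
rewrite (big_morph (@complex.Im R) (@cImD R) erefl); apply: eq_bigr => j _.
by rewrite cImM /= mul0r addr0.
Qed.

(** Meant for [a] a power of a transition function, which is constant in [t]: it shows that a
    Hadamard integral of sections is again a section. *)
Lemma I01CZ (a : R[i]) (g : E2 -> R[i]) z : csm W g -> W z ->
  I01C (fun t => a * g (z0 + t *: (z - z0))) =
  a * I01C (fun t => g (z0 + t *: (z - z0))).
Proof.
move=> [r i] Wz; have cr := cont01_path r Wz; have ci := cont01_path i Wz.
have cZ (x : R) g' : cont01 g' -> cont01 (fun t => x * g' t).
  by move=> cg t t01; apply: cvgM; [exact: cvg_cst|exact: cg].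
apply/eqP; rewrite eq_complex; apply/andP; split; apply/eqP.
  rewrite cReM /=; under [X in I01 X]eq_fun do rewrite cReM.
  rewrite (I01B (cZ (complex.Re a) _ cr) (cZ (complex.Im a) _ ci)).
  by rewrite (I01Z _ cr) (I01Z _ ci).
rewrite cImM /=; under [X in I01 X]eq_fun do rewrite cImM -(opprK (_ * complex.Re _)) -mulNr.
rewrite (I01B (cZ (complex.Re a) _ ci) (cZ (- complex.Im a) _ cr)).
by rewrite (I01Z _ cr) (I01Z _ ci) mulNr opprK.
Qed.

Lemma derivC_basis (f : E2 -> R[i]) z v : csm W f -> W z ->
  derivC v f z = \sum_i (@bcoord _ _ B2 i v)%:C * derivC (@bvec _ _ B2 i) f z.
Proof.
move=> [r i] Wz.
have d (g : E2 -> R) : sm W g ->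
    'D_v g z = \sum_i (@bcoord _ _ B2 i v) * 'D_(@bvec _ _ B2 i) g z.
  move=> sg; apply: (@derive_basis _ _ B2 g W z v oW Wz).
    by move=> u y Wy; exact: sm_derivable sg Wy.
  by move=> u; apply: sm_continuous (sm_derive u sg) _.
apply/eqP; rewrite eq_complex; apply/andP; split; apply/eqP.
  rewrite (big_morph (@complex.Re R) (@cReD R) erefl) /= d //.
  by apply: eq_bigr => j _; rewrite mul0r subr0.
rewrite (big_morph (@complex.Im R) (@cImD R) erefl) /= d //.
by apply: eq_bigr => j _; rewrite mul0r addr0.
Qed.

End ComplexHadamard.

(** * Families of sections and of operators *)

Section ManifoldLemmas.
Variables (R : realType) (E : normedModType R) (M : manifold E).
Implicit Types (c : atlas M) (x : M) (A : set M).

Lemma manifold_hausdorff : hausdorff_space M.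
Proof. by case: M. Qed.

Lemma dom_cover x : exists c, dom c x.
Proof. by case: M x. Qed.

Lemma open_dom c : open (dom c).
Proof. by case: M c. Qed.

Lemma open_coord c : open (coord c @` dom c).
Proof. by case: M c. Qed.

Lemma coordK c x : dom c x -> icoord c (coord c x) = x.
Proof. by case: M c x. Qed.

Lemma coord_continuous_dom c x : dom c x -> {for x, continuous (coord c)}.
Proof. by case: M c x. Qed.

Lemma icoord_continuous c y : (coord c @` dom c) y ->
  {for y, continuous (icoord c)}.
Proof. by case: M c y. Qed.

Lemma transition_smooth c c' :
  smooth_on (coord c @` (dom c `&` dom c')) (coord c' \o icoord c).
Proof. by case: M c c'. Qed.

Definition cset c A : set E := coord c @` (dom c `&` A).

Lemma csetP c A y : cset c A y <->
  [/\ (coord c @` dom c) y, coord c (icoord c y) = y, dom c (icoord c y) &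
      A (icoord c y)].
Proof.
split=> [[x [dx Ax] <-]|[_ e d a]]; last by exists (icoord c y).
by rewrite coordK //; split => //; exists x.
Qed.

Lemma cset_coord c A x : dom c x -> A x -> cset c A (coord c x).
Proof. by move=> dx Ax; exists x. Qed.

Lemma icoordK c y : (coord c @` dom c) y -> coord c (icoord c y) = y.
Proof. by case=> x dx <-; rewrite coordK. Qed.

Lemma dom_icoord c y : (coord c @` dom c) y -> dom c (icoord c y).
Proof. by case=> x dx <-; rewrite coordK. Qed.

Lemma open_cset c A : open A -> open (cset c A).
Proof.
move=> oA; have -> : cset c A = (coord c @` dom c) `&` (icoord c @^-1` A).
  apply/seteqP; split=> y; first by case/csetP.
  by case=> dy Ay; apply/csetP; rewrite icoordK //; split => //; exact: dom_icoord.
rewrite openE => y [dy Ay]; apply: filterI.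
  exact: open_nbhs_nbhs (conj (open_coord c) dy).
by apply: (icoord_continuous dy); exact: open_nbhs_nbhs (conj oA Ay).
Qed.

End ManifoldLemmas.

Lemma continuous_idfun (X : topologicalType) (x : X) :
  {for x, continuous (@idfun X)}.
Proof. by move=> A. Qed.

Lemma continuous_cstfun (X Y : topologicalType) (x : X) (y : Y) :
  {for x, continuous (fun _ : X => y)}.
Proof. exact: cvg_cst. Qed.

Lemma pair_affine1 (R : realType) (E1 E2 : normedModType R) (h : R) (v x : E1)
    (z : E2) : (h *: v + x, z) = h *: (v, 0) + (x, z).
Proof. by apply: (f_equal2 pair) => //=; rewrite scaler0 add0r. Qed.

Lemma pair_affine2 (R : realType) (E1 E2 : normedModType R) (h : R) (v x : E2)
    (y : E1) : (y, h *: v + x) = h *: (0, v) + (y, x).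
Proof. by apply: (f_equal2 pair) => //=; rewrite scaler0 add0r. Qed.

Section Families.
Variables (R : realType) (m : nat) (M : manifold 'rV[R]_m).
Variables (L : herm_line_bundle M) (k : nat).
Local Notation sec := (frame L -> M -> R[i]).
Local Notation op := (sec -> sec).

Lemma frame_open (i : frame L) : open (fdom i).
Proof. by case: L i. Qed.

Definition lincomb (a : R[i]) (s s' : sec) : sec := fun i x => a * s i x + s' i x.

Lemma cocycle_lincomb a s s' : cocycle_section k s -> cocycle_section k s' ->
  cocycle_section k (lincomb a s s').
Proof.
move=> [s0 st] [s0' st']; split=> [i x xi|i j x xi xj]; rewrite /lincomb.
  by rewrite s0 // s0' // mulr0 addr0.
by rewrite (st i j) // (st' i j) // mulrDr mulrCA.
Qed.

Lemma cocycle0 : cocycle_section k (0 : sec).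
Proof. by split=> // i j x xi xj; exact/esym/mulr0. Qed.

Lemma smooth_sectionP (s : sec) : smooth_section k s <->
  cocycle_section k s /\
  forall i c, csm (cset c (fdom i)) (fun y => s i (icoord c y)).
Proof.
split=> -[cs H]; split=> // i.
  by move=> c; have [r im] := H i; split; apply/smE; [exact: r|exact: im].
by split=> c; apply/smE; have [] := H i c.
Qed.

Lemma smooth_section0 : smooth_section k (0 : sec).
Proof. by apply/smooth_sectionP; split=> [|i c]; [exact: cocycle0|exact: csm_cst]. Qed.

Lemma smooth_lincomb a s s' : smooth_section k s -> smooth_section k s' ->
  smooth_section k (lincomb a s s').
Proof.
move=> /smooth_sectionP[cs ss] /smooth_sectionP[cs' ss'].
apply/smooth_sectionP; split=> [|i c]; first exact: cocycle_lincomb.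
have oU := open_cset c (frame_open i).
by apply: csm_add => //; apply: csm_scale.
Qed.

Variable ET : normedModType R.
Implicit Types (Om : set ET) (phi : ET -> sec).

(** [smooth_family] over a set in a chart space instead of over T. Nothing is asked of [phi] outside
    [Om], since the families of Hadamard's lemma are controlled only near a point. *)
Definition fam Om phi : Prop :=
  (forall z, Om z -> cocycle_section k (phi z)) /\
  (forall i c, csm (cset c (fdom i) `*` Om)
    (fun p => phi p.2 i (icoord c p.1))).

Let oX Om i (c : atlas M) : open Om -> open (cset c (@fdom _ _ _ L i) `*` Om).
Proof. by move=> oO; apply: open_prod => //; apply: open_cset; exact: frame_open. Qed.

Lemma fam_cst Om s : smooth_section k s -> fam Om (fun=> s).
Proof.
move=> /smooth_sectionP[cs ss]; split=> // i c.
apply: (@csm_affine _ _ _ _ (cset c (fdom i)) (fun y => s i (icoord c y)) fst fst).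
- by move=> x v h.
- by move=> x; exact: cvg_fst.
- by case=> y z [].
- exact: ss.
Qed.

Lemma fam_slice Om phi z : fam Om phi -> Om z -> smooth_section k (phi z).
Proof.
move=> [cs ss] Oz; apply/smooth_sectionP; split=> [|i c]; first exact: cs.
apply: (@csm_affine _ _ _ _ (cset c (fdom i) `*` Om)
   (fun p => phi p.2 i (icoord c p.1)) (fun y => (y, z)) (fun y => (y, 0))).
- by move=> x v h; exact: pair_affine1.
- by move=> x; apply: (@pair_continuous _ _ _ idfun (fun=> z)); [exact: continuous_idfun|exact: continuous_cstfun].
- by [].
- exact: ss.
Qed.

Lemma csm_slice2 (U : set 'rV[R]_m) Om (f : 'rV[R]_m * ET -> R[i]) y : U y ->
  csm (U `*` Om) f -> csm Om (fun z => f (y, z)).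
Proof.
move=> Uy; apply: (@csm_affine _ _ _ _ _ f (fun z => (y, z)) (fun z => (0, z))).
- by move=> x v h; exact: pair_affine2.
- by move=> x; apply: (@pair_continuous _ _ _ (fun=> y) idfun); [exact: continuous_cstfun|exact: continuous_idfun].
- by [].
Qed.

Lemma fam_pt Om phi i x : open Om -> fam Om phi -> csm Om (fun z => phi z i x).
Proof.
move=> oO [cs ss]; have [xi|xi] := pselect (fdom i x); last first.
  apply: (csm_eq oO _ (csm_cst Om 0)) => z /cs[s0 _].
  by rewrite s0.
have [c cx] := dom_cover x.
have := csm_slice2 (cset_coord cx xi) (ss i c).
by rewrite /= coordK.
Qed.

Lemma fam_eq Om phi phi' : open Om -> (forall z, Om z -> phi z = phi' z) ->
  fam Om phi -> fam Om phi'.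
Proof.
move=> oO e [cs ss]; split=> [z Oz|i c]; first by rewrite -e //; exact: cs.
by apply: (csm_eq (oX oO) _ (ss i c)) => -[y z] [_ /= Oz]; rewrite e.
Qed.

Lemma fam_sub Om Om' phi : Om' `<=` Om -> fam Om phi -> fam Om' phi.
Proof.
move=> OO [cs ss]; split=> [z /OO|i c]; first exact: cs.
by apply: csm_sub (ss i c) => -[y z] [/= Uy /OO].
Qed.

Lemma fam_local Om phi :
  (forall z, Om z -> exists V : set ET, V z /\ fam V phi) -> fam Om phi.
Proof.
move=> H; split=> [z /H[V [Vz [cs _]]]|i c]; first exact: cs.
apply: csm_local => -[y z] [/= Uy /H[V [Vz [_ ss]]]].
by exists (cset c (fdom i) `*` V).
Qed.

Lemma fam_lincomb Om a phi phi' : open Om -> fam Om phi -> fam Om phi' ->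
  fam Om (fun z => lincomb a (phi z) (phi' z)).
Proof.
move=> oO [cs ss] [cs' ss']; split=> [z Oz|i c].
  by apply: cocycle_lincomb; [exact: cs|exact: cs'].
by apply: csm_add (oX oO) _ (ss' i c); apply: csm_scale (ss i c); exact: oX.
Qed.

Lemma fam0 Om : fam Om (fun=> 0).
Proof. by apply: fam_cst; exact: smooth_section0. Qed.

Lemma fam_mul Om (f : M -> ET -> R[i]) phi : open Om ->
  (forall c, csm ((coord c @` dom c) `*` Om) (fun p => f (icoord c p.1) p.2)) ->
  fam Om phi -> fam Om (fun z i x => f x z * phi z i x).
Proof.
move=> oO sf [cs ss]; split=> [z /cs[s0 st]|i c].
  split=> [i x xi|i j x xi xj]; first by rewrite s0 // mulr0.
  by rewrite (st i j) // mulrCA.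
apply: csm_mul (oX oO) _ (ss i c).
by apply: csm_sub (sf c) => -[y z] [/= /csetP[]].
Qed.

(** The transition functions do not depend on the parameter, so differentiating in it preserves the
    cocycle condition. *)
Lemma fam_derive Om phi v : open Om -> fam Om phi ->
  fam Om (fun z i x => derivC v (fun z' => phi z' i x) z).
Proof.
move=> oO fphi; have [cs ss] := fphi; split=> [z Oz|i c].
  split=> [i x xi|i j x xi xj].
    rewrite -(derivC_cst 0 z v); apply: (derivC_eq v oO Oz); last exact: fam_pt.
    by move=> z' /cs[s0 _]; exact: s0.
  rewrite -(derivCZ _ v oO Oz (fam_pt j x oO fphi)).
  apply: (derivC_eq v oO Oz); last exact: fam_pt.
  by move=> z' /cs[_ st]; exact: st.
(* The derivative in the parameter is the derivative of the joint function along (0, v), to which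
   [csm_derive] applies. *)
have -> : (fun p : 'rV[R]_m * ET =>
    derivC v (fun z' => phi z' i (icoord c p.1)) p.2) =
    derivC (0, v) (fun p : 'rV[R]_m * ET => phi p.2 i (icoord c p.1)).
  apply/funext => -[y z] /=.
  apply: (@derivC_affine _ _ _ (fun p : 'rV[R]_m * ET => phi p.2 i (icoord c p.1))
    (fun z => (y, z)) (fun z => (0, z)) z v) => h.
  exact: pair_affine2.
exact: csm_derive (ss i c).
Qed.

Definition linear_op (D : op) : Prop :=
  forall a s s', smooth_section k s -> smooth_section k s' ->
    D (lincomb a s s') = lincomb a (D s) (D s').

(** What the Leibniz rule asks of an operator-valued map. Quantifying over all open subsets makes
    the notion stable under restriction to a ball and admits families that exist only locally. *)
Record locop Om (P : ET -> op) : Prop := Locop {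
  locop_linear : forall z, Om z -> linear_op (P z);
  locop_fam : forall Om' phi, open Om' -> Om' `<=` Om -> fam Om' phi ->
    fam Om' (fun z => P z (phi z)) }.

Lemma locop_smooth Om P z s : open Om -> locop Om P -> Om z ->
  smooth_section k s -> smooth_section k (P z s).
Proof.
move=> oO lP Oz /(fam_cst Om) fs.
exact: (fam_slice (locop_fam lP oO (@subset_refl _ Om) fs) Oz).
Qed.

Lemma linear_op0 D : linear_op D -> D 0 = 0.
Proof.
move=> lD; have := lD (-1) _ _ smooth_section0 smooth_section0.
have -> : lincomb (-1) 0 0 = 0.
  apply/funext => i; apply/funext => x.
  by change (-1 * 0 + 0 = 0 :> R[i]); rewrite mulr0 addr0.
move=> ->; apply/funext => i; apply/funext => x.
by rewrite /lincomb mulN1r addNr.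
Qed.

Lemma linear_op_sum (I : Type) (r : seq I) D (a : I -> R[i]) (s : I -> sec) s0 i x :
  linear_op D -> (forall j, smooth_section k (s j)) -> smooth_section k s0 ->
  D (fun i x => s0 i x + \sum_(j <- r) a j * s j i x) i x =
  D s0 i x + \sum_(j <- r) a j * D (s j) i x.
Proof.
move=> lD ss ss0; elim: r i x => [|j r IH] i x.
  have -> : (fun i x => s0 i x + \sum_(j <- [::]) a j * s j i x) = s0.
    by apply/funext => i'; apply/funext => x'; rewrite big_nil addr0.
  by rewrite big_nil addr0.
have sr : smooth_section k (fun i x => s0 i x + \sum_(j <- r) a j * s j i x).
  elim: r {IH} => [|j' r IH].
    have -> // : (fun i x => s0 i x + \sum_(j <- [::]) a j * s j i x) = s0.
    by apply/funext => i'; apply/funext => x'; rewrite big_nil addr0.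
  have := smooth_lincomb (a j') (ss j') IH; congr smooth_section.
  apply/funext => i'; apply/funext => x'.
  by rewrite /lincomb big_cons addrCA.
have -> : (fun i x => s0 i x + \sum_(j <- j :: r) a j * s j i x) =
    lincomb (a j) (s j) (fun i x => s0 i x + \sum_(j <- r) a j * s j i x).
  by apply/funext => i'; apply/funext => x'; rewrite /lincomb big_cons addrCA.
by rewrite lD // /lincomb IH big_cons addrCA.
Qed.

End Families.

(** * The Leibniz rule for operators applied to families *)

Section Leibniz.
Variables (R : realType) (m : nat) (M : manifold 'rV[R]_m).
Variables (L : herm_line_bundle M) (k : nat).
Variables (ET : normedModType R) (B : basis ET).
Local Notation sec := (frame L -> M -> R[i]).
Local Notation op := (sec -> sec).

Definition dfam (v : ET) (phi : ET -> sec) (z : ET) : sec :=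
  fun i x => derivC v (fun z' => phi z' i x) z.

(** The coefficient g_a in phi_z = phi_z0 + sum_a (z - z0)_a g_a(z): the average of the a-th partial
    derivative of phi over the segment from [z0] to [z]. *)
Definition hadamard_fam (z0 : ET) (phi : ET -> sec) (a : basis_index B)
    (z : ET) : sec :=
  fun i x => I01C (fun t : R => dfam (bvec a) phi (z0 + t *: (z - z0)) i x).

Variables (Om : set ET) (z0 : ET).
Hypotheses (oO : open Om) (O0 : Om z0).
Hypothesis starO : forall z (t : R), 0 <= t <= 1 -> Om z ->
  Om (z0 + t *: (z - z0)).

(** Off the frame domain the integrand is 0, and on overlaps the transition function comes out of
    the integral. Joint smoothness is that of an integral depending on parameters. *)
Lemma fam_hadamard phi a : fam k Om phi -> fam k Om (hadamard_fam z0 phi a).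
Proof.
move=> fphi; have fd := fam_derive (bvec a) oO fphi; have [cs ss] := fd.
have dpt i x : csm Om (fun z => dfam (bvec a) phi z i x) by exact: (fam_pt i x oO fd).
split=> [z Oz|i c].
  split=> [i x xi|i j x xi xj].
    rewrite /hadamard_fam /I01C (@I01_eq _ _ (fun=> 0)) ?I01_cst.
      rewrite (@I01_eq _ _ (fun=> 0)) ?I01_cst // => t t01.
      by have [s0 _] := cs _ (starO t01 Oz); rewrite /dfam s0.
    move=> t t01.
    by have [s0 _] := cs _ (starO t01 Oz); rewrite /dfam s0.
  rewrite /hadamard_fam -(I01CZ starO _ (dpt j x) Oz).
  rewrite /I01C; congr (_ +i* _); apply: I01_eq => t t01;
    by have [_ st] := cs _ (starO t01 Oz); rewrite /dfam (st i j).
have oU := open_cset c (frame_open i).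
exact: (csm_path_integral (row_basis R m) B oU oO starO (ss i c)).
Qed.

Lemma fam_expand phi z i x : fam k Om phi -> Om z ->
  phi z i x = phi z0 i x +
    \sum_a (bcoord a (z - z0))%:C * hadamard_fam z0 phi a z i x.
Proof. by move=> fphi; apply: (hadamardC B oO starO (fam_pt i x oO fphi)). Qed.

Lemma hadamard_fam0 phi a : hadamard_fam z0 phi a z0 = dfam (bvec a) phi z0.
Proof.
apply/funext => i; apply/funext => x; rewrite /hadamard_fam subrr /I01C.
have e (t : R) : z0 + t *: (0 : ET) = z0 by rewrite scaler0 addr0.
under [X in I01 X +i* _]eq_fun do rewrite e.
under [X in _ +i* I01 X]eq_fun do rewrite e.
by rewrite !I01_cst; case: (dfam _ _ _ _ _).
Qed.

Lemma dfam_basis phi v i x : fam k Om phi ->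
  dfam v phi z0 i x = \sum_a (@bcoord _ _ B a v)%:C * dfam (@bvec _ _ B a) phi z0 i x.
Proof. by move=> fphi; apply: (derivC_basis B oO v (fam_pt i x oO fphi) O0). Qed.

(** In P_z phi_z = P_z phi_z0 + sum_a (z - z0)_a P_z g_a(z) the coordinates are scalars for fixed
    [z], which is why they pass through [P z]. They vanish at [z0], so the derivatives of P_z g_a(z)
    drop out, and g_a(z0) is the a-th partial derivative of phi. *)
Lemma leibniz_star (P : ET -> op) phi v i x : locop k Om P -> fam k Om phi ->
  dfam v (fun z => P z (phi z)) z0 i x =
  dfam v (fun z => P z (phi z0)) z0 i x + P z0 (dfam v phi z0) i x.
Proof.
move=> lP fphi; have s0 := fam_slice fphi O0.
have f0 : fam k Om (fun z => P z (phi z0)).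
  by apply: (locop_fam lP) => //; exact: fam_cst.
pose g := hadamard_fam z0 phi.
have fg a : fam k Om (g a) by exact: fam_hadamard.
have fPg a : fam k Om (fun z => P z (g a z)) by apply: (locop_fam lP).
have sl a : sm Om (fun z => @bcoord _ _ B a (z - z0)).
  apply: (@sm_affine _ ET ET Om setT (@bcoord _ _ B a) (fun z => z - z0) idfun) => //.
  - by move=> z w h; rewrite addrA.
  - by move=> z; apply: cvgB; [exact: continuous_idfun|exact: cvg_cst].
  - by apply: sm_lin => [b y z|z]; [exact: bcoord_linear|exact: bcoord_continuous].
have dl a : 'D_v (fun z => @bcoord _ _ B a (z - z0)) z0 = @bcoord _ _ B a v.
  apply: (proj2 (derive_dist (a := bcoord a v) _)) => e e0; exists 1 => // h h0 _.
  by rewrite addrK subrr bcoord0 subr0 bcoordZ mulrA mulVf // mul1r subrr normr0.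
have expand z : Om z -> P z (phi z) i x = P z (phi z0) i x +
    \sum_a (bcoord a (z - z0))%:C * P z (g a z) i x.
  move=> Oz; have -> : phi z = fun i x => phi z0 i x +
      \sum_a (bcoord a (z - z0))%:C * g a z i x.
    by apply/funext => i'; apply/funext => x'; exact: fam_expand.
  apply: linear_op_sum; [exact: locop_linear lP _ Oz| |exact: s0].
  by move=> a; exact: fam_slice (fg a) Oz.
have sg a : csm Om (fun z => (bcoord a (z - z0))%:C * P z (g a z) i x).
  by apply: csm_mul => //; [exact: csm_real|exact: fam_pt (fPg a)].
have fP : fam k Om (fun z => P z (phi z)) by apply: (locop_fam lP).
rewrite [LHS]/dfam (derivC_eq v oO O0 expand (fam_pt i x oO fP)).
rewrite (derivCD v oO O0 (fam_pt i x oO f0) (csm_sum _ oO sg)).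
congr (_ + _); rewrite (derivC_sum _ v oO O0 sg).
(* The zero section stands in for the leading term that [linear_op_sum] expects. *)
have -> : dfam v phi z0 = fun i x => (0 : sec) i x + \sum_a (@bcoord _ _ B a v)%:C * g a z0 i x.
  apply/funext => i'; apply/funext => x'; rewrite (dfam_basis v i' x' fphi).
  rewrite [RHS]add0r; apply: eq_bigr => a _; by rewrite /g hadamard_fam0.
rewrite (linear_op_sum _ _ i x (locop_linear lP O0)); last exact: smooth_section0.
  rewrite (linear_op0 (locop_linear lP O0)) [RHS]add0r; apply: eq_bigr => a _.
  rewrite (derivCM v oO O0 (csm_real (sl a)) (fam_pt i x oO (fPg a))).
  by rewrite derivC_real dl subrr bcoord0 mul0r add0r.
by move=> a; exact: fam_slice (fg a) O0.
Qed.

End Leibniz.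

Lemma ball_star (R : realType) (E : normedModType R) (z0 z : E) (r t : R) :
  0 <= t <= 1 -> ball z0 r z -> ball z0 r (z0 + t *: (z - z0)).
Proof.
move=> /andP[t0 t1]; rewrite -ball_normE /ball_ /= => zr.
rewrite opprD addrA subrr add0r normrN normrZ (ger0_norm t0) distrC in zr *.
by apply: le_lt_trans zr; rewrite ler_piMl.
Qed.

(** Reduces to a ball about [z0], which is star-shaped. *)
Lemma leibniz (R : realType) (m : nat) (M : manifold 'rV[R]_m)
    (L : herm_line_bundle M) (k : nat) (ET : normedModType R) (B : basis ET)
    (Om : set ET) (z0 : ET) (P : ET -> (frame L -> M -> R[i]) -> frame L -> M -> R[i])
    phi v i x : open Om -> Om z0 -> locop k Om P -> fam k Om phi ->
  dfam v (fun z => P z (phi z)) z0 i x =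
  dfam v (fun z => P z (phi z0)) z0 i x + P z0 (dfam v phi z0) i x.
Proof.
move=> oO O0 lP fphi.
have := open_nbhs_nbhs (conj oO O0) => /nbhs_ballP[r /= r0 rO].
have oB : open (ball z0 r) by exact: ball_open.
have lP' : locop k (ball z0 r) P.
  split=> [z /rO Oz|Om' phi' oO' OO']; first exact: locop_linear lP _ Oz.
  by apply: (locop_fam lP) => //; exact: subset_trans OO' rO.
exact: (leibniz_star B oB (ballxx z0 r0) (fun z t => @ball_star _ _ z0 z r t)
  v i x lP' (fam_sub rO fphi)).
Qed.

Section LinearImage.
Variables (R : realType) (E F : normedModType R).

(** A continuous linear form commutes with the limits that define derivatives. It is applied to
    transition maps, which are given as vector-valued smooth maps and must be fed to [sm_comp] by
    their coordinates. *)
Lemma sm_lin_comp (U : set E) (f : E -> F) (l : F -> R) : open U ->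
  (forall a x y, l (a *: x + y) = a * l x + l y) -> continuous l ->
  smooth_on U f -> sm U (l \o f).
Proof.
move=> oU ll cl sf; split=> n; elim: n f sf => [|n IH] f sf.
  split=> // x Ux; apply: continuous_comp; first exact: (sf [::] x Ux).1.
  exact: cl.
have cf x : U x -> {for x, continuous (l \o f)}.
  by move=> Ux; apply: continuous_comp; [exact: (sf [::] x Ux).1|exact: cl].
have l0 : l 0 = 0.
  have := ll 1 0 0; rewrite scaler0 addr0 mul1r => /eqP.
  by rewrite -subr_eq0 opprD addrA subrr sub0r oppr_eq0 => /eqP.
have lZ a x : l (a *: x) = a * l x by have := ll a x 0; rewrite !addr0 l0 addr0.
have lB x y : l (x - y) = l x - l y.
  by have := ll (-1) y x; rewrite scaleN1r mulN1r addrC => ->; rewrite addrC.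
have dl x v : U x -> derivable (l \o f) x v /\ 'D_v (l \o f) x = l ('D_v f x).
  move=> Ux; apply: derive_cvg.
  have -> : (fun h : R => h^-1 *: ((l \o f) (h *: v + x) - (l \o f) x)) =
      l \o (fun h => h^-1 *: (f (h *: v + x) - f x)).
    by apply/funext => h /=; rewrite lZ lB.
  have df : (fun h : R => h^-1 *: (f (h *: v + x) - f x)) @ 0^' --> 'D_v f x.
    exact: (sf [::] x Ux).2.
  exact: (cvg_comp _ _ df (cl _)).
split=> // v; split=> [x Ux|]; first exact: (dl x v Ux).1.
have sD : smooth_on U ('D_v f) by move=> vs x Ux; exact: (sf (v :: vs) x Ux).
by apply: (ck_eq oU _ (IH _ sD)) => x Ux; rewrite (dl x v Ux).2.
Qed.

End LinearImage.

(** * Extension of a local family to all of T by a cutoff *)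

Section Cutoff.
Variables (R : realType) (m : nat) (M : manifold 'rV[R]_m).
Variables (L : herm_line_bundle M) (k : nat) (n : nat).
Variables (T : complex_manifold R n).
Local Notation ET := ('rV[R]_n * 'rV[R]_n)%type.
Local Notation sec := (frame L -> M -> R[i]).
Local Notation op := (sec -> sec).
Local Notation BT := (prod_basis (row_basis R n) (row_basis R n)).
Implicit Types (d : atlas T).

Definition chart_dom d : set ET := coord d @` dom d.

Lemma smooth_familyP (psi : T -> sec) : smooth_family k psi <->
  (forall t, cocycle_section k (psi t)) /\
  forall i c d, csm (cset c (fdom i) `*` chart_dom d)
    (fun p => psi (icoord d p.2) i (icoord c p.1)).
Proof.
split=> -[cs H]; split=> // i.
  by move=> c d; have [r im] := H i; split; apply/smE; [exact: r|exact: im].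
by split=> c d; apply/smE; have [] := H i c d.
Qed.

Lemma smooth_family_fam (psi : T -> sec) d : smooth_family k psi ->
  fam k (chart_dom d) (fun z => psi (icoord d z)).
Proof.
by move=> /smooth_familyP[cs ss]; split=> [z _|i c]; [exact: cs|exact: ss].
Qed.

Variables (d : atlas T) (Om K : set ET) (chi : ET -> R).
Hypotheses (oO : open Om) (OT : Om `<=` chart_dom d).
Hypotheses (schi : sm setT chi) (cK : compact K) (KO : K `<=` Om).
Hypothesis chiK : forall z, chi z != 0 -> K z.

(** Outside the chart [coord d] is junk, hence the test on [dom d] in addition to the vanishing of
    [chi]. *)
Definition cutoff (phi : ET -> sec) (t : T) : sec :=
  if `[< dom d t >] then fun i x => (chi (coord d t))%:C * phi (coord d t) i x
  else 0.

Lemma cutoff_out phi t : ~ (icoord d @` K) t -> cutoff phi t = 0.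
Proof.
rewrite /cutoff; case: asboolP => // dt nK; apply/funext => i; apply/funext => x.
have [->|/chiK Kz] := eqVneq (chi (coord d t)) 0; first by rewrite mul0r.
by case: nK; exists (coord d t) => //; rewrite coordK.
Qed.

Lemma cutoff_cocycle phi t : fam k Om phi -> cocycle_section k (cutoff phi t).
Proof.
move=> [cs _]; have [[z Kz zt]|nK] := pselect ((icoord d @` K) t); last first.
  by rewrite cutoff_out //; exact: cocycle0.
have Oz := KO Kz; have [s0 st] := cs _ Oz.
have dt : dom d t by rewrite -zt; exact: dom_icoord (OT Oz).
have ct : coord d t = z by rewrite -zt icoordK //; exact: OT.
rewrite /cutoff asboolT // ct; split=> [i x xi|i j x xi xj].
  by rewrite s0 // mulr0.
by rewrite (st i j) // mulrCA.
Qed.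

(** T is covered by two open sets: the part [A] of the chart lying over [Om], where the cutoff is a
    smooth family composed with a transition map, and the complement [C] of the image of [K], where
    it is zero. [C] is open because compact sets in the Hausdorff space T are closed. *)
Lemma cutoff_smooth phi : fam k Om phi -> smooth_family k (cutoff phi).
Proof.
move=> fphi; apply/smooth_familyP; split=> [t|i c d'].
  exact: cutoff_cocycle.
have oC : open (cset c (@fdom _ _ _ L i)) by apply: open_cset; exact: frame_open.
pose A : set T := dom d `&` (coord d @^-1` Om).
have oA : open A.
  rewrite openE => t [dt Ot]; apply: filterI.
    exact: open_nbhs_nbhs (conj (open_dom d) dt).
  by apply: (coord_continuous_dom dt); exact: open_nbhs_nbhs (conj oO Ot).
pose C : set T := ~` (icoord d @` K).
have oCo : open C.
  apply: closed_openC; apply: compact_closed; first exact: manifold_hausdorff.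
  apply: continuous_compact => //; apply: continuous_in_subspaceT => z.
  by rewrite inE => /KO /OT; exact: icoord_continuous.
apply: csm_local => -[y z'] [/= Uy dz'].
have [At|nA] := pselect (A (icoord d' z')); last first.
  exists (cset c (fdom i) `*` cset d' C); split.
    split=> //; apply/csetP; split=> //; [exact: icoordK|exact: dom_icoord|].
    move=> [z Kz zt]; apply: nA; rewrite -zt.
    split; first exact: dom_icoord (OT (KO Kz)).
    by rewrite /= icoordK; [exact: KO|exact: OT (KO Kz)].
  apply: (csm_eq _ _ (csm_cst _ 0)).
    by apply: open_prod => //; exact: open_cset.
  by move=> -[y1 z1] [/= _ /csetP[_ _ _ Cz1]]; rewrite cutoff_out.
exists (cset c (fdom i) `*` cset d' A); split.
  by split=> //; apply/csetP; split=> //; [exact: icoordK|exact: dom_icoord].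
pose tau := coord d \o icoord d'.
pose f (p : 'rV[R]_m * ET) := (chi p.2)%:C * phi p.2 i (icoord c p.1).
have oUA : open (cset c (@fdom _ _ _ L i) `*` cset d' A).
  by apply: open_prod => //; exact: open_cset.
have oUO : open (cset c (@fdom _ _ _ L i) `*` Om) by exact: open_prod.
pose g (p : 'rV[R]_m * ET) := (p.1, tau p.2).
have tau_sm : smooth_on (cset d' (dom d)) tau by exact: transition_smooth.
have AT : cset d' A `<=` cset d' (dom d).
  by move=> z /csetP[? ? ? [? _]]; apply/csetP.
apply: (csm_eq (f := f \o g) oUA).
  move=> -[y1 z1] [/= _ /csetP[_ _ _ [dz1 _]]].
  by rewrite /f /cutoff asboolT.
apply: (csm_comp (B := prod_basis (row_basis R m) BT) oUA oUO).
- by move=> -[y1 z1] [/= Uy1 /csetP[_ _ _ [_ Oz1]]].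
- move=> -[y1 z1] [/= Uy1 Az1].
  apply: (@pair_continuous _ _ _ fst (fun p : 'rV[R]_m * ET => tau p.2)).
    exact: cvg_fst.
  apply: (@continuous_comp _ _ _ snd tau); first exact: cvg_snd.
  exact: (tau_sm [::] z1 (AT _ Az1)).1.
- apply: csm_mul => //; last by case: fphi => _ /(_ i c).
  apply: csm_real; apply: (@sm_affine _ _ _ _ setT chi snd snd) => //.
  by move=> x; exact: cvg_snd.
- case=> a /=.
    have sa : sm setT (@bcoord _ _ (row_basis R m) a).
      by apply: sm_lin; [exact: bcoord_linear|exact: bcoord_continuous].
    apply: (@sm_affine _ _ _ _ setT (@bcoord _ _ (row_basis R m) a) fst fst) => //.
    by move=> x; exact: cvg_fst.
  have sa : sm (cset d' A) (@bcoord _ _ BT a \o tau).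
    apply: sm_sub AT _; apply: sm_lin_comp tau_sm.
    + exact: open_cset (open_dom d).
    + exact: bcoord_linear.
    + exact: bcoord_continuous.
  apply: (@sm_affine _ _ _ _ (cset d' A) (@bcoord _ _ BT a \o tau) snd snd) => //.
  + by move=> x; exact: cvg_snd.
  + by case=> y1 z1 [].
Qed.

End Cutoff.

(** * Operator-valued maps over a chart and their derivatives *)

Section SmoothOperators.
Variables (R : realType) (m : nat) (M : manifold 'rV[R]_m).
Variables (L : herm_line_bundle M) (k : nat) (n : nat).
Variables (T : complex_manifold R n).
Local Notation ET := ('rV[R]_n * 'rV[R]_n)%type.
Local Notation sec := (frame L -> M -> R[i]).
Local Notation op := (sec -> sec).
Local Notation BT := (prod_basis (row_basis R n) (row_basis R n)).

Lemma Dk_linear_op (D : op) : Dk k D -> linear_op k D.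
Proof. by move=> [_ lD _] a s s'; exact: lD. Qed.

Lemma lincomb_0r a (s : sec) : lincomb a s 0 = fun i x => a * s i x.
Proof. by apply/funext => i; apply/funext => x; rewrite /lincomb [LHS]addr0. Qed.

Lemma linear_opZ (D : op) a s : linear_op k D -> smooth_section k s ->
  D (fun i x => a * s i x) = fun i x => a * D s i x.
Proof.
move=> lD ss; rewrite -lincomb_0r (lD a s 0 ss (@smooth_section0 _ _ _ L k)).
by rewrite (linear_op0 lD) lincomb_0r.
Qed.

(* If chi is a bump function at z1, then near z1 the sections D phi and
   chi^-1 D (chi phi) agree, and chi phi extends by zero to all of T. *)
Lemma smooth_op_locop (D : T -> op) (d : atlas T) : smooth_op k D ->
  locop k (chart_dom d) (fun z => D (icoord d z)).
Proof.
move=> [DD Dfam]; split=> [z _|Om phi oO OT fphi]; first exact: Dk_linear_op.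
apply: fam_local => z1 Oz1.
have [chi [K [schi cK KO chi1 chiK]]] := bump_exists BT oO Oz1.
have sp := cutoff_smooth oO OT schi cK KO chiK fphi.
pose V := Om `&` [set z | chi z != 0].
have cchi z : {for z, continuous chi} by apply: sm_continuous schi _.
have oV : open V.
  apply: openI => //; apply: (@open_comp _ _ chi [set r | r != 0]) => [z _|].
    exact: cchi.
  exact: open_neq.
exists V; split=> //.
have fD : fam k V (fun z => D (icoord d z) (cutoff d chi phi (icoord d z))).
  apply: fam_sub (smooth_family_fam d (Dfam _ sp)).
  by move=> z [/OT].
have fV : fam k V (fun z i x => (((chi z)^-1)%:C) *
    D (icoord d z) (cutoff d chi phi (icoord d z)) i x).
  apply: (fam_mul (f := fun x z => ((chi z)^-1)%:C) oV _ fD) => c.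
  apply: (@csm_affine _ _ _ _ V (fun z => ((chi z)^-1)%:C) snd snd) => //.
  - by move=> x; exact: cvg_snd.
  - by case=> y z [].
  - apply: csm_real; apply: sm_inv => //; first by move=> z [].
    exact: sm_sub schi.
apply: fam_eq oV _ fV => z [Oz chiz].
have dz : dom d (icoord d z) by apply: dom_icoord; exact: OT.
have -> : cutoff d chi phi (icoord d z) = fun i x => (chi z)%:C * phi z i x.
  by rewrite /cutoff asboolT // icoordK //; exact: OT.
rewrite (linear_opZ (chi z)%:C (Dk_linear_op (DD (icoord d z))) (fam_slice fphi Oz)).
apply/funext => i; apply/funext => x; rewrite mulrA -rmorphM mulVf //.
by rewrite mul1r.
Qed.

Variable ET' : normedModType R.
Implicit Types (P Q : ET' -> op) (Om : set ET').

Lemma locop_comp Om P Q : open Om -> locop k Om P -> locop k Om Q ->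
  locop k Om (fun z s => P z (Q z s)).
Proof.
move=> oO lP lQ; split=> [z Oz a s s' ss ss'|Om' phi oO' OO fphi].
  rewrite (locop_linear lQ Oz a ss ss').
  exact: (locop_linear lP Oz a (locop_smooth oO lQ Oz ss) (locop_smooth oO lQ Oz ss')).
by apply: (locop_fam lP) => //; apply: (locop_fam lQ).
Qed.

Lemma locop_lincomb Om a P Q : locop k Om P -> locop k Om Q ->
  locop k Om (fun z s => lincomb a (P z s) (Q z s)).
Proof.
move=> lP lQ; split=> [z Oz b s s' ss ss'|Om' phi oO' OO fphi].
  rewrite (locop_linear lQ Oz b ss ss') (locop_linear lP Oz b ss ss').
  by apply/funext => i; apply/funext => x; rewrite /lincomb; ring.
by apply: fam_lincomb => //; [apply: (locop_fam lP)|apply: (locop_fam lQ)].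
Qed.

Lemma locop_mul Om (f : M -> ET' -> R[i]) :
  (forall c, csm ((coord c @` dom c) `*` Om) (fun p => f (icoord c p.1) p.2)) ->
  locop k Om (fun z => mulop (fun x => f x z) : op).
Proof.
move=> sf; split=> [z Oz b s s' ss ss'|Om' phi oO' OO fphi].
  by apply/funext => i; apply/funext => x; rewrite /lincomb /mulop; ring.
apply: fam_mul => // c; apply: csm_sub (sf c).
by move=> -[y z] [/= ? /OO].
Qed.

Definition dop (v : ET') P (z : ET') : op := fun s => dfam v (fun z' => P z' s) z.

Lemma dop_linear Om v P z : open Om -> locop k Om P -> Om z ->
  linear_op k (dop v P z).
Proof.
move=> oO lP Oz a s s' ss ss'; apply/funext => i; apply/funext => x.
have f1 := locop_fam lP oO (@subset_refl _ Om) (fam_cst Om ss).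
have f2 := locop_fam lP oO (@subset_refl _ Om) (fam_cst Om ss').
have p1 := fam_pt i x oO f1; have p2 := fam_pt i x oO f2.
rewrite /lincomb /dop /dfam -(derivCZ a v oO Oz p1).
rewrite -(derivCD v oO Oz (csm_scale a oO p1) p2).
apply: (derivC_eq v oO Oz).
  by move=> z' Oz'; rewrite -/(lincomb a s s') (locop_linear lP Oz' a ss ss').
have f3 := locop_fam lP oO (@subset_refl _ Om) (fam_cst Om (smooth_lincomb a ss ss')).
exact: (fam_pt i x oO f3).
Qed.

Lemma dop_smooth Om v P z s : open Om -> locop k Om P -> Om z ->
  smooth_section k s -> smooth_section k (dop v P z s).
Proof.
move=> oO lP Oz ss.
have f1 := locop_fam lP oO (@subset_refl _ Om) (fam_cst Om ss).
exact: (fam_slice (fam_derive v oO f1) Oz).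
Qed.

Lemma dop_comp (B : basis ET') Om v P Q z s : open Om -> locop k Om P ->
  locop k Om Q -> Om z -> smooth_section k s ->
  dop v (fun z s => P z (Q z s)) z s =
  (fun i x => dop v P z (Q z s) i x + P z (dop v Q z s) i x).
Proof.
move=> oO lP lQ Oz ss; apply/funext => i; apply/funext => x.
have f1 := locop_fam lQ oO (@subset_refl _ Om) (fam_cst Om ss).
exact: (leibniz B v i x oO Oz lP f1).
Qed.

Lemma dop_lincomb Om a v P Q z s : open Om -> locop k Om P -> locop k Om Q ->
  Om z -> smooth_section k s ->
  dop v (fun z s => lincomb a (P z s) (Q z s)) z s =
  lincomb a (dop v P z s) (dop v Q z s).
Proof.
move=> oO lP lQ Oz ss; apply/funext => i; apply/funext => x.
have p1 := fam_pt i x oO (locop_fam lP oO (@subset_refl _ Om) (fam_cst Om ss)).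
have p2 := fam_pt i x oO (locop_fam lQ oO (@subset_refl _ Om) (fam_cst Om ss)).
rewrite /dop /dfam /lincomb (derivCD v oO Oz (csm_scale a oO p1) p2).
by rewrite (derivCZ a v oO Oz p1).
Qed.

End SmoothOperators.

(** * The operators b and bbar *)

Section SmoothMatrices.
Variables (R : realType) (E : normedModType R) (U : set E).
Hypothesis oU : open U.

Lemma sm_det (n : nat) (A : E -> 'M[R]_n) :
  (forall i j, sm U (fun x => A x i j)) -> sm U (fun x => \det (A x)).
Proof.
move=> sA; apply: sm_sum => // s; apply: sm_mul => //; first exact: sm_cst.
exact: sm_prod.
Qed.

(** By Cramer's rule, entries of the inverse are cofactors divided by the determinant. *)
Lemma sm_invmx (n : nat) (A : E -> 'M[R]_n) :
  (forall x, U x -> A x \in unitmx) ->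
  (forall i j, sm U (fun x => A x i j)) ->
  forall i j, sm U (fun x => invmx (A x) i j).
Proof.
move=> uA sA i j.
apply: (@sm_eq _ _ U (fun x => (\det (A x))^-1 * cofactor (A x) j i)) => //.
  by move=> x /uA ux; rewrite /invmx ux !mxE.
apply: sm_mul => //.
  apply: sm_inv; [exact: oU| |exact: sm_det].
  by move=> x /uA; rewrite unitmxE unitfE.
apply: sm_mul => //; first exact: sm_cst.
apply: sm_det => a b.
by apply: (sm_eq oU _ (sA (lift j a) (lift i b))) => x _; rewrite !mxE.
Qed.

End SmoothMatrices.

Section JointSmoothness.
Variables (R : realType) (m : nat) (M : manifold 'rV[R]_m) (n : nat).
Variables (T : complex_manifold R n) (c : atlas M) (d : atlas T).
Local Notation ET := ('rV[R]_n * 'rV[R]_n)%type.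

Definition joint_dom : set ('rV[R]_m * ET) := cset c (dom c) `*` chart_dom d.

(** Smoothness is joint in M and T even for quantities differentiated along M alone, such as
    Christoffel symbols, because the operators act on families over T. *)
Definition jsm (f : M -> T -> R) : Prop :=
  sm joint_dom (fun p => f (icoord c p.1) (icoord d p.2)).

Definition jcsm (f : M -> T -> R[i]) : Prop :=
  csm joint_dom (fun p => f (icoord c p.1) (icoord d p.2)).

Lemma open_joint : open joint_dom.
Proof.
apply: open_prod; first by apply: open_cset; exact: open_dom.
exact: open_coord.
Qed.

Lemma joint_domP y z : joint_dom (y, z) ->
  [/\ coord c (icoord c y) = y, dom c (icoord c y),
      coord d (icoord d z) = z & dom d (icoord d z)].
Proof.
by move=> [/= /csetP[] *]; split=> //; [exact: icoordK|exact: dom_icoord].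
Qed.

Lemma smooth2_jsm (A : set M) f : dom c `<=` A -> smooth2 A f -> jsm f.
Proof.
move=> cA /(_ c d)/smE; apply: sm_sub => -[y z] [/= /csetP[h1 h2 h3 h4] h5].
by split=> //; apply/csetP; split=> //; exact: cA.
Qed.

Lemma smooth_jsm (f : M -> R) : smooth (dom c) f -> jsm (fun x _ => f x).
Proof.
move=> /(_ c)/smE sf.
apply: (@sm_affine _ _ _ _ _ (f \o icoord c) fst fst _ _ _ sf) => //.
- by move=> x; exact: cvg_fst.
- by case=> y z [].
Qed.

Lemma jsm_pd f mu : jsm f -> jsm (fun x s => pd c mu (f ^~ s) x).
Proof.
move=> /(sm_derive (delta_mx 0 mu, 0)); apply: sm_eq; first exact: open_joint.
move=> -[y z] /joint_domP[ey _ _ _]; rewrite /pd /vder ey.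
have [<- _] := @derive_affine _ _ _ (fun p : 'rV[R]_m * ET =>
  f (icoord c p.1) (icoord d p.2)) (fun y => (y, z)) (fun y => (y, 0)) y
  (delta_mx 0 mu) (fun h => pair_affine1 h _ _ _).
by [].
Qed.

Lemma jsm_vder f v : jsm f -> jsm (fun x s => vder d v (f x) s).
Proof.
move=> /(sm_derive (0, v)); apply: sm_eq; first exact: open_joint.
move=> -[y z] /joint_domP[_ _ ez _]; rewrite /vder ez.
have [<- _] := @derive_affine _ _ _ (fun p : 'rV[R]_m * ET =>
  f (icoord c p.1) (icoord d p.2)) (fun z => (y, z)) (fun z => (0, z)) z
  v (fun h => pair_affine2 h _ _ _).
by [].
Qed.

Lemma jcsm_pdC f mu : jcsm f -> jcsm (fun x s => pdC c mu (f ^~ s) x).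
Proof.
move=> [fr fi]; split.
- exact: (@jsm_pd (fun x s => complex.Re (f x s)) mu fr).
- exact: (@jsm_pd (fun x s => complex.Im (f x s)) mu fi).
Qed.

Lemma jcsm_real f : jsm f -> jcsm (fun x s => (f x s)%:C).
Proof. exact: csm_real. Qed.

Lemma jcsm_sum (I : Type) (r : seq I) (f : I -> M -> T -> R[i]) :
  (forall i, jcsm (f i)) -> jcsm (fun x s => \sum_(i <- r) f i x s).
Proof. by move=> sf; apply: csm_sum => //; exact: open_joint. Qed.

Lemma jcsm_mul f g : jcsm f -> jcsm g -> jcsm (fun x s => f x s * g x s).
Proof. by apply: csm_mul; exact: open_joint. Qed.

Lemma jcsm_add f g : jcsm f -> jcsm g -> jcsm (fun x s => f x s + g x s).
Proof. by apply: csm_add; exact: open_joint. Qed.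

Lemma jcsm_opp f : jcsm f -> jcsm (fun x s => - f x s).
Proof. by apply: csm_opp; exact: open_joint. Qed.

Lemma jcsm_cst a : jcsm (fun _ _ => a).
Proof. exact: csm_cst. Qed.

Lemma jsm_sum (I : Type) (r : seq I) (f : I -> M -> T -> R) :
  (forall i, jsm (f i)) -> jsm (fun x s => \sum_(i <- r) f i x s).
Proof. by move=> sf; apply: sm_sum => //; exact: open_joint. Qed.

Lemma jsm_mul f g : jsm f -> jsm g -> jsm (fun x s => f x s * g x s).
Proof. by apply: sm_mul; exact: open_joint. Qed.

Lemma jsm_add f g : jsm f -> jsm g -> jsm (fun x s => f x s + g x s).
Proof. by apply: sm_add; exact: open_joint. Qed.

Lemma jsm_opp f : jsm f -> jsm (fun x s => - f x s).
Proof. by apply: sm_opp; exact: open_joint. Qed.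

Lemma jcsm_mulmx p q r (A : M -> T -> 'M[R[i]]_(p, q)) (C : M -> T -> 'M[R[i]]_(q, r)) :
  (forall i j, jcsm (fun x s => A x s i j)) ->
  (forall i j, jcsm (fun x s => C x s i j)) ->
  forall i j, jcsm (fun x s => (A x s *m C x s) i j).
Proof.
move=> sA sC i j; under eq_fun2 do rewrite mxE.
by apply: jcsm_sum => a; apply: jcsm_mul.
Qed.

Section Coefficients.
Variables (om : atlas M -> M -> 'M[R]_m) (J : atlas M -> M -> T -> 'M[R]_m).
Hypotheses (Hom : symplectic om) (HJ : kahler_family om J).

(** J squares to -1, so [- J] is its inverse. *)
Lemma metric_unit x s : dom c x -> metric om J c x s \in unitmx.
Proof.
move=> cx; rewrite /metric unitmx_mul (symp_nondeg Hom cx) /=.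
have : J c x s *m (- J c x s) = 1%:M by rewrite mulmxN (kah_acs HJ s cx) opprK.
by case/mulmx1_unit.
Qed.

Lemma jsm_J mu nu : jsm (fun x s => J c x s mu nu).
Proof. exact: (smooth2_jsm (@subset_refl _ (dom c)) (kah_smooth HJ mu nu)). Qed.

Lemma jsm_metric mu nu : jsm (fun x s => metric om J c x s mu nu).
Proof.
rewrite /metric; under eq_fun2 do rewrite mxE.
apply: jsm_sum => ka; apply: jsm_mul; last exact: jsm_J.
exact: (smooth_jsm (symp_smooth Hom mu ka)).
Qed.

Lemma jsm_inv_metric mu nu : jsm (fun x s => inv_metric om J c x s mu nu).
Proof.
apply: (sm_invmx open_joint); last exact: jsm_metric.
by move=> -[y z] /joint_domP[_ cy _ _]; exact: metric_unit.
Qed.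

Lemma jsm_christoffel la mu nu : jsm (fun x s => christoffel om J c x s la mu nu).
Proof.
apply: jsm_mul; first exact: sm_cst.
apply: jsm_sum => ka; apply: jsm_mul; first exact: jsm_inv_metric.
apply: jsm_add; last first.
  by apply: jsm_opp; apply: (@jsm_pd (fun x s => metric om J c x s mu nu)); exact: jsm_metric.
apply: jsm_add.
- by apply: (@jsm_pd (fun x s => metric om J c x s nu ka)); exact: jsm_metric.
- by apply: (@jsm_pd (fun x s => metric om J c x s mu ka)); exact: jsm_metric.
Qed.

Lemma jsm_Gtilde v mu nu : jsm (fun x s => Gtilde om J c d v x s mu nu).
Proof.
under eq_fun2 do rewrite mxE.
apply: jsm_opp; apply: (@jsm_vder (fun x s => inv_metric om J c x s mu nu)).
exact: jsm_inv_metric.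
Qed.

(** With [a] equal to i this is [proj01], with [a] equal to -i it is [proj10]. *)
Lemma jcsm_proj (a : R[i]) mu nu :
  jcsm (fun x s => ((2%:R)^-1 *: (1%:M + a *: map_mx (fun r : R => r%:C) (J c x s))) mu nu).
Proof.
under eq_fun2 do rewrite !mxE.
apply: jcsm_mul; first exact: jcsm_cst.
apply: jcsm_add; first exact: jcsm_cst.
by apply: jcsm_mul; [exact: jcsm_cst|apply: jcsm_real; exact: jsm_J].
Qed.

Lemma jcsm_proj10 mu nu : jcsm (fun x s => proj10 J c x s mu nu).
Proof.
have := jcsm_proj (- 'i%C) mu nu; rewrite /proj10.
by under eq_fun2 do rewrite scaleNr.
Qed.

Lemma jcsm_G v mu nu : jcsm (fun x s => G om J c d v x s mu nu).
Proof.
apply: jcsm_mulmx; first apply: jcsm_mulmx.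
- exact: jcsm_proj10.
- by move=> i j; under eq_fun2 do rewrite mxE; apply: jcsm_real; exact: jsm_Gtilde.
- by move=> i j; under eq_fun2 do rewrite mxE; exact: jcsm_proj10.
Qed.

Lemma jcsm_Gbar v mu nu : jcsm (fun x s => Gbar om J c d v x s mu nu).
Proof.
apply: jcsm_mulmx; first apply: jcsm_mulmx.
- exact: jcsm_proj.
- by move=> i j; under eq_fun2 do rewrite mxE; apply: jcsm_real; exact: jsm_Gtilde.
- by move=> i j; under eq_fun2 do rewrite mxE; exact: jcsm_proj.
Qed.

Lemma jcsm_div_bivector (B : M -> T -> 'M[R[i]]_m) nu :
  (forall mu nu, jcsm (fun x s => B x s mu nu)) ->
  jcsm (fun x s => div_bivector om J c s (B ^~ s) x nu).
Proof.
move=> sB; apply: jcsm_sum => mu; apply: jcsm_add.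
  exact: (@jcsm_pdC (fun x s => B x s mu nu)).
apply: jcsm_sum => la; apply: jcsm_add; apply: jcsm_mul => //;
  by apply: jcsm_real; exact: jsm_christoffel.
Qed.

End Coefficients.

End JointSmoothness.

(** * Covariant derivatives in a chart and a frame *)

Section CovariantDerivative.
Variables (R : realType) (m : nat) (M : manifold 'rV[R]_m).
Variables (L : herm_line_bundle M) (k : nat) (c : atlas M).
Implicit Types (i j : frame L) (A : set M) (u w : M -> R[i]).

Lemma theta_smooth i mu :
  csm (cset c (fdom i)) (fun y => theta i c (icoord c y) 0 mu).
Proof.
have : csmooth (fdom i `&` dom c) (fun x => theta i c x 0 mu) by case: L i.
move=> [/(_ c)/smE sr /(_ c)/smE si].
have e : cset c (fdom i) `<=` cset c (fdom i `&` dom c).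
  by move=> y /csetP[h1 h2 h3 h4]; apply/csetP.
by split; [exact: sm_sub sr|exact: sm_sub si].
Qed.

Lemma trans_smooth i j :
  csm (cset c (fdom i `&` fdom j)) (fun y => trans i j (icoord c y)).
Proof.
have : csmooth (fdom i `&` fdom j) (trans i j) by case: L i j.
by move=> [/(_ c)/smE sr /(_ c)/smE si]; split.
Qed.

Lemma trans_theta i j x mu : fdom i x -> fdom j x -> dom c x ->
  trans i j x * (theta j c x 0 mu - theta i c x 0 mu) = pdC c mu (trans i j) x.
Proof. by case: L i j => *; eauto. Qed.

Definition chart_csm A u := csm (cset c A) (fun y => u (icoord c y)).

Lemma pdC_eq A u w mu x : open A -> A x -> dom c x ->
  (forall y, A y -> dom c y -> u y = w y) -> chart_csm A u ->
  pdC c mu u x = pdC c mu w x.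
Proof.
move=> oA Ax cx uw su; apply: (derivC_eq _ (open_cset c oA) (cset_coord cx Ax)) su.
by move=> y /csetP[h1 h2 h3 h4] /=; apply: uw.
Qed.

Lemma nab_eq A i u w mu x : open A -> A x -> dom c x ->
  (forall y, A y -> dom c y -> u y = w y) -> chart_csm A u ->
  nab k i c mu u x = nab k i c mu w x.
Proof.
by move=> oA Ax cx uw su; rewrite /nab (pdC_eq mu oA Ax cx uw su) uw.
Qed.

Lemma nab_chart_csm A i u mu : open A -> A `<=` fdom i -> chart_csm A u ->
  chart_csm A (nab k i c mu u).
Proof.
move=> oA Ai su; have oU := open_cset c oA.
apply: csm_add => //.
  apply: (csm_eq oU _ (csm_derive (delta_mx 0 mu) su)) => y /csetP[h1 h2 h3 h4].
  by rewrite /pdC /vderC h2.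
apply: csm_mul => //; apply: csm_scale => //.
apply: csm_sub (theta_smooth i mu) => y /csetP[h1 h2 h3 h4].
by apply/csetP; split=> //; exact: Ai.
Qed.

Lemma nab_lincomb A i a u w mu x : open A -> A x -> dom c x ->
  chart_csm A u -> chart_csm A w ->
  nab k i c mu (fun y => a * u y + w y) x = a * nab k i c mu u x + nab k i c mu w x.
Proof.
move=> oA Ax cx su sw; have oU := open_cset c oA; have Ux := cset_coord cx Ax.
have -> : nab k i c mu (fun y => a * u y + w y) x =
    (a * pdC c mu u x + pdC c mu w x) + k%:R * theta i c x 0 mu * (a * u x + w x).
  congr (_ + _).
  have := derivCD (delta_mx 0 mu) oU Ux (csm_scale a oU su) sw.
  by rewrite (derivCZ a (delta_mx 0 mu) oU Ux su).
by rewrite /nab; ring.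
Qed.

(** The derivative of the k-th power of g = [trans i j] contributes k g^(k-1) dg, and [trans_theta]
    turns dg into g (theta_j - theta_i), which exchanges theta_i for theta_j. *)
Lemma nab_gauge A i j w mu x : open A -> A x -> dom c x ->
  A `<=` fdom i -> A `<=` fdom j -> chart_csm A w ->
  nab k i c mu (fun y => trans i j y ^+ k * w y) x =
  trans i j x ^+ k * nab k j c mu w x.
Proof.
move=> oA Ax cx Ai Aj sw; have oU := open_cset c oA; have Ux := cset_coord cx Ax.
have st : csm (cset c A) (fun y => trans i j (icoord c y)).
  apply: csm_sub (trans_smooth i j) => y /csetP[h1 h2 h3 h4].
  by apply/csetP; split=> //; split; [exact: Ai|exact: Aj].
have -> : nab k i c mu (fun y => trans i j y ^+ k * w y) x =
    (trans i j x ^+ k * pdC c mu w x +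
     k%:R * trans i j x ^+ k.-1 * pdC c mu (trans i j) x * w x)
    + k%:R * theta i c x 0 mu * (trans i j x ^+ k * w x).
  congr (_ + _).
  have := derivCM (delta_mx 0 mu) oU Ux (csm_exp k oU st) sw.
  rewrite (derivCX k (delta_mx 0 mu) oU Ux st) coordK //.
rewrite -(trans_theta mu (Ai _ Ax) (Aj _ Ax) cx) /nab.
(* [k = 0] is apart because the exponent [k.-1] is truncated there. *)
case: k => [|k']; first by rewrite expr0; ring.
by rewrite /= exprS; ring.
Qed.

Variables (ET : normedModType R) (Om : set ET).

Lemma nab_joint A i (phi : ET -> M -> R[i]) mu : open A -> open Om ->
  A `<=` fdom i ->
  csm (cset c A `*` Om) (fun p => phi p.2 (icoord c p.1)) ->
  csm (cset c A `*` Om) (fun p => nab k i c mu (phi p.2) (icoord c p.1)).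
Proof.
move=> oA oO Ai sp; have oU : open (cset c A `*` Om).
  by apply: open_prod => //; exact: open_cset.
apply: csm_add => //.
  apply: (csm_eq oU _ (csm_derive (delta_mx 0 mu, 0) sp)) => -[y z] [/= /csetP[h1 h2 h3 h4] h5].
  rewrite /pdC /vderC h2.
  exact: esym (@derivC_affine _ _ _ (fun p : 'rV[R]_m * ET => phi p.2 (icoord c p.1))
    (fun y => (y, z)) (fun y => (y, 0)) y (delta_mx 0 mu) (fun h => pair_affine1 h _ _ _)).
apply: csm_mul => //; apply: csm_scale => //.
apply: (@csm_affine _ _ _ _ (cset c (fdom i)) (fun y => theta i c (icoord c y) 0 mu) fst fst).
- by move=> x v h.
- by move=> x; exact: cvg_fst.
- by move=> [y z] [/= /csetP[h1 h2 h3 h4] h5]; apply/csetP; split=> //; exact: Ai.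
- exact: theta_smooth.
Qed.

End CovariantDerivative.

(** * Second-order operators with smooth coefficients *)

Section SecondOrder.
Variables (R : realType) (m : nat) (M : manifold 'rV[R]_m).
Variables (L : herm_line_bundle M) (k : nat).
Local Notation sec := (frame L -> M -> R[i]).
Local Notation op := (sec -> sec).

(** The algebraic skeleton of a second-order operator, as a function of the second, first and zeroth
    order values of the section. Linearity and gauge covariance become statements about these values
    alone. *)
Definition combine2 (C2 : 'M[R[i]]_m) (C1 : 'I_m -> R[i]) (C0 : R[i])
    (n2 : 'I_m -> 'I_m -> R[i]) (n1 : 'I_m -> R[i]) (n0 : R[i]) : R[i] :=
  \sum_mu \sum_nu C2 mu nu * n2 mu nu + \sum_nu C1 nu * n1 nu + C0 * n0.

Lemma combine2_lincomb C2 C1 C0 a n2 n1 n0 p2 p1 p0 q2 q1 q0 :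
  (forall mu nu, n2 mu nu = a * p2 mu nu + q2 mu nu) ->
  (forall nu, n1 nu = a * p1 nu + q1 nu) -> n0 = a * p0 + q0 ->
  combine2 C2 C1 C0 n2 n1 n0 =
  a * combine2 C2 C1 C0 p2 p1 p0 + combine2 C2 C1 C0 q2 q1 q0.
Proof.
move=> e2 e1 ->; rewrite /combine2 !mulrDr !mulr_sumr mulrCA.
have -> : \sum_mu \sum_nu C2 mu nu * n2 mu nu =
    \sum_mu a * (\sum_nu C2 mu nu * p2 mu nu) + \sum_mu \sum_nu C2 mu nu * q2 mu nu.
  rewrite -big_split; apply: eq_bigr => mu _; rewrite mulr_sumr -big_split.
  by apply: eq_bigr => nu _; rewrite e2 mulrDr mulrCA.
have -> : \sum_nu C1 nu * n1 nu =
    \sum_nu a * (C1 nu * p1 nu) + \sum_nu C1 nu * q1 nu.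
  by rewrite -big_split; apply: eq_bigr => nu _; rewrite e1 mulrDr mulrCA.
ring.
Qed.

Lemma combine2_scale C2 C1 C0 a n2 n1 n0 p2 p1 p0 :
  (forall mu nu, n2 mu nu = a * p2 mu nu) ->
  (forall nu, n1 nu = a * p1 nu) -> n0 = a * p0 ->
  combine2 C2 C1 C0 n2 n1 n0 = a * combine2 C2 C1 C0 p2 p1 p0.
Proof.
move=> e2 e1 e0.
rewrite (@combine2_lincomb C2 C1 C0 a n2 n1 n0 p2 p1 p0 (fun _ _ => 0) (fun=> 0) 0).
- rewrite [X in _ + X]/combine2 !big1 ?mulr0 ?addr0 // => mu _.
    by rewrite mulr0.
  by rewrite big1 // => nu _; rewrite mulr0.
- by move=> mu nu; rewrite e2 addr0.
- by move=> nu; rewrite e1 addr0.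
- by rewrite e0 addr0.
Qed.

(** Written with iterated [nab] rather than [nab2], because each [nab] satisfies the gauge law by
    itself; the Christoffel terms are to be absorbed in [C1]. *)
Definition order2 (c : atlas M) (C2 : 'M[R[i]]_m) (C1 : 'I_m -> R[i]) (C0 : R[i])
    (i : frame L) (u : M -> R[i]) (x : M) : R[i] :=
  combine2 C2 C1 C0 (fun mu nu => nab k i c mu (nab k i c nu u) x)
    (fun nu => nab k i c nu u x) (u x).

Variables (ET : normedModType R) (Om : set ET) (P : ET -> op).
Variables (C2 : atlas M -> ET -> M -> 'M[R[i]]_m).
Variables (C1 : atlas M -> ET -> M -> 'I_m -> R[i]).
Variables (C0 : atlas M -> ET -> M -> R[i]).
Hypothesis oO : open Om.
Hypothesis sC2 : forall c mu nu, csm (cset c (dom c) `*` Om)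
  (fun p => C2 c p.2 (icoord c p.1) mu nu).
Hypothesis sC1 : forall c nu, csm (cset c (dom c) `*` Om)
  (fun p => C1 c p.2 (icoord c p.1) nu).
Hypothesis sC0 : forall c, csm (cset c (dom c) `*` Om)
  (fun p => C0 c p.2 (icoord c p.1)).
Hypothesis P_out : forall z s i x, Om z -> smooth_section k s ->
  ~ fdom i x -> P z s i x = 0.
Hypothesis P_in : forall z s i x c, Om z -> smooth_section k s ->
  fdom i x -> dom c x ->
  P z s i x = order2 c (C2 c z x) (C1 c z x) (C0 c z x) i (s i) x.

(** The coefficients depend on the chart but not on the frame, so inside one chart the gauge law of
    [nab] yields the cocycle condition. Independence of the chart is contained in [P_in], which
    gives the same value in every chart. *)
Lemma order2_locop : locop k Om P.
Proof.
split=> [z Oz a s s' ss ss'|Om' phi oO' OO fphi].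
  apply/funext => i; apply/funext => x; rewrite /lincomb.
  have [xi|xi] := pselect (fdom i x); last first.
    rewrite (P_out Oz (smooth_lincomb a ss ss') xi) (P_out Oz ss xi).
    by rewrite (P_out Oz ss' xi) mulr0 addr0.
  have [c cx] := dom_cover x; have oi := frame_open i.
  rewrite (P_in Oz (smooth_lincomb a ss ss') xi cx) (P_in Oz ss xi cx).
  rewrite (P_in Oz ss' xi cx).
  have [_ /(_ i c) su] := (smooth_sectionP _ _).1 ss.
  have [_ /(_ i c) sw] := (smooth_sectionP _ _).1 ss'.
  have sub := @subset_refl _ (fdom i).
  have n1 mu y : fdom i y -> dom c y ->
      nab k i c mu (lincomb a s s' i) y = a * nab k i c mu (s i) y + nab k i c mu (s' i) y.
    by move=> yi yc; apply: (nab_lincomb k i a mu oi yi yc su sw).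
  have n2 mu nu : nab k i c mu (nab k i c nu (lincomb a s s' i)) x =
      a * nab k i c mu (nab k i c nu (s i)) x + nab k i c mu (nab k i c nu (s' i)) x.
    rewrite -(nab_lincomb k i a mu oi xi cx (nab_chart_csm k nu oi sub su)
      (nab_chart_csm k nu oi sub sw)).
    apply: (nab_eq k i mu oi xi cx) => [y yi yc|]; first exact: n1.
    have [_ /(_ i c) sl] := (smooth_sectionP _ _).1 (smooth_lincomb a ss ss').
    exact: (nab_chart_csm k nu oi sub sl).
  exact: (combine2_lincomb _ _ _ n2 (fun mu => n1 mu x xi cx)).
have [cs ss] := fphi; split=> [z Oz|i c].
  have sz := fam_slice fphi Oz; have Oz' := OO _ Oz.
  split=> [i x xi|i j x xi xj]; first exact: P_out.
  have [c cx] := dom_cover x.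
  rewrite (P_in Oz' sz xi cx) (P_in Oz' sz xj cx).
  pose A := @fdom _ _ _ L i `&` fdom j.
  have oA : open A by apply: openI; exact: frame_open.
  have Ax : A x by [].
  have Ai : A `<=` fdom i by move=> y [].
  have Aj : A `<=` fdom j by move=> y [].
  have [_ st] := cs _ Oz.
  have [_ sm_] := (smooth_sectionP _ _).1 sz.
  have sA f : A `<=` fdom f -> chart_csm c A (phi z f).
    move=> Af; apply: csm_sub (sm_ f c) => y /csetP[h1 h2 h3 h4].
    by apply/csetP; split=> //; exact: Af.
  have n1 mu y : A y -> dom c y -> nab k i c mu (phi z i) y =
      trans i j y ^+ k * nab k j c mu (phi z j) y.
    move=> Ay yc; rewrite -(nab_gauge k mu oA Ay yc Ai Aj (sA j Aj)).
    apply: (nab_eq k i mu oA Ay yc _ (sA i Ai)) => y' [yi yj] _.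
    exact: st.
  have n2 mu nu : nab k i c mu (nab k i c nu (phi z i)) x =
      trans i j x ^+ k * nab k j c mu (nab k j c nu (phi z j)) x.
    rewrite -(nab_gauge k mu oA Ax cx Ai Aj (nab_chart_csm k nu oA Aj (sA j Aj))).
    apply: (nab_eq k i mu oA Ax cx _ (nab_chart_csm k nu oA Ai (sA i Ai))) => y yA yc.
    exact: n1.
  exact: (combine2_scale _ _ _ n2 (fun mu => n1 mu x Ax cx) (st i j x xi xj)).
have oi := frame_open i; have sub := @subset_refl _ (@fdom _ _ _ L i).
have oU : open (cset c (@fdom _ _ _ L i) `*` Om').
  by apply: open_prod => //; exact: open_cset.
have UW : cset c (@fdom _ _ _ L i) `*` Om' `<=` cset c (dom c) `*` Om.
  by move=> [y z] [/= /csetP[h1 h2 h3 h4] /OO]; split=> //; apply/csetP.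
have s1 nu := @nab_joint _ _ _ _ k c _ _ _ i (fun z => phi z i) nu oi oO' sub
  (ss i c).
have s2 mu nu := @nab_joint _ _ _ _ k c _ _ _ i
  (fun z => nab k i c nu (phi z i)) mu oi oO' sub (s1 nu).
apply: (@csm_eq _ _ _ (fun p => order2 c (C2 c p.2 (icoord c p.1))
   (C1 c p.2 (icoord c p.1)) (C0 c p.2 (icoord c p.1)) i (phi p.2 i) (icoord c p.1))) => //.
  move=> [y z] [/= /csetP[h1 h2 h3 h4] Oz].
  by rewrite (P_in (OO _ Oz) (fam_slice fphi Oz) h4 h3).
apply: (csm_add oU); last exact: (csm_mul oU (csm_sub UW (sC0 c)) (ss i c)).
apply: (csm_add oU).
  apply: (csm_sum _ oU) => mu; apply: (csm_sum _ oU) => nu.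
  exact: (csm_mul oU (csm_sub UW (sC2 c mu nu)) (s2 mu nu)).
apply: (csm_sum _ oU) => nu.
exact: (csm_mul oU (csm_sub UW (sC1 c nu)) (s1 nu)).
Qed.

End SecondOrder.

(** Brings Delta_B + 2 nabla_(B.dF) - h to the form [order2]: the Christoffel symbols contracted
    with B join the divergence of B and the gradient term in the first-order coefficient. *)
Lemma combine2_normal (C : comNzRingType) (m : nat) (B : 'M[C]_m)
    (Gam : 'I_m -> 'I_m -> 'I_m -> C) (dv f : 'I_m -> C) (h u : C)
    (n2 : 'I_m -> 'I_m -> C) (n1 : 'I_m -> C) :
  \sum_mu \sum_nu B mu nu * (n2 mu nu - \sum_la Gam la mu nu * n1 la)
  + \sum_nu dv nu * n1 nu
  + 2%:R * (\sum_mu (\sum_nu B mu nu * f nu) * n1 mu) - h * u =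
  \sum_mu \sum_nu B mu nu * n2 mu nu
  + \sum_la (dv la - \sum_mu \sum_nu B mu nu * Gam la mu nu
     + 2%:R * \sum_nu B la nu * f nu) * n1 la + (- h) * u.
Proof.
have -> : \sum_mu \sum_nu B mu nu * (n2 mu nu - \sum_la Gam la mu nu * n1 la) =
    \sum_mu \sum_nu B mu nu * n2 mu nu -
    \sum_la (\sum_mu \sum_nu B mu nu * Gam la mu nu) * n1 la.
  have -> : \sum_la (\sum_mu \sum_nu B mu nu * Gam la mu nu) * n1 la =
      \sum_mu \sum_nu B mu nu * \sum_la Gam la mu nu * n1 la.
    under eq_bigr => la _ do rewrite mulr_suml.
    rewrite exchange_big; apply: eq_bigr => mu _ /=.
    under eq_bigr => la _ do rewrite mulr_suml.
    rewrite exchange_big; apply: eq_bigr => nu _ /=.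
    by rewrite mulr_sumr; apply: eq_bigr => la _; rewrite mulrA.
  rewrite -sumrB; apply: eq_bigr => mu _; rewrite -sumrB.
  by apply: eq_bigr => nu _; rewrite mulrBr.
have -> : \sum_la (dv la - \sum_mu \sum_nu B mu nu * Gam la mu nu
     + 2%:R * \sum_nu B la nu * f nu) * n1 la =
    \sum_la dv la * n1 la - \sum_la (\sum_mu \sum_nu B mu nu * Gam la mu nu) * n1 la
    + 2%:R * \sum_la (\sum_nu B la nu * f nu) * n1 la.
  rewrite mulr_sumr -sumrB -big_split; apply: eq_bigr => la _ /=.
  by rewrite mulrDl mulrBl mulrA.
ring.
Qed.

(** * Smooth dependence of b, bbar and dF on the point of T *)

Section HitchinWittenOperators.
Variables (R : realType) (m : nat) (M : manifold 'rV[R]_m).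
Variables (L : herm_line_bundle M) (k : nat) (n : nat).
Variables (T : complex_manifold R n).
Variables (om : atlas M -> M -> 'M[R]_m) (J : atlas M -> M -> T -> 'M[R]_m).
Hypotheses (Hom : symplectic om) (HJ : kahler_family om J).
Variables (F : M -> T -> R).
Hypothesis sF : smooth2 setT F.
Local Notation ET := ('rV[R]_n * 'rV[R]_n)%type.
Local Notation sec := (frame L -> M -> R[i]).
Local Notation op := (sec -> sec).

Lemma jsm_F c d : @jsm _ _ M _ T c d F.
Proof. by apply: smooth2_jsm sF => x. Qed.

Lemma jcsm_vder10 c d (v : ET) : @jcsm _ _ M _ T c d (fun x s => vder10 d v (F x) s).
Proof.
apply: jcsm_mul; first exact: jcsm_cst.
apply: jcsm_add; first by apply: jcsm_real; apply: jsm_vder; exact: jsm_F.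
apply: jcsm_opp; apply: jcsm_mul; first exact: jcsm_cst.
by apply: jcsm_real; apply: jsm_vder; exact: jsm_F.
Qed.

Lemma jcsm_vder01 c d (v : ET) : @jcsm _ _ M _ T c d (fun x s => vder01 d v (F x) s).
Proof.
apply: jcsm_mul; first exact: jcsm_cst.
apply: jcsm_add; first by apply: jcsm_real; apply: jsm_vder; exact: jsm_F.
apply: jcsm_mul; first exact: jcsm_cst.
by apply: jcsm_real; apply: jsm_vder; exact: jsm_F.
Qed.

Definition first_order_coeff c s (B : M -> 'M[R[i]]_m) x (la : 'I_m) : R[i] :=
  div_bivector om J c s B x la
  - \sum_mu \sum_nu B x mu nu * (christoffel om J c x s la mu nu)%:C
  + 2%:R * \sum_nu B x la nu * (pd c nu (F ^~ s) x)%:C.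

Lemma Delta_order2 i c s B (h : R[i]) u x :
  Delta k om J i c s B u x + 2%:R * @nab_grad _ _ M L k _ T i c s F B u x - h * u x =
  order2 k c (B x) (first_order_coeff c s B x) (- h) i u x.
Proof. exact: combine2_normal. Qed.

Variables (d : atlas T) (P : T -> op) (B : atlas M -> M -> T -> 'M[R[i]]_m).
Variables (h : M -> T -> R[i]).
Hypothesis sB : forall c mu nu, @jcsm _ _ M _ T c d (fun x s => B c x s mu nu).
Hypothesis sh : forall c, @jcsm _ _ M _ T c d h.
Hypothesis HP : forall s psi i x, dom d s -> smooth_section k psi ->
  (~ fdom i x -> P s psi i x = 0) /\
  (forall c, fdom i x -> dom c x ->
     P s psi i x = Delta k om J i c s (B c ^~ s) (psi i) x
       + 2%:R * nab_grad k i c s F (B c ^~ s) (psi i) x - h x s * psi i x).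

(** Common to b and bbar, which differ only in the bivector [B] and in the multiplication term
    [h]. *)
Lemma explicit_locop : locop k (chart_dom d) (fun z => P (icoord d z)).
Proof.
apply: (@order2_locop _ _ M L k _ (chart_dom d) (fun z => P (icoord d z))
  (fun c z x => B c x (icoord d z))
  (fun c z x => first_order_coeff c (icoord d z) (B c ^~ (icoord d z)) x)
  (fun c z x => - h x (icoord d z))).
- by move=> c mu nu; exact: sB.
- move=> c la.
  apply: (jcsm_add (f := fun x s => div_bivector om J c s (B c ^~ s) x la
     - \sum_mu \sum_nu B c x s mu nu * (christoffel om J c x s la mu nu)%:C)
     (g := fun x s => 2%:R * \sum_nu B c x s la nu * (pd c nu (F ^~ s) x)%:C)).
    apply: jcsm_add; first by apply: (jcsm_div_bivector Hom HJ).
    apply: jcsm_opp; apply: jcsm_sum => mu; apply: jcsm_sum => nu.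
    apply: jcsm_mul; first exact: sB.
    by apply: jcsm_real; exact: jsm_christoffel.
  apply: jcsm_mul; first exact: jcsm_cst.
  apply: jcsm_sum => nu; apply: jcsm_mul; first exact: sB.
  by apply: jcsm_real; apply: jsm_pd; exact: jsm_F.
- by move=> c; apply: jcsm_opp.
- by move=> z s i x Oz ss xi; apply: (HP i x (dom_icoord Oz) ss).1.
- move=> z s i x c Oz ss xi cx; rewrite -Delta_order2.
  exact: ((HP i x (dom_icoord Oz) ss).2 c xi cx).
Qed.

End HitchinWittenOperators.

Section HitchinWittenLocop.
Variables (R : realType) (m : nat) (M : manifold 'rV[R]_m).
Variables (L : herm_line_bundle M) (k : nat) (n : nat).
Variables (T : complex_manifold R n).
Variables (om : atlas M -> M -> 'M[R]_m) (J : atlas M -> M -> T -> 'M[R]_m).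
Hypotheses (Hom : symplectic om) (HJ : kahler_family om J).
Variables (F : M -> T -> R) (lam : R).
Hypothesis sF : smooth2 setT F.
Local Notation ET := ('rV[R]_n * 'rV[R]_n)%type.
Local Notation sec := (frame L -> M -> R[i]).
Local Notation op := (sec -> sec).
Variables b : atlas T -> ET -> T -> op.

Lemma b_locop d v : is_b k F om J lam b ->
  locop k (chart_dom d) (fun z => b d v (icoord d z)).
Proof.
move=> Hb; apply: (explicit_locop Hom HJ sF
  (B := fun c x s => G om J c d v x s)
  (h := fun x s => 2%:R * lam%:C * vder10 d v (F x) s)).
- by move=> c mu nu; exact: jcsm_G.
- by move=> c; apply: jcsm_mul; [exact: jcsm_cst|exact: jcsm_vder10].
- by move=> s psi i x ds ss; have [h1 h2] := Hb d v s psi i x ds ss; split.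
Qed.

Lemma bbar_locop d v : is_bbar k F om J lam b ->
  locop k (chart_dom d) (fun z => b d v (icoord d z)).
Proof.
move=> Hb; apply: (explicit_locop Hom HJ sF
  (B := fun c x s => Gbar om J c d v x s)
  (h := fun x s => 2%:R * lam%:C * vder01 d v (F x) s)).
- by move=> c mu nu; exact: jcsm_Gbar.
- by move=> c; apply: jcsm_mul; [exact: jcsm_cst|exact: jcsm_vder01].
- by move=> s psi i x ds ss; have [h1 h2] := Hb d v s psi i x ds ss; split.
Qed.

Lemma dTF_locop d v : locop k (chart_dom d) (fun z => @dTF _ _ M L _ T F d v (icoord d z)).
Proof.
suff H c : csm ((coord c @` dom c) `*` chart_dom d)
    (fun p => (vder d v (F (icoord c p.1)) (icoord d p.2))%:C).
  exact: (locop_mul L k H).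
have : @jcsm _ _ M _ T c d (fun x s => (vder d v (F x) s)%:C).
  by apply: jcsm_real; apply: jsm_vder; exact: jsm_F.
apply: csm_sub => -[y z] [/= h1 h2]; split=> //; apply/csetP.
by split=> //; [exact: icoordK|exact: dom_icoord|exact: dom_icoord].
Qed.

End HitchinWittenLocop.

(** * The recursion in a Lie algebra *)

(** Collects a double sum by N = p + r, which will be the total power of i k. *)
Lemma sum_triangle (V : nmodType) (l : nat) (f : nat -> nat -> V) :
  \sum_(1 <= p < l.+1) \sum_(1 <= r < (l - p).+1) f p r =
  \sum_(1 <= N < l.+1) \sum_(1 <= p < N) f p (N - p)%N.
Proof.
transitivity (\sum_(1 <= p < l.+1) \sum_(1 <= N < l.+1 | (p < N)%N) f p (N - p)%N).
  apply: eq_big_nat => p /andP[p1 pl].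
  rewrite [RHS](big_cat_nat (n := p.+1)) //= [X in _ = X + _]big_nat_cond.
  rewrite [X in _ = X + _]big1 ?add0r; last first.
    by move=> N /andP[/andP[_ Np] pN]; move: Np; rewrite ltnS leqNgt pN.
  have -> : \sum_(p.+1 <= N < l.+1 | (p < N)%N) f p (N - p)%N =
      \sum_(1 + p <= N < l.+1) f p (N - p)%N.
    rewrite add1n big_nat_cond [RHS]big_nat_cond; apply: eq_bigl => N.
    by case: (p < N)%N; rewrite ?andbT ?andbF.
  by rewrite big_addn subSn //; apply: eq_bigr => r _; rewrite addnK.
transitivity (\sum_(1 <= N < l.+1) \sum_(1 <= p < l.+1 | (p < N)%N) f p (N - p)%N).
  by rewrite (exchange_big_dep_nat xpredT).
apply: eq_big_nat => N /andP[N1 Nl].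
by rewrite [RHS](big_nat_widen _ _ l.+1) // ltnW.
Qed.

Lemma sum_sign (R : pzRingType) (N : nat) : (0 < N)%N ->
  \sum_(1 <= p < N) (-1) ^+ p = - (~~ odd N)%:R :> R.
Proof.
elim: N => // [[|N]] IH _; first by rewrite big_geq // oppr0.
rewrite big_nat_recr //= IH // exprS -signr_odd /=.
case: (odd N); rewrite /= ?expr1 ?expr0 ?mulr1 ?mulrN1 ?opprK ?oppr0 ?add0r //.
by rewrite addNr.
Qed.

Section LieRecursion.
Variables (C : fieldType) (V : lmodType C) (br : V -> V -> V).
Hypothesis brDl : forall x y z, br (x + y) z = br x z + br y z.
Hypothesis brZl : forall a x z, br (a *: x) z = a *: br x z.
Hypothesis brC : forall x y, br x y = - br y x.
Hypothesis jacobi : forall x y z, br x (br y z) = br (br x y) z + br y (br x z).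

Lemma brDr x y z : br x (y + z) = br x y + br x z.
Proof. by rewrite brC brDl opprD -!brC. Qed.

Lemma brZr a x z : br x (a *: z) = a *: br x z.
Proof. by rewrite brC brZl -scalerN -brC. Qed.

Lemma brNl x z : br (- x) z = - br x z.
Proof. by rewrite -scaleN1r brZl scaleN1r. Qed.

Lemma brNr x z : br x (- z) = - br x z.
Proof. by rewrite -(scaleN1r z) brZr scaleN1r. Qed.

Lemma brBl x y z : br (x - y) z = br x z - br y z.
Proof. by rewrite brDl brNl. Qed.

Lemma br0r x : br x 0 = 0.
Proof. by rewrite -(scale0r (0 : V)) brZr !scale0r. Qed.

Lemma br_sumr (I : Type) (r : seq I) (P : pred I) x (F : I -> V) :
  br x (\sum_(i <- r | P i) F i) = \sum_(i <- r | P i) br x (F i).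
Proof. exact: (big_morph (br x) (brDr x) (br0r x)). Qed.

(** For tangent vectors v and w, [bv], [cv], [fv] stand for b(v), bbar(v), dF(v), and [bvw] for the
    derivative of b(w) along v; [D j] is R^(j)(D), with derivatives [Dv j] and [Dw j]. The scalars
    [h] and [q] stand for 1/(2k) and i k. Below, [X] and [Y] are d^F b and d^F bbar, and [W] is
    [b /\ bbar], all evaluated on (v, w). *)
Variables (bv bw cv cw fv fw bvw bwv cvw cwv : V) (h q : C) (l : nat).
Variables (D Dv Dw : nat -> V).

Let xv p := bv - (-1) ^+ p *: cv.
Let xw p := bw - (-1) ^+ p *: cw.
Let dxvw p := bvw - (-1) ^+ p *: cvw.
Let dxwv p := bwv - (-1) ^+ p *: cwv.
Let X := bvw - bwv + (br fv bw - br fw bv).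
Let Y := cvw - cwv + (br fv cw - br fw cv).
Let W := br bv cw - br bw cv.

Hypothesis rec_v : forall j, (j < l)%N -> Dv j + br fv (D j) =
  h *: \sum_(1 <= r < j.+1) q ^+ r *: br (xv r) (D (j - r)%N).
Hypothesis rec_w : forall j, (j < l)%N -> Dw j + br fw (D j) =
  h *: \sum_(1 <= r < j.+1) q ^+ r *: br (xw r) (D (j - r)%N).
Hypothesis central_XY : forall j, (j < l)%N -> br (X + Y) (D j) = 0.
Hypothesis central_W : forall j, (j < l)%N -> br (h *: W - 2%:R *: X) (D j) = 0.
Hypothesis central_bb : forall j, (j < l)%N -> br (br bv bw) (D j) = 0.
Hypothesis central_cc : forall j, (j < l)%N -> br (br cv cw) (D j) = 0.

(** The rule d^F [x_p, R] = [d^F x_p, R] - [x_p /\ d^F R]; the Jacobi identity distributes the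
    brackets with dF over both factors. *)
Lemma jacobi_step p j :
  br (dxvw p) (D j) + br (xw p) (Dv j) - (br (dxwv p) (D j) + br (xv p) (Dw j))
  + (br fv (br (xw p) (D j)) - br fw (br (xv p) (D j))) =
  br (X - (-1) ^+ p *: Y) (D j) + (br (xw p) (Dv j + br fv (D j))
    - br (xv p) (Dw j + br fw (D j))).
Proof.
have -> : X - (-1) ^+ p *: Y = dxvw p - dxwv p + (br fv (xw p) - br fw (xv p)).
  rewrite /X /Y /dxvw /dxwv /xw /xv !brDr !brNr !brZr !scalerDr !scalerN !opprD !opprK !addrA.
  by rewrite [RHS](ACl (1*3*5*7*2*4*6*8)) /=.
move: (dxvw p) (dxwv p) (xw p) (xv p) => a a' c c'.
rewrite (jacobi fv) (jacobi fw) !brDr !brDl !brNl !opprD !addrA.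
by rewrite [LHS](ACl (1*3*5*7*2*6*4*8)).
Qed.

(** On [D j], Y acts as -X, so X - (-1)^p Y acts as (1 + (-1)^p) X: this is 0 for odd p and 2 X = h
    W for even p. *)
Lemma central_term p j : (j < l)%N -> br (X - (-1) ^+ p *: Y) (D j) =
  (~~ odd p)%:R *: (h *: br W (D j)).
Proof.
move=> jl; have /eqP := central_XY jl; rewrite brDl addrC addr_eq0 => /eqP eY.
have /eqP := central_W jl; rewrite brBl !brZl subr_eq0 => /eqP ->.
rewrite brBl brZl eY scalerN opprK -{1}[br X (D j)]scale1r -scalerDl scalerA.
congr (_ *: _); rewrite -signr_odd.
by case: odd => /=; rewrite ?expr1 ?subrr ?mul0r // expr0 mul1r.
Qed.

(** By the Jacobi identity the left side is the action of [x_p(w), x_r(v)], in which centrality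
    leaves only the mixed brackets of b with bbar. *)
Lemma double_bracket p r j : (j < l)%N ->
  br (xw p) (br (xv r) (D j)) - br (xv r) (br (xw p) (D j)) =
  (-1) ^+ p *: br (br bv cw) (D j) - (-1) ^+ r *: br (br bw cv) (D j).
Proof.
move=> jl; rewrite (jacobi (xw p)) addrK /xw /xv.
rewrite !brDl !brNl !brDr !brNr !brZl !brZr !brDl !brNl !brZl.
rewrite (brC bw bv) (brC cw cv) (brC cw bv) !brNl (central_bb jl) (central_cc jl).
by rewrite !(oppr0, scaler0, addr0, add0r, scalerN, opprK) addrC.
Qed.

(** Replacing p by N - p in the second sum pairs the terms into double brackets. The signs of p and
    of N - p have the same sum over 0 < p < N, so the two mixed brackets assemble into a multiple of
    [W]. *)
Lemma antidiagonal N : (0 < N)%N -> (N <= l)%N ->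
  \sum_(1 <= p < N) (br (xw p) (br (xv (N - p)%N) (D (l - N)%N))
    - br (xv p) (br (xw (N - p)%N) (D (l - N)%N))) =
  - ((~~ odd N)%:R *: br W (D (l - N)%N)).
Proof.
move=> N0 Nl; have jl : (l - N < l)%N by lia.
rewrite sumrB [X in _ - X]big_nat_rev /= add1n.
have -> : \sum_(1 <= p < N) br (xv (N - p)%N) (br (xw (N - (N - p))%N) (D (l - N)%N))
    = \sum_(1 <= p < N) br (xv (N - p)%N) (br (xw p) (D (l - N)%N)).
  by apply: eq_big_nat => p /andP[p1 pN]; rewrite subKn // ltnW.
rewrite -sumrB; under eq_bigr => p _ do rewrite double_bracket //.
rewrite sumrB -!scaler_suml [X in _ - X *: _]big_nat_rev /= add1n.
have -> : \sum_(1 <= p < N) (-1) ^+ (N - (N - p)) = \sum_(1 <= p < N) (-1) ^+ p :> C.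
  by apply: eq_big_nat => p /andP[p1 pN]; rewrite subKn // ltnW.
by rewrite sum_sign // -scalerBr -brBl scaleNr.
Qed.

(** For even N, d^F x_N contributes h q^N [W, R^(l-N)(D)], and the double brackets with p + r = N
    contribute the negative of this; for odd N both are 0. *)
Lemma lie_recursion_closed :
  \sum_(1 <= p < l.+1) q ^+ p *: (br (dxvw p) (D (l - p)%N) + br (xw p) (Dv (l - p)%N))
  - \sum_(1 <= p < l.+1) q ^+ p *: (br (dxwv p) (D (l - p)%N) + br (xv p) (Dw (l - p)%N))
  + (br fv (\sum_(1 <= p < l.+1) q ^+ p *: br (xw p) (D (l - p)%N))
     - br fw (\sum_(1 <= p < l.+1) q ^+ p *: br (xv p) (D (l - p)%N))) = 0.
Proof.
rewrite !br_sumr -!sumrB -big_split /=.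
have lp p : (1 <= p < l.+1)%N -> (l - p < l)%N by lia.
(* The first summand comes from d^F x_p, the second from substituting the recursion for d^F
   R^(l-p)(D), available since p > 0. *)
transitivity (\sum_(1 <= p < l.+1) (h *: (q ^+ p *: ((~~ odd p)%:R *: br W (D (l - p)%N)))
  + h *: \sum_(1 <= r < (l - p).+1) q ^+ (p + r) *:
     (br (xw p) (br (xv r) (D (l - (p + r))%N))
      - br (xv p) (br (xw r) (D (l - (p + r))%N))))).
  apply: eq_big_nat => p /lp jl.
  rewrite !brZr -!scalerBr -scalerDr jacobi_step scalerDr (central_term p jl).
  congr (_ + _).
    by rewrite !scalerA; congr (_ *: _); ring.
  rewrite (rec_v jl) (rec_w jl) !brZr -scalerBr scalerA mulrC -scalerA.
  congr (_ *: _); rewrite !br_sumr -sumrB scaler_sumr; apply: eq_bigr => r _.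
  by rewrite !brZr -scalerBr scalerA exprD subnDA.
rewrite big_split -!scaler_sumr /= -scalerDr.
rewrite (sum_triangle l (fun p r => q ^+ (p + r) *:
  (br (xw p) (br (xv r) (D (l - (p + r))%N))
   - br (xv p) (br (xw r) (D (l - (p + r))%N))))).
rewrite -big_split /= big_nat_cond big1 ?scaler0 // => N /andP[/andP[N1 Nl] _].
have -> : \sum_(1 <= p < N) q ^+ (p + (N - p)) *:
     (br (xw p) (br (xv (N - p)%N) (D (l - (p + (N - p)))%N))
      - br (xv p) (br (xw (N - p)%N) (D (l - (p + (N - p)))%N))) =
   q ^+ N *: \sum_(1 <= p < N) (br (xw p) (br (xv (N - p)%N) (D (l - N)%N))
      - br (xv p) (br (xw (N - p)%N) (D (l - N)%N))).
  rewrite scaler_sumr; apply: eq_big_nat => p /andP[p1 pN].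
  by rewrite subnKC // ltnW.
by rewrite antidiagonal // scalerN subrr.
Qed.

End LieRecursion.

(** * The Lie algebra of operators on smooth sections *)

Section Endomorphisms.
Variables (R : realType) (m : nat) (M : manifold 'rV[R]_m).
Variables (L : herm_line_bundle M) (k : nat).
Local Notation sec := (frame L -> M -> R[i]).
Local Notation op := (sec -> sec).

(** The properties under which brackets of operators obey the Lie axioms on smooth sections. They
    hold in D_k, and also for the values and derivatives of local operator maps. *)
Record good (D : op) : Prop := Good {
  good_linear : linear_op k D;
  good_stable : forall s, smooth_section k s -> smooth_section k (D s) }.

(* Operators that agree on smooth sections are identified by extending every
   operator by zero to the families that are not smooth sections. *)
Definition endo_pred : {pred op} := fun D =>
  `[< good D /\ forall s, ~ smooth_section k s -> D s = 0 >].

Lemma endo_predP D : reflect (good D /\ forall s, ~ smooth_section k s -> D s = 0)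
  (D \in endo_pred).
Proof. exact: asboolP. Qed.

Lemma good0 : good 0.
Proof.
split=> [a s s' _ _|s _]; last exact: smooth_section0.
by rewrite lincomb_0r; apply/funext => i; apply/funext => x; exact/esym/mulr0.
Qed.

Lemma good_lincomb a D D' : good D -> good D' ->
  good (fun s => lincomb a (D s) (D' s)).
Proof.
move=> [lD sD] [lD' sD']; split=> [c s s' ss ss'|s ss].
  rewrite (lD _ _ _ ss ss') (lD' _ _ _ ss ss').
  by apply/funext => i; apply/funext => x; rewrite /lincomb; ring.
by apply: smooth_lincomb; [exact: sD|exact: sD'].
Qed.

Lemma good_comp D D' : good D -> good D' -> good (fun s => D (D' s)).
Proof.
move=> [lD sD] [lD' sD']; split=> [c s s' ss ss'|s ss]; last exact/sD/sD'.
by rewrite (lD' _ _ _ ss ss') (lD _ _ _ (sD' _ ss) (sD' _ ss')).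
Qed.

Lemma goodD D D' : good D -> good D' -> good (D + D').
Proof.
move=> gD gD'; have := good_lincomb 1 gD gD'; congr good.
by apply/funext => s; apply/funext => i; apply/funext => x; rewrite /lincomb mul1r.
Qed.

Lemma goodZ a D : good D -> good (opscale a D).
Proof.
move=> gD; have := good_lincomb a gD good0; congr good.
by apply/funext => s; exact: lincomb_0r.
Qed.

Lemma goodN D : good D -> good (- D).
Proof.
move=> /(goodZ (-1)); congr good.
by apply/funext => s; apply/funext => i; apply/funext => x; exact: mulN1r.
Qed.

Lemma goodB D D' : good D -> good D' -> good (D - D').
Proof. move=> gD gD'; exact: (goodD gD (goodN gD')). Qed.

Lemma good_comm D D' : good D -> good D' -> good (comm D D').
Proof.
move=> gD gD'; exact: (goodB (good_comp gD gD') (good_comp gD' gD)).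
Qed.

Lemma endo_zmod_closed : zmod_closed endo_pred.
Proof.
split; first by apply/endo_predP; split=> [|s _]; [exact: good0|reflexivity].
move=> D D' /endo_predP[gD zD] /endo_predP[gD' zD']; apply/endo_predP.
split; first exact: goodB.
by move=> s ns; change (D s - D' s = 0); rewrite (zD s ns) (zD' s ns) subr0.
Qed.

HB.instance Definition _ := GRing.isZmodClosed.Build op endo_pred endo_zmod_closed.

Record endo := Endo { endo_val : op; endoP : endo_val \in endo_pred }.

HB.instance Definition _ := [isSub for endo_val].
HB.instance Definition _ := [Choice of endo by <:].
HB.instance Definition _ := [SubChoice_isSubZmodule of endo by <:].

Lemma endo_good (D : endo) : good (\val D).
Proof. by have /endo_predP[] := valP D. Qed.

Lemma endo_out (D : endo) s : ~ smooth_section k s -> \val D s = 0.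
Proof. by have /endo_predP[_] := valP D; apply. Qed.

Lemma endo_smooth (D : endo) s : smooth_section k s -> smooth_section k (\val D s).
Proof. exact: (good_stable (endo_good D)). Qed.

Lemma endo_eq (D D' : endo) : opeq k (\val D) (\val D') -> D = D'.
Proof.
move=> e; apply/val_inj/funext => s.
have [ss|ns] := pselect (smooth_section k s); first exact: (e s ss).
by rewrite (endo_out D ns) (endo_out D' ns).
Qed.

Lemma endo_scale_subproof a (D : endo) : opscale a (\val D) \in endo_pred.
Proof.
apply/endo_predP; split; first by apply: goodZ; exact: endo_good.
move=> s ns; apply/funext => i; apply/funext => x; rewrite /opscale (endo_out D ns).
exact: mulr0.
Qed.

Definition endo_scale a D : endo := Endo (endo_scale_subproof a D).

Lemma endo_scaleA a c D : endo_scale a (endo_scale c D) = endo_scale (a * c) D.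
Proof.
by apply: endo_eq => s _; apply/funext => i; apply/funext => x; exact: mulrA.
Qed.

Lemma endo_scale1 : left_id 1 endo_scale.
Proof.
by move=> D; apply: endo_eq => s _; apply/funext => i; apply/funext => x; exact: mul1r.
Qed.

Lemma endo_scaleDr : right_distributive endo_scale +%R.
Proof.
move=> a D D'; apply: endo_eq => s _; apply/funext => i; apply/funext => x.
change (a * (\val D s i x + \val D' s i x) = a * \val D s i x + a * \val D' s i x).
exact: mulrDr.
Qed.

Lemma endo_scaleDl D : {morph endo_scale^~ D : a c / a + c}.
Proof.
move=> a c; apply: endo_eq => s _; apply/funext => i; apply/funext => x.
change ((a + c) * \val D s i x = a * \val D s i x + c * \val D s i x).
exact: mulrDl.
Qed.

HB.instance Definition _ := GRing.Zmodule_isLmodule.Build R[i] endo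
  endo_scaleA endo_scale1 endo_scaleDr endo_scaleDl.

Lemma endo_br_subproof (D D' : endo) : comm (\val D) (\val D') \in endo_pred.
Proof.
apply/endo_predP; split; first by apply: good_comm; exact: endo_good.
move=> s ns; rewrite /comm (endo_out D ns) (endo_out D' ns).
rewrite (linear_op0 (good_linear (endo_good D))).
by rewrite (linear_op0 (good_linear (endo_good D'))) subr0.
Qed.

Definition endo_br D D' : endo := Endo (endo_br_subproof D D').

Lemma endo_lincomb (D : endo) a s s' : smooth_section k s -> smooth_section k s' ->
  \val D (lincomb a s s') = lincomb a (\val D s) (\val D s').
Proof. exact: (good_linear (endo_good D)). Qed.

Lemma endo_additive (D : endo) s s' i x : smooth_section k s -> smooth_section k s' ->
  \val D (s + s') i x = \val D s i x + \val D s' i x.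
Proof.
move=> ss ss'; have := endo_lincomb D 1 ss ss'.
have -> : lincomb 1 s s' = s + s'.
  by apply/funext => i'; apply/funext => x'; rewrite /lincomb mul1r.
by move=> ->; rewrite /lincomb mul1r.
Qed.

Lemma endo_scalable (D : endo) a s i x : smooth_section k s ->
  \val D (fun i x => a * s i x) i x = a * \val D s i x.
Proof. by move=> ss; rewrite (linear_opZ a (good_linear (endo_good D)) ss). Qed.

Lemma endo_subtractive (D : endo) s s' i x : smooth_section k s -> smooth_section k s' ->
  \val D (s - s') i x = \val D s i x - \val D s' i x.
Proof.
move=> ss ss'; have := endo_lincomb D (-1) ss' ss.
have -> : lincomb (-1) s' s = s - s'.
  by apply/funext => i'; apply/funext => x'; rewrite /lincomb mulN1r addrC.
by move=> ->; rewrite /lincomb mulN1r addrC.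
Qed.

Lemma endo_brDl D D' D'' : endo_br (D + D') D'' = endo_br D D'' + endo_br D' D''.
Proof.
apply: endo_eq => s ss; apply/funext => i; apply/funext => x.
change ((\val D (\val D'' s) i x + \val D' (\val D'' s) i x)
  - \val D'' (\val D s + \val D' s) i x =
  (\val D (\val D'' s) i x - \val D'' (\val D s) i x)
  + (\val D' (\val D'' s) i x - \val D'' (\val D' s) i x)).
rewrite (endo_additive D'' i x (endo_smooth D ss) (endo_smooth D' ss)); ring.
Qed.

Lemma endo_brZl a D D'' : endo_br (a *: D) D'' = a *: endo_br D D''.
Proof.
apply: endo_eq => s ss; apply/funext => i; apply/funext => x.
change (a * \val D (\val D'' s) i x - \val D'' (fun i x => a * \val D s i x) i x =
  a * (\val D (\val D'' s) i x - \val D'' (\val D s) i x)).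
rewrite (endo_scalable D'' a i x (endo_smooth D ss)); ring.
Qed.

Lemma endo_brC D D' : endo_br D D' = - endo_br D' D.
Proof.
apply: endo_eq => s ss; apply/funext => i; apply/funext => x.
change (\val D (\val D' s) i x - \val D' (\val D s) i x =
  - (\val D' (\val D s) i x - \val D (\val D' s) i x)).
by ring.
Qed.

(** The operators are additive only on smooth sections, so stability has to be invoked for every
    argument that is expanded. *)
Lemma endo_jacobi D D' D'' : endo_br D (endo_br D' D'') =
  endo_br (endo_br D D') D'' + endo_br D' (endo_br D D'').
Proof.
apply: endo_eq => s ss; apply/funext => i; apply/funext => x.
change (\val D (\val D' (\val D'' s) - \val D'' (\val D' s)) i x
   - (\val D' (\val D'' (\val D s)) i x - \val D'' (\val D' (\val D s)) i x) =
  ((\val D (\val D' (\val D'' s)) i x - \val D' (\val D (\val D'' s)) i x)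
    - \val D'' (\val D (\val D' s) - \val D' (\val D s)) i x)
  + (\val D' (\val D (\val D'' s) - \val D'' (\val D s)) i x
    - (\val D (\val D'' (\val D' s)) i x - \val D'' (\val D (\val D' s)) i x))).
rewrite (endo_subtractive D i x (endo_smooth D' (endo_smooth D'' ss))
  (endo_smooth D'' (endo_smooth D' ss))).
rewrite (endo_subtractive D'' i x (endo_smooth D (endo_smooth D' ss))
  (endo_smooth D' (endo_smooth D ss))).
rewrite (endo_subtractive D' i x (endo_smooth D (endo_smooth D'' ss))
  (endo_smooth D'' (endo_smooth D ss))).
ring.
Qed.

Definition extend0 (D : op) : op := fun s =>
  if `[< smooth_section k s >] then D s else 0.

(** [insubd] falls back to 0 when the extension is not in [endo_pred]; this is why the transfer
    lemmas assume [good]. *)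
Definition endo_of (D : op) : endo := insubd 0 (extend0 D).

Lemma endo_ofE D s : good D -> smooth_section k s -> \val (endo_of D) s = D s.
Proof.
move=> gD ss; rewrite /endo_of val_insubd.
have ext s' : smooth_section k s' -> extend0 D s' = D s'.
  by move=> ss'; rewrite /extend0 asboolT.
suff -> : extend0 D \in endo_pred by exact: ext.
apply/endo_predP; split; last by move=> s' ns'; rewrite /extend0 asboolF.
split=> [a s1 s2 ss1 ss2|s1 ss1]; last by rewrite (ext s1 ss1); exact: (good_stable gD).
rewrite (ext s1 ss1) (ext s2 ss2) (ext _ (smooth_lincomb a ss1 ss2)).
exact: (good_linear gD).
Qed.

Lemma endo_of_opeq D D' : good D -> good D' -> opeq k D D' <-> endo_of D = endo_of D'.
Proof.
move=> gD gD'; split=> [e|e s ss].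
  by apply: endo_eq => s ss; rewrite (endo_ofE gD ss) (endo_ofE gD' ss) (e s ss).
by rewrite -(endo_ofE gD ss) e (endo_ofE gD' ss).
Qed.

Lemma endo_of0 : endo_of 0 = 0.
Proof. by apply: endo_eq => s ss; rewrite (endo_ofE good0 ss). Qed.

Lemma endo_ofD D D' : good D -> good D' -> endo_of (D + D') = endo_of D + endo_of D'.
Proof.
move=> gD gD'; apply: endo_eq => s ss; rewrite (endo_ofE (goodD gD gD') ss).
change (D s + D' s = \val (endo_of D) s + \val (endo_of D') s).
by rewrite (endo_ofE gD ss) (endo_ofE gD' ss).
Qed.

Lemma endo_ofB D D' : good D -> good D' -> endo_of (D - D') = endo_of D - endo_of D'.
Proof.
move=> gD gD'; apply: endo_eq => s ss; rewrite (endo_ofE (goodB gD gD') ss).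
change (D s - D' s = \val (endo_of D) s - \val (endo_of D') s).
by rewrite (endo_ofE gD ss) (endo_ofE gD' ss).
Qed.

Lemma endo_ofZ a D : good D -> endo_of (opscale a D) = a *: endo_of D.
Proof.
move=> gD; apply: endo_eq => s ss; rewrite (endo_ofE (goodZ a gD) ss).
change (opscale a D s = opscale a (\val (endo_of D)) s).
by rewrite /opscale (endo_ofE gD ss).
Qed.

Lemma endo_of_comm D D' : good D -> good D' ->
  endo_of (comm D D') = endo_br (endo_of D) (endo_of D').
Proof.
move=> gD gD'; apply: endo_eq => s ss; rewrite (endo_ofE (good_comm gD gD') ss).
change (comm D D' s = \val (endo_of D) (\val (endo_of D') s)
  - \val (endo_of D') (\val (endo_of D) s)).
rewrite (endo_ofE gD' ss) (endo_ofE gD ss).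
by rewrite (endo_ofE gD (good_stable gD' ss)) (endo_ofE gD' (good_stable gD ss)).
Qed.

Lemma good_sum (I : Type) (r : seq I) (P : pred I) (D : I -> op) :
  (forall i, P i -> good (D i)) -> good (\sum_(i <- r | P i) D i).
Proof. move=> gD; exact: (big_ind good good0 goodD gD). Qed.

Lemma endo_of_sum (I : Type) (r : seq I) (P : pred I) (D : I -> op) :
  (forall i, P i -> good (D i)) ->
  endo_of (\sum_(i <- r | P i) D i) = \sum_(i <- r | P i) endo_of (D i).
Proof.
move=> gD; elim: r => [|i r IH]; first by rewrite !big_nil endo_of0.
rewrite !big_cons; case: ifP => [Pi|_]; last exact: IH.
by rewrite (endo_ofD (gD i Pi) (good_sum r gD)) IH.
Qed.

Lemma Dk_good D : Dk k D -> good D.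
Proof. by move=> DD; split; [exact: (Dk_linear_op DD)|exact: (Dk_stable DD)]. Qed.

Lemma locop_good (ET : normedModType R) (Om : set ET) P z : open Om ->
  locop k Om P -> Om z -> good (P z).
Proof.
move=> oO lP Oz; split; first exact: (locop_linear lP Oz).
by move=> s; exact: (locop_smooth oO lP Oz).
Qed.

End Endomorphisms.

(** * Differentiation of operator-valued maps at a point of T *)

Section Derivation.
Variables (R : realType) (m : nat) (M : manifold 'rV[R]_m).
Variables (L : herm_line_bundle M) (k : nat) (n : nat).
Variables (T : complex_manifold R n) (d : atlas T) (t : T).
Hypothesis dt : dom d t.
Local Notation ET := ('rV[R]_n * 'rV[R]_n)%type.
Local Notation sec := (frame L -> M -> R[i]).
Local Notation op := (sec -> sec).
Implicit Types (D : T -> op) (v : ET).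

Definition loc D := locop k (chart_dom d) (fun z => D (icoord d z)).

(** Derivatives are taken in [endo], since they are shown to be linear and stable on smooth
    sections, with no claim about their order as differential operators. *)
Definition tder v D : endo L k := endo_of k (opder d v D t).

Let oT : open (chart_dom d).
Proof. exact: open_coord. Qed.

Let ct : chart_dom d (coord d t).
Proof. by exists t. Qed.

Let BT := prod_basis (row_basis R n) (row_basis R n).

Lemma loc_good D : loc D -> good k (D t).
Proof. by move=> lD; have := locop_good oT lD ct; rewrite coordK. Qed.

Lemma opder_good v D : loc D -> good k (opder d v D t).
Proof.
move=> lD; split; first exact: (dop_linear v oT lD ct).
by move=> s ss; exact: (dop_smooth v oT lD ct ss).
Qed.

Lemma loc0 : loc (fun=> 0).
Proof.
split=> [z _ a s s' _ _|Om' phi oO' OO fphi]; last exact: fam0.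
by rewrite lincomb_0r; apply/funext => i; apply/funext => x; exact/esym/mulr0.
Qed.

Lemma locD D D' : loc D -> loc D' -> loc (fun t => D t + D' t).
Proof.
move=> lD lD'; have := locop_lincomb 1 lD lD'; congr locop.
apply/funext => z; apply/funext => s; apply/funext => i; apply/funext => x.
by rewrite /lincomb mul1r.
Qed.

Lemma locZ a D : loc D -> loc (fun t => opscale a (D t)).
Proof.
move=> lD; have := locop_lincomb a lD loc0; congr locop.
apply/funext => z; apply/funext => s; exact: lincomb_0r.
Qed.

Lemma locB D D' : loc D -> loc D' -> loc (fun t => D t - D' t).
Proof.
move=> lD lD'; have := locop_lincomb (-1) lD' lD; congr locop.
apply/funext => z; apply/funext => s; apply/funext => i; apply/funext => x.
by rewrite /lincomb mulN1r addrC.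
Qed.

Lemma loc_comp D D' : loc D -> loc D' -> loc (fun t s => D t (D' t s)).
Proof. by move=> lD lD'; exact: (locop_comp oT lD lD'). Qed.

Lemma loc_comm D D' : loc D -> loc D' -> loc (fun t => comm (D t) (D' t)).
Proof. by move=> lD lD'; exact: (locB (loc_comp lD lD') (loc_comp lD' lD)). Qed.

Lemma loc_sum (r : seq nat) (D : nat -> T -> op) :
  {in r, forall p, loc (D p)} -> loc (fun t => \sum_(p <- r) D p t).
Proof.
elim: r => [|p r IH] lD.
  by under eq_fun do rewrite big_nil; exact: loc0.
under eq_fun do rewrite big_cons; apply: locD.
  by apply: lD; rewrite inE eqxx.
by apply: IH => q qr; apply: lD; rewrite inE qr orbT.
Qed.

Lemma tder_lincomb v a D D' s : loc D -> loc D' -> smooth_section k s ->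
  opder d v (fun t s => lincomb a (D t s) (D' t s)) t s =
  lincomb a (opder d v D t s) (opder d v D' t s).
Proof. by move=> lD lD' ss; exact: (dop_lincomb a v oT lD lD' ct ss). Qed.

Lemma tder0 v : tder v (fun=> 0) = 0.
Proof.
rewrite /tder -endo_of0; congr endo_of.
apply/funext => s; apply/funext => i; apply/funext => x.
exact: (derivC_cst 0 (coord d t) v).
Qed.

Lemma tderD v D D' : loc D -> loc D' ->
  tder v (fun t => D t + D' t) = tder v D + tder v D'.
Proof.
move=> lD lD'; rewrite -(endo_ofD (opder_good v lD) (opder_good v lD')).
apply: endo_eq => s ss.
rewrite (endo_ofE (opder_good v (locD lD lD')) ss).
rewrite (endo_ofE (goodD (opder_good v lD) (opder_good v lD')) ss).
have e : (fun t => D t + D' t) = (fun t s => lincomb 1 (D t s) (D' t s)).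
  apply/funext => z; apply/funext => s'; apply/funext => i; apply/funext => x.
  by rewrite /lincomb mul1r.
rewrite e (tder_lincomb v 1 lD lD' ss).
by apply/funext => i; apply/funext => x; rewrite /lincomb mul1r.
Qed.

Lemma tderZ v a D : loc D -> tder v (fun t => opscale a (D t)) = a *: tder v D.
Proof.
move=> lD; rewrite -(endo_ofZ a (opder_good v lD)).
apply: endo_eq => s ss.
rewrite (endo_ofE (opder_good v (locZ a lD)) ss).
rewrite (endo_ofE (goodZ a (opder_good v lD)) ss).
have e : (fun t => opscale a (D t)) = (fun t s => lincomb a (D t s) 0).
  by apply/funext => z; apply/funext => s'; exact/esym/lincomb_0r.
rewrite e (tder_lincomb v a lD loc0 ss) /opscale -lincomb_0r; congr lincomb.
apply/funext => i; apply/funext => x; exact: (derivC_cst 0 (coord d t) v).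
Qed.

Lemma tderB v D D' : loc D -> loc D' ->
  tder v (fun t => D t - D' t) = tder v D - tder v D'.
Proof.
move=> lD lD'; rewrite -scaleN1r -(tderZ v (-1) lD') -(tderD v lD (locZ (-1) lD')).
congr tder; apply/funext => z; congr (_ + _).
by apply/funext => s; apply/funext => i; apply/funext => x; exact/esym/mulN1r.
Qed.

Lemma opder_comp v D D' s : loc D -> loc D' -> smooth_section k s ->
  opder d v (fun t s => D t (D' t s)) t s =
  opder d v D t (D' t s) + D t (opder d v D' t s).
Proof.
move=> lD lD' ss; have := dop_comp BT v oT lD lD' ct ss.
by rewrite coordK.
Qed.

(** The Leibniz rule for families, in the form [opder_comp], applied to both products of the
    commutator. *)
Lemma tder_comm v D D' : loc D -> loc D' ->
  tder v (fun t => comm (D t) (D' t)) =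
  endo_br (tder v D) (endo_of k (D' t)) + endo_br (endo_of k (D t)) (tder v D').
Proof.
move=> lD lD'; have gD := loc_good lD; have gD' := loc_good lD'.
have hD := opder_good v lD; have hD' := opder_good v lD'.
rewrite -(endo_of_comm hD gD') -(endo_of_comm gD hD').
rewrite -(endo_ofD (good_comm hD gD') (good_comm gD hD')).
rewrite [LHS](tderB v (loc_comp lD lD') (loc_comp lD' lD)) /tder.
have h1 := opder_good v (loc_comp lD lD').
have h2 := opder_good v (loc_comp lD' lD).
rewrite -(endo_ofB h1 h2); apply: endo_eq => s ss.
rewrite (endo_ofE (goodB h1 h2) ss).
rewrite (endo_ofE (goodD (good_comm hD gD') (good_comm gD hD')) ss).
change (opder d v (fun t s => D t (D' t s)) t s - opder d v (fun t s => D' t (D t s)) t s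
  = (opder d v D t (D' t s) - D' t (opder d v D t s))
    + (D t (opder d v D' t s) - opder d v D' t (D t s))).
rewrite (opder_comp v lD lD' ss) (opder_comp v lD' lD ss).
by rewrite (addrC (opder d v D' t (D t s))) opprD addrACA.
Qed.

Lemma tder_sum v (r : seq nat) (D : nat -> T -> op) :
  {in r, forall p, loc (D p)} ->
  tder v (fun t => \sum_(p <- r) D p t) = \sum_(p <- r) tder v (D p).
Proof.
elim: r => [|p r IH] lD.
  by under eq_fun do rewrite big_nil; rewrite big_nil tder0.
have lp : loc (D p) by apply: lD; rewrite inE eqxx.
have lr : {in r, forall q, loc (D q)} by move=> q qr; apply: lD; rewrite inE qr orbT.
under eq_fun do rewrite big_cons.
by rewrite (tderD v lp (loc_sum lr)) IH // big_cons.
Qed.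

End Derivation.

(** * The curvature of the Hitchin-Witten connection *)

Section Curvature.
Variables (C : fieldType) (V : lmodType C) (br : V -> V -> V).
Hypothesis brDl : forall x y z, br (x + y) z = br x z + br y z.
Hypothesis brZl : forall a x z, br (a *: x) z = a *: br x z.
Hypothesis brC : forall x y, br x y = - br y x.

(** The curvature of A = a b - a' bbar + dF on (v, w), sorted by monomials in a and a'. The brackets
    with dF complete the differentials of b and bbar to d^F b and d^F bbar. *)
Lemma curvature_expansion (bv bw cv cw fv fw bvw bwv cvw cwv fvw fwv : V) (a a' : C) :
  ((a *: bvw - a' *: cvw + fvw) - (a *: bwv - a' *: cwv + fwv))
  + br (a *: bv - a' *: cv + fv) (a *: bw - a' *: cw + fw) =
  (a *: (bvw - bwv + (br fv bw - br fw bv))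
   - a' *: (cvw - cwv + (br fv cw - br fw cv))
   - (a * a') *: (br bv cw - br bw cv) + (fvw - fwv + br fv fw))
  + ((a * a) *: br bv bw + (a' * a') *: br cv cw).
Proof.
have nl := brNl brZl; have nr := brNr brZl brC.
have dr := brDr brDl brC; have zr := brZr brZl brC.
rewrite !brDl !nl !dr !nr !brZl !zr !scalerDr !scalerN !scalerA !opprD !opprK.
rewrite (brC fw bv) (brC fw cv) (brC bw cv) !scalerN !opprK (mulrC a' a) !addrA.
by rewrite [LHS](ACl (1*4*13*9*2*5*14*12*8*10*3*6*15*7*11)).
Qed.

End Curvature.

(** Multiplied by 4 t conj(t), the identity becomes 2 conj(t) x - 2 t y - w + 4 t conj(t) z = 0, a
    polynomial of degree 2 in [sg]. Its values at 0, 1 and -1 determine the coefficients: the linear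
    one gives x + y = 0, the quadratic one z = 0, and then w = 4 k x. *)
Lemma central_scalars (R : realType) (k : nat) (x y w z : R[i]) : (0 < k)%N ->
  (forall sg : R, (2%:R * (k%:R +i* sg))^-1 * x
     - (2%:R * ((k%:R +i* sg)^*)%C)^-1 * y
     - ((2%:R * (k%:R +i* sg))^-1 * (2%:R * ((k%:R +i* sg)^*)%C)^-1) * w + z = 0) ->
  x + y = 0 /\ (2%:R * k%:R)^-1 * w - 2%:R * x = 0.
Proof.
move=> k0 H; have kR : (k%:R : R) != 0 by rewrite pnatr_eq0 -lt0n.
have n2 : (2%:R : R[i]) != 0 by rewrite pnatr_eq0.
have kC : (k%:R : R[i]) != 0 by rewrite pnatr_eq0 -lt0n.
have tn (sg : R) : (k%:R +i* sg : R[i]) != 0.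
  by rewrite eq_complex /= (negbTE kR).
have eqs (sg : R) : 2%:R * (k%:R +i* (- sg)) * x - 2%:R * (k%:R +i* sg) * y - w
    + 4%:R * ((k%:R +i* sg) * (k%:R +i* (- sg))) * z = 0.
  have e := congr1 (fun r => 4%:R * ((k%:R +i* sg) * (k%:R +i* (- sg))) * r) (H sg).
  rewrite mulr0 /= in e; rewrite -e; field.
  by rewrite !tn.
have kE : (k%:R +i* 0 : R[i]) = k%:R by rewrite -[RHS](rmorph_nat (real_complex R)).
have sE (s : R) : (k%:R +i* s : R[i]) = k%:R + (0 +i* s).
  by rewrite -kE; apply/eqP; rewrite eq_complex /= addr0 add0r !eqxx.
have iE : (0 +i* (-1) : R[i]) = - 'i%C by apply/eqP; rewrite eq_complex /= oppr0 !eqxx.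
have ii : ('i%C : R[i]) * 'i%C = -1 by rewrite -expr2 sqr_i.
have := eqs 0; rewrite oppr0 kE => e0.
have := eqs 1; rewrite !sE iE -['i%C]/(0 +i* 1) => e1.
have := eqs (-1); rewrite opprK !sE iE => e2.
move: ii e1 e2; move: ('i%C : R[i]) => I ii e1 e2.
have [n4 n8] : (4%:R : R[i]) != 0 /\ (8%:R : R[i]) != 0 by rewrite !pnatr_eq0.
(* The values at 1 and -1 differ by -4 i (x + y). *)
have xy : x + y = 0.
  have := congr2 (fun u v => I * (u - v)) e1 e2.
  rewrite /= subr0 mulr0 => e; apply: (mulfI n4); rewrite mulr0 -[RHS]e.
  ring: ii.
have yx : y = - x by apply/eqP; rewrite -addr_eq0 addrC xy.
(* The second difference of the values at -1, 0, 1 is 8 z. *)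
have z0 : z = 0.
  have := congr2 (fun u v => u - 2%:R * v) (congr2 (fun u v => u + v) e1 e2) e0.
  rewrite /= addr0 mulr0 subr0 => e; apply: (mulfI n8); rewrite mulr0 -[RHS]e.
  ring: ii.
have wx : w = 4%:R * k%:R * x.
  move: e0; rewrite z0 yx mulr0 addr0 => /eqP; rewrite subr_eq0 => /eqP <-; ring.
split=> //; rewrite wx; field; by rewrite kC.
Qed.

(** Matches the factor 1/2 in [HW_curvature] with the two equal terms of [wedge_comm] for a form
    wedged with itself. *)
Lemma endo_br_half (R : realType) (m : nat) (M : manifold 'rV[R]_m)
    (L : herm_line_bundle M) (k : nat) (x y : endo L k) :
  (2%:R)^-1 *: (endo_br x y - endo_br y x) = endo_br x y.
Proof.
rewrite (endo_brC y x) opprK -[endo_br x y]scale1r -scalerDl scalerA.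
by rewrite -[1 + 1]/(2%:R : R[i]) mulVf // pnatr_eq0.
Qed.

(** * The recursion sum, d^F and the curvature as endomorphisms of smooth sections *)

Section RecursionSum.
Variables (R : realType) (m : nat) (M : manifold 'rV[R]_m).
Variables (L : herm_line_bundle M) (k : nat) (n : nat).
Variables (T : complex_manifold R n) (d : atlas T) (t : T).
Hypothesis dt : dom d t.
Local Notation ET := ('rV[R]_n * 'rV[R]_n)%type.
Local Notation sec := (frame L -> M -> R[i]).
Local Notation op := (sec -> sec).
Variables (F : M -> T -> R).
Local Notation dtF := (@dTF R m M L n T F).
Variables (b bbar : atlas T -> ET -> T -> op).
Hypothesis lb : forall v, loc k d (b d v).
Hypothesis lbb : forall v, loc k d (bbar d v).
Hypothesis lF : forall v, loc k d (dtF d v).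

Local Notation E D := (endo_of k (D t)).
Local Notation q := ('i%C * k%:R : R[i]).
Local Notation twist x y p := (x - (-1) ^+ p *: y).

Section Sum.
Variables (RR : nat -> T -> op) (j : nat) (v : ET).
Hypothesis lR : forall p, (0 < p <= j)%N -> loc k d (RR (j - p)%N).

Let term p : T -> op := fun s => opscale (q ^+ p)
  (comm (b d v s - opscale ((-1) ^+ p) (bbar d v s)) (RR (j - p)%N s)).

Let loc_term : {in index_iota 1 j.+1, forall p, loc k d (term p)}.
Proof.
move=> p; rewrite mem_index_iota ltnS => /lR lRp.
exact: (locZ _ (loc_comm (locB (lb v) (locZ _ (lbb v))) lRp)).
Qed.

Lemma loc_recursion_sum : loc k d (recursion_sum k b bbar RR j d v).
Proof. exact: (loc_sum loc_term). Qed.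

Lemma endo_of_recursion_sum : E (recursion_sum k b bbar RR j d v) =
  \sum_(1 <= p < j.+1) q ^+ p *:
     endo_br (twist (E (b d v)) (E (bbar d v)) p) (E (RR (j - p)%N)).
Proof.
rewrite /recursion_sum big_nat_cond endo_of_sum; last first.
  by move=> p /andP[pj _]; apply: (loc_good dt (loc_term _)); rewrite mem_index_iota.
rewrite [RHS]big_nat_cond; apply: eq_bigr => p /andP[pj _].
have gR := loc_good dt (lR pj).
have gb := loc_good dt (lb v); have gc := loc_good dt (lbb v).
have gz := goodZ ((-1) ^+ p) gc.
rewrite (endo_ofZ _ (good_comm (goodB gb gz) gR)) (endo_of_comm (goodB gb gz) gR).
by rewrite (endo_ofB gb gz) (endo_ofZ _ gc).
Qed.

Lemma tder_recursion_sum u : tder k d t u (recursion_sum k b bbar RR j d v) =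
  \sum_(1 <= p < j.+1) q ^+ p *:
    (endo_br (twist (tder k d t u (b d v)) (tder k d t u (bbar d v)) p) (E (RR (j - p)%N))
     + endo_br (twist (E (b d v)) (E (bbar d v)) p) (tder k d t u (RR (j - p)%N))).
Proof.
rewrite [LHS](tder_sum dt u loc_term) big_nat_cond [RHS]big_nat_cond.
apply: eq_bigr => p /andP[pj _].
have lz := locZ ((-1) ^+ p) (lbb v); have lx := locB (lb v) lz.
rewrite (tderZ dt u (q ^+ p) (loc_comm lx (lR pj))) (tder_comm dt u lx (lR pj)).
rewrite (tderB dt u (lb v) lz) (tderZ dt u _ (lbb v)).
have gb := loc_good dt (lb v); have gc := loc_good dt (lbb v).
by rewrite (endo_ofB gb (goodZ _ gc)) (endo_ofZ _ gc).
Qed.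

End Sum.

Lemma endo_of_dF0 (D : T -> op) v : loc k d D ->
  endo_of k (dF0 F D d v t) = tder k d t v D + endo_br (E (dtF d v)) (E D).
Proof.
move=> lD; have gD := loc_good dt lD; have gF := loc_good dt (lF v).
by rewrite (endo_ofD (opder_good dt v lD) (good_comm gF gD)) (endo_of_comm gF gD).
Qed.

Lemma good_dF0 (D : T -> op) v : loc k d D -> good k (dF0 F D d v t).
Proof.
move=> lD; exact: (goodD (opder_good dt v lD)
  (good_comm (loc_good dt (lF v)) (loc_good dt lD))).
Qed.

Section DF1.
Variables (phi : atlas T -> ET -> T -> op) (v w : ET).
Hypothesis lphi : forall u, loc k d (phi d u).

Let gv u u' := opder_good dt u (lphi u').
Let gF u := loc_good dt (lF u).
Let gp u := loc_good dt (lphi u).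

Lemma good_dF1 : good k (dF1 F phi d v w t).
Proof.
exact: (goodD (goodB (gv v w) (gv w v))
  (goodB (good_comm (gF v) (gp w)) (good_comm (gF w) (gp v)))).
Qed.

Lemma endo_of_dF1 : endo_of k (dF1 F phi d v w t) =
  tder k d t v (phi d w) - tder k d t w (phi d v)
  + (endo_br (E (dtF d v)) (E (phi d w)) - endo_br (E (dtF d w)) (E (phi d v))).
Proof.
rewrite [LHS](endo_ofD (goodB (gv v w) (gv w v))
  (goodB (good_comm (gF v) (gp w)) (good_comm (gF w) (gp v)))).
congr (_ + _); first exact: (endo_ofB (gv v w) (gv w v)).
rewrite [LHS](endo_ofB (good_comm (gF v) (gp w)) (good_comm (gF w) (gp v))).
congr (_ - _); first exact: (endo_of_comm (gF v) (gp w)).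
exact: (endo_of_comm (gF w) (gp v)).
Qed.

End DF1.

Section HW.
Variables (sg : R) (v w : ET).
Local Notation a := ((2%:R * (k%:R +i* sg))^-1 : R[i]).
Local Notation a' := ((2%:R * ((k%:R +i* sg)^*)%C)^-1 : R[i]).

Let A u : T -> op := HW_form k F b bbar sg d u.

Let lA u : loc k d (A u).
Proof. exact: (locD (locB (locZ a (lb u)) (locZ a' (lbb u))) (lF u)). Qed.

Let E_A u : E (A u) = a *: E (b d u) - a' *: E (bbar d u) + E (dtF d u).
Proof.
have gb := loc_good dt (lb u); have gc := loc_good dt (lbb u).
have gF := loc_good dt (lF u).
rewrite [LHS](endo_ofD (goodB (goodZ a gb) (goodZ a' gc)) gF).
congr (_ + _); rewrite [LHS](endo_ofB (goodZ a gb) (goodZ a' gc)).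
congr (_ - _); first exact: (endo_ofZ a gb).
exact: (endo_ofZ a' gc).
Qed.

Let tder_A u u' : tder k d t u (A u') = a *: tder k d t u (b d u')
  - a' *: tder k d t u (bbar d u') + tder k d t u (dtF d u').
Proof.
rewrite [LHS](tderD dt u (locB (locZ a (lb u')) (locZ a' (lbb u'))) (lF u')).
congr (_ + _); rewrite [LHS](tderB dt u (locZ a (lb u')) (locZ a' (lbb u'))).
congr (_ - _); first exact: (tderZ dt u a (lb u')).
exact: (tderZ dt u a' (lbb u')).
Qed.

Lemma endo_of_HW_curvature : endo_of k (HW_curvature k F b bbar sg d v w t) =
  (tder k d t v (A w) - tder k d t w (A v)) + endo_br (E (A v)) (E (A w)).
Proof.
pose A' := HW_form k F b bbar sg.
have gv u u' := opder_good dt u (lA u').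
have gA u := loc_good dt (lA u).
have gw := goodB (good_comm (gA v) (gA w)) (good_comm (gA w) (gA v)).
rewrite [LHS](endo_ofD (goodB (gv v w) (gv w v)) (goodZ (2%:R)^-1 gw)).
congr (_ + _); first exact: (endo_ofB (gv v w) (gv w v)).
rewrite [LHS](endo_ofZ _ gw).
have -> : endo_of k (wedge_comm A' A' d v w t) =
    endo_br (E (A v)) (E (A w)) - endo_br (E (A w)) (E (A v)).
  rewrite [LHS](endo_ofB (good_comm (gA v) (gA w)) (good_comm (gA w) (gA v))).
  congr (_ - _); first exact: (endo_of_comm (gA v) (gA w)).
  exact: (endo_of_comm (gA w) (gA v)).
exact: endo_br_half.
Qed.

Lemma HW_curvature_expand : endo_of k (HW_curvature k F b bbar sg d v w t) =
  (a *: (endo_of k (dF1 F b d v w t)) - a' *: (endo_of k (dF1 F bbar d v w t))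
   - (a * a') *: (endo_br (E (b d v)) (E (bbar d w))
                  - endo_br (E (b d w)) (E (bbar d v)))
   + (tder k d t v (dtF d w) - tder k d t w (dtF d v)
      + endo_br (E (dtF d v)) (E (dtF d w))))
  + ((a * a) *: endo_br (E (b d v)) (E (b d w))
     + (a' * a') *: endo_br (E (bbar d v)) (E (bbar d w))).
Proof.
refine (etrans endo_of_HW_curvature _).
refine (etrans (congr2 +%R (congr2 (fun x y => x - y) (tder_A v w) (tder_A w v))
  (congr2 (@endo_br _ _ _ L k) (E_A v) (E_A w))) _).
refine (etrans (curvature_expansion (@endo_brDl _ _ _ L k) (@endo_brZl _ _ _ L k)
  (@endo_brC _ _ _ L k) _ _ _ _ _ _ _ _ _ _ _ _ _ _) _).
rewrite [X in _ = a *: X - _ - _ + _ + _](endo_of_dF1 v w lb).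
rewrite [X in _ = _ - a' *: X - _ + _ + _](endo_of_dF1 v w lbb).
reflexivity.
Qed.

End HW.

End RecursionSum.

(** * Consequences of centrality *)

Section Central.
Variables (R : realType) (m : nat) (M : manifold 'rV[R]_m).
Variables (L : herm_line_bundle M) (k : nat).
Local Notation sec := (frame L -> M -> R[i]).
Local Notation op := (sec -> sec).

Lemma central_br (K D : op) : central k K -> Dk k D ->
  endo_br (endo_of k K) (endo_of k D) = 0.
Proof.
move=> [DK cK] DD; have gK := Dk_good DK; have gD := Dk_good DD.
rewrite -(endo_of_comm gK gD) -endo_of0.
by apply (endo_of_opeq (good_comm gK gD) (@good0 _ _ _ L k)); exact: cK.
Qed.

(** [al /\ al](v, w) is twice the bracket of al(v) and al(w), so its centrality passes to that
    bracket. *)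
Lemma central_wedge_br (n : nat) (T : complex_manifold R n)
    (al : atlas T -> 'rV[R]_n * 'rV[R]_n -> T -> op) d v w t D :
  (forall u, good k (al d u t)) -> central k (wedge_comm al al d v w t) ->
  Dk k D ->
  endo_br (endo_br (endo_of k (al d v t)) (endo_of k (al d w t))) (endo_of k D) = 0.
Proof.
move=> ga cw DD; have gvw := good_comm (ga v) (ga w).
have gwv := good_comm (ga w) (ga v).
have e : endo_of k (wedge_comm al al d v w t) =
    endo_br (endo_of k (al d v t)) (endo_of k (al d w t))
    - endo_br (endo_of k (al d w t)) (endo_of k (al d v t)).
  refine (etrans (endo_ofB gvw gwv) _); congr (_ - _).
    exact: (endo_of_comm (ga v) (ga w)).
  exact: (endo_of_comm (ga w) (ga v)).
rewrite -[X in endo_br X _]endo_br_half -e.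
by rewrite endo_brZl (central_br cw DD) scaler0.
Qed.

(* The curvature is central for every t = k + i sg, so each coefficient of the
   resulting polynomial in sg is central. *)
Lemma central_coefficients (x y w z : endo L k) : (0 < k)%N ->
  (forall sg : R, (2%:R * (k%:R +i* sg))^-1 *: x
     - (2%:R * ((k%:R +i* sg)^*)%C)^-1 *: y
     - ((2%:R * (k%:R +i* sg))^-1 * (2%:R * ((k%:R +i* sg)^*)%C)^-1) *: w + z = 0) ->
  x + y = 0 /\ (2%:R * k%:R)^-1 *: w - 2%:R *: x = 0.
Proof.
move=> k0 H.
have vB (D D' : endo L k) s i p : \val (D - D') s i p = \val D s i p - \val D' s i p by [].
have vD (D D' : endo L k) s i p : \val (D + D') s i p = \val D s i p + \val D' s i p by [].
have vZ a (D : endo L k) s i p : \val (a *: D) s i p = a * \val D s i p by [].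
have v0 s i p : \val (0 : endo L k) s i p = 0 by [].
have pt s i p : \val x s i p + \val y s i p = 0 /\
    (2%:R * k%:R)^-1 * \val w s i p - 2%:R * \val x s i p = 0.
  apply: (central_scalars (z := \val z s i p) k0) => sg.
  have := congr1 (fun D : endo L k => \val D s i p) (H sg).
  by rewrite vD vB vB vZ vZ vZ v0.
split; apply: endo_eq => s _; apply/funext => i; apply/funext => p.
  by rewrite vD v0 (pt s i p).1.
by rewrite vB vZ vZ v0 (pt s i p).2.
Qed.

(** Bracketing with a fixed [D] turns centrality into an identity valid for every [sg]. The terms in
    a^2 and a'^2 vanish, and [central_coefficients] applies to the brackets of the other
    coefficients with [D]. *)
Lemma central_curvature (X Y W Z BB CC D : endo L k) : (0 < k)%N ->
  endo_br BB D = 0 -> endo_br CC D = 0 ->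
  (forall sg : R, let a : R[i] := (2%:R * (k%:R +i* sg))^-1 in
     let a' : R[i] := (2%:R * ((k%:R +i* sg)^*)%C)^-1 in
     endo_br ((a *: X - a' *: Y - (a * a') *: W + Z)
       + ((a * a) *: BB + (a' * a') *: CC)) D = 0) ->
  endo_br (X + Y) D = 0 /\
  endo_br ((2%:R * k%:R)^-1 *: W - 2%:R *: X) D = 0.
Proof.
move=> k0 eB eC H; have nl := brNl (@endo_brZl _ _ _ L k).
rewrite endo_brDl (endo_brDl _ _ D) nl !endo_brZl.
apply: (central_coefficients (z := endo_br Z D) k0) => sg.
have := H sg; move: (2%:R * (k%:R +i* sg))^-1 => a.
move: (2%:R * ((k%:R +i* sg)^*)%C)^-1 => a' /=.
by rewrite !endo_brDl !nl !endo_brZl eB eC !scaler0 !addr0.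
Qed.

End Central.

(** * Closedness of the right-hand side of the recursion *)

Theorem theorem2 (R : realType) (m n : nat)
  (M : manifold 'rV[R]_m) (om : atlas M -> M -> 'M[R]_m)
  (Hom : symplectic om) (HH1 : H1_zero M)
  (L : herm_line_bundle M) (HL : prequantum om L)
  (k : nat) (Hk : (0 < k)%N)
  (T : complex_manifold R n) (J : atlas M -> M -> T -> 'M[R]_m)
  (HJ : kahler_family om J)
  (Hfun : only_constant_holomorphic_functions J)
  (Hvf : no_holomorphic_vector_fields J)
  (F : M -> T -> R) (lam : R) (HF : ricci_potential om J F lam)
  (Hhol : holomorphic_family om J) (Hrigid : rigid om J)
  (b bbar : atlas T -> 'rV[R]_n * 'rV[R]_n -> T ->
            (frame L -> M -> R[i]) -> (frame L -> M -> R[i]))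
  (Hb : is_b k F om J lam b) (Hbbar : is_bbar k F om J lam bbar)
  (Hcurv : forall (sg : R) (d : atlas T) v w s, dom d s ->
     central k (HW_curvature k F b bbar sg d v w s))
  (Hbb : forall (d : atlas T) v w s, dom d s ->
     central k (wedge_comm b b d v w s))
  (Hbbarbbar : forall (d : atlas T) v w s, dom d s ->
     central k (wedge_comm bbar bbar d v w s))
  (l : nat) (Hl : (0 < l)%N)
  (RR : nat -> T -> (frame L -> M -> R[i]) -> (frame L -> M -> R[i]))
  (HRR : forall j, (j < l)%N -> smooth_op k (RR j))
  (Hrec : forall j, (j < l)%N -> forall (d : atlas T) v s, dom d s ->
     opeq k (dF0 F (RR j) d v s)
            (opscale (2%:R * k%:R)^-1 (recursion_sum k b bbar RR j d v s))) :
  forall (d : atlas T) v w s, dom d s ->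
    opeq k (dF1 F (recursion_sum k b bbar RR l) d v w s) 0.
Proof.
move=> d v w t dt; have sF : smooth2 setT F by case: HF.
have lb u : loc k d (b d u) by exact: (@b_locop _ _ _ _ _ _ _ om J Hom HJ F lam sF b d u Hb).
have lc u : loc k d (bbar d u) by exact: (@bbar_locop _ _ _ _ _ _ _ om J Hom HJ F lam sF bbar d u Hbbar).
have lF u : loc k d (@dTF R m M L n T F d u) by exact: (@dTF_locop _ _ _ L k _ _ F sF d u).
have lR j : (j < l)%N -> loc k d (RR j).
  by move=> jl; exact: (smooth_op_locop d (HRR j jl)).
have DR j : (j < l)%N -> Dk k (RR j t) by move=> /HRR[].
have lRl p : (0 < p <= l)%N -> loc k d (RR (l - p)%N).
  by move=> pl; apply: lR; lia.
have lS u := loc_recursion_sum lb lc u lRl.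
(* Agreement on smooth sections becomes an equality in the Lie algebra [endo], at the fixed point
   [t]. *)
apply (endo_of_opeq (good_dF1 dt lF v w lS) (@good0 _ _ _ L k)).
rewrite endo_of0 (endo_of_dF1 dt lF v w lS).
rewrite (tder_recursion_sum dt lb lc w lRl v) (tder_recursion_sum dt lb lc v lRl w).
rewrite (endo_of_recursion_sum dt lb lc v lRl).
rewrite (endo_of_recursion_sum dt lb lc w lRl).
have recursion u j : (j < l)%N ->
    tder k d t u (RR j) + endo_br (endo_of k (@dTF R m M L n T F d u t)) (endo_of k (RR j t)) =
    (2%:R * k%:R)^-1 *: \sum_(1 <= r < j.+1) ('i%C * k%:R) ^+ r *:
      endo_br (endo_of k (b d u t) - (-1) ^+ r *: endo_of k (bbar d u t))
        (endo_of k (RR (j - r)%N t)).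
  move=> jl; have lRj p : (0 < p <= j)%N -> loc k d (RR (j - p)%N).
    by move=> pj; apply: lR; lia.
  have lSj := loc_recursion_sum lb lc u lRj.
  rewrite -(endo_of_recursion_sum dt lb lc u lRj) -(endo_of_dF0 dt lF u (lR j jl)).
  rewrite -(endo_ofZ _ (loc_good dt lSj)).
  apply (endo_of_opeq (good_dF0 dt lF u (lR j jl)) (goodZ _ (loc_good dt lSj))).
  exact: (Hrec j jl d u t dt).
have cbb j (jl : (j < l)%N) := central_wedge_br (fun u => loc_good dt (lb u))
  (Hbb d v w t dt) (DR j jl).
have ccc j (jl : (j < l)%N) := central_wedge_br (fun u => loc_good dt (lc u))
  (Hbbarbbar d v w t dt) (DR j jl).
(* For every [sg] the expanded curvature is bracketed with R^(j)(D), which lies in D_k, so that its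
   centrality can be used. *)
have cHW j (jl : (j < l)%N) := central_curvature Hk (cbb j jl) (ccc j jl)
  (fun sg => etrans (congr1 (fun K => endo_br K _)
     (esym (HW_curvature_expand dt lb lc lF sg v w)))
     (central_br (Hcurv sg d v w t dt) (DR j jl))).
rewrite (endo_of_dF1 dt lF v w lb) (endo_of_dF1 dt lF v w lc) in cHW.
(* Unification takes q = i k and h = 1/(2k). The prefactor of the recursion agrees with the constant
   in the relation obtained from the curvature, and the cancellation rests on this agreement. *)
exact: (@lie_recursion_closed _ _ _ (@endo_brDl _ _ _ L k) (@endo_brZl _ _ _ L k)
  (@endo_brC _ _ _ L k) (@endo_jacobi _ _ _ L k) _ _ _ _ _ _ _ _ _ _ _ _ _
  (fun j => endo_of k (RR j t)) (fun j => tder k d t v (RR j))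
  (fun j => tder k d t w (RR j)) (recursion v) (recursion w)
  (fun j jl => (cHW j jl).1) (fun j jl => (cHW j jl).2) cbb ccc).
Qed.
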